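(* Let $B=\{B_t,t\in[0,1]\}$ be a standard Brownian motion and, for $n\ge1$, let $Z_n=\delta(u_n)=\sqrt n\int_0^1t^nB_t\,dB_t$, where $u_n(t)=\sqrt n\,t^nB_t$, $t\in[0,1]$. Let $\zeta\sim N(0,1)$ be independent of $B$. Then for every $f\in C^3_b(\mathbb R)$, $$E[f(Z_n)]=E\Big[f\big(\tfrac1{\sqrt2}|B_1|\zeta\big)\Big]+\frac1{3\sqrt n}E\Big[B_1^2\,f^{(3)}\big(\tfrac1{\sqrt2}|B_1|\zeta\big)\Big]+o(n^{-1/2})\qquad(n\to\infty).$$
   Context: $\delta$ is the Skorohod (here Itô) integral with respect to $B$. $C_b^3(\mathbb R)$ is the space of functions with bounded continuous derivatives up to order 3. *)

(* Defs.v *)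
(* MathComp-Analysis *)
From HB Require Import structures.
From mathcomp Require Import all_boot all_order all_algebra.
From mathcomp Require Import all_classical all_reals all_analysis.

Set Implicit Arguments.
Unset Strict Implicit.
Unset Printing Implicit Defensive.

Import Order.TTheory GRing.Theory Num.Theory.
Import numFieldNormedType.Exports.

Local Open Scope classical_set_scope.
Local Open Scope ring_scope.

(* A process is indexed by all of R, but every definition below constrains it
   and uses it on [0, 1] only. *)

(* F_t = sigma(B_s : 0 <= s <= t) *)
Definition natural_filtration (R : realType) (d : measure_display)
    (T : measurableType d) (B : R -> T -> R) (t : R) : set (set T) :=
  <<s [set E | exists s, exists A : set R,
         [/\ 0 <= s <= t, measurable A & E = B s @^-1` A]] >>.

Definition indep_RV_sigma (R : realType) (d : measure_display)
    (T : measurableType d) (P : probability T R) (X : T -> R)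
    (F : set (set T)) : Prop :=
  forall (A : set R) (E : set T), measurable A -> F E ->
    P ((X @^-1` A) `&` E) = (P (X @^-1` A) * P E)%E.

(* [sigma] is the standard deviation, as in [normal_prob] *)
Definition has_normal_law (R : realType) (d : measure_display)
    (T : measurableType d) (P : probability T R) (X : T -> R)
    (m sigma : R) : Prop :=
  forall A : set R, measurable A -> P (X @^-1` A) = normal_prob m sigma A.

Definition standard_brownian_motion (R : realType) (d : measure_display)
    (T : measurableType d) (P : probability T R)
    (B : R -> {RV P >-> R}) : Prop :=
  [/\ {ae P, forall w, B 0 w = 0},
      forall s t, 0 <= s -> s < t -> t <= 1 ->
        has_normal_law P (fun w => B t w - B s w) 0 (Num.sqrt (t - s)),
      forall s t, 0 <= s -> s < t -> t <= 1 ->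
        indep_RV_sigma P (fun w => B t w - B s w)
          (natural_filtration (fun r => B r : T -> R) s)
    & {ae P, forall w, {within `[0, 1], continuous (fun t => B t w)}}].

(* The process \sum_(i < sp_size) xi_i 1_(t_i, t_(i+1)]. *)
Record simple_process (R : realType) (T : Type) := SimpleProcess {
  sp_size : nat;
  sp_node : nat -> R;
  sp_coef : nat -> T -> R }.

Definition adapted_simple (R : realType) (d : measure_display)
    (T : measurableType d) (B : R -> T -> R) (X : simple_process R T) : Prop :=
  [/\ 0 <= sp_node X 0%N, sp_node X (sp_size X) <= 1,
      forall i, (i < sp_size X)%N -> sp_node X i <= sp_node X i.+1,
      forall i, (i < sp_size X)%N -> forall A : set R, measurable A ->
        natural_filtration B (sp_node X i) (sp_coef X i @^-1` A)
    & forall i, (i < sp_size X)%N ->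
        exists M : R, forall w, `|sp_coef X i w| <= M].

Definition sp_val (R : realType) (T : Type) (X : simple_process R T)
    (t : R) (w : T) : R :=
  \sum_(i < sp_size X)
    sp_coef X i w * \1_(`]sp_node X i, sp_node X i.+1]%classic) t.

Definition sp_int (R : realType) (T : Type) (B : R -> T -> R)
    (X : simple_process R T) (w : T) : R :=
  \sum_(i < sp_size X)
    sp_coef X i w * (B (sp_node X i.+1) w - B (sp_node X i) w).

(* [Z] is a version of the Ito integral delta(u) = \int_0^1 u_t dB_t: it is the
   L^2(P)-limit of the elementary integrals of simple adapted processes that
   converge to [u] in L^2([0, 1] x Omega).  An integral is only determined up
   to null sets, hence a relation. *)
Definition is_ito_integral (R : realType) (d : measure_display)
    (T : measurableType d) (P : probability T R) (B : R -> {RV P >-> R})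
    (u : R -> T -> R) (Z : T -> R) : Prop :=
  exists X : nat -> simple_process R T,
    [/\ forall k, adapted_simple (fun t => B t : T -> R) (X k),
        (fun k => \int[lebesgue_measure]_(t in `[0%R, 1%R])
                    'E_P[fun w => ((sp_val (X k) t w - u t w) ^+ 2)%R])%E @ \oo
          --> 0%E
      & (fun k => 'E_P[fun w =>
                    ((sp_int (fun t => B t : T -> R) (X k) w - Z w) ^+ 2)%R])%E @ \oo
          --> 0%E].

(* C^3_b(R): f is of class C^3 and f', f'', f''' are bounded.  f itself need not
   be bounded; the convention that also bounds f defines a subclass. *)
Definition C3b (R : realType) (f : R -> R) : Prop :=
  [/\ forall k, (k < 3)%N -> forall x, derivable f^`(k)%classic x 1,
      forall k, (k <= 3)%N -> continuous f^`(k)%classic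
    & forall k, (0 < k <= 3)%N -> exists M : R, forall x, `|f^`(k)%classic x| <= M].

(* Main.v *)
(* Only the times close to 1 contribute to Z_n. Put tau = 1 - n^(-3/4) and
   discretise (tau, 1] by a fine grid tau = t_0 < ... < t_N = 1 of step h with
   increments x_i. By the Ito isometry Z_n is, up to o(n^(-1/2)) in L^2, the sum
   S = sum_i a_i B_(t_i) x_i with a_i = sqrt n t_i^n, and S = B_tau g + r where
   g = sum_i a_i x_i is a Gaussian variable independent of B_tau and
   r = sum_i a_i (B_(t_i) - B_tau) x_i is a small element of the second chaos.
   By Taylor E f(S) = E f(B_tau g) + E[f'(B_tau g) r] + O(E r^2), and two
   Gaussian integrations by parts give
   E[f'(B_tau g) r] = kappa E[B_tau^2 f'''(B_tau g)] with
   kappa = sum_(j < i) h^2 a_i^2 a_j, where sqrt n kappa tends to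
   int_0^1 r^2 dr = 1/3 (put r = t^n). Finally (B_tau, g) has the law of
   (sqrt tau B_1, sqrt v sgn(B_1) zeta) with v = h sum_i a_i^2, tau v = 1/2 +
   O(n^(-3/4)), and f' is bounded, so both expectations may be replaced by those
   at |B_1| zeta / sqrt 2. *)
Require Import Defs.
From HB Require Import structures.
From mathcomp Require Import all_boot all_order all_algebra.
From mathcomp Require Import all_classical all_reals all_analysis.
From mathcomp Require Import measurable_realfun ring lra.

Import Order.TTheory GRing.Theory Num.Theory.
Import numFieldNormedType.Exports.

Local Open Scope classical_set_scope.
Local Open Scope ring_scope.

Set Implicit Arguments.
Unset Strict Implicit.
Unset Printing Implicit Defensive.

(** * Square-integrable random variables *)

Section moments.
Context (R : realType) (d : measure_display) (T : measurableType d).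
Variable P : probability T R.
Implicit Types X Y : T -> R.

(** The exponent 3/4 lies strictly between 1/2 and 1. The Taylor remainder is controlled by E r^2 <=
    (1 - tau) v, which is o(n^(-1/2)) because 3/4 > 1/2; the part of the integral before tau has
    second moment at most n tau^(2n), of order n exp(- 2 n^(1/4)), which is negligible because 3/4 <
    1. The expansion is made around B_tau because the increments after tau are independent of it:
    B_tau g is exactly a product of two independent Gaussian variables, and the correction of order
    n^(-1/2) comes from r alone, through its dependence on g. On a grid the Malliavin integration by
    parts becomes Stein's identity in a single Gaussian increment, the other variables being frozen
    by independence; the mesh h makes n^2 h tend to 0, so its cost is invisible in the result. Every
    error has an explicit rate in q = n^(-1/4) except one: f''' is merely continuous, so its
    expectation at the scale sqrt(tau v) converges to the one at 1 / sqrt 2 by dominated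
    convergence, without a rate. Hence a little o. *)

Definition L1 X := P.-integrable [set: T] (EFin \o X).
Definition L2 X := measurable_fun [set: T] X /\ L1 (fun w => X w ^+ 2).
(** [Rintegral] sends an infinite integral to 0, so the value is a true expectation only under [L1];
    the linearity lemmas carry that hypothesis. *)
Definition mean X : R := \int[P]_w X w.

Lemma L1_measurable X : L1 X -> measurable_fun [set: T] X.
Proof. by move=> /integrableP[/measurable_EFinP]. Qed.

Lemma L2_measurable X : L2 X -> measurable_fun [set: T] X.
Proof. by case. Qed.

Lemma le_L1 X Y : measurable_fun [set: T] X -> L1 Y ->
  (forall w, `|X w| <= `|Y w|) -> L1 X.
Proof.
move=> mX iY XY; apply: le_integrable iY => //; first exact/measurable_EFinP.
by move=> w _ /=; rewrite lee_fin.
Qed.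

Lemma L1D X Y : L1 X -> L1 Y -> L1 (fun w => X w + Y w).
Proof. by move=> iX iY; exact: (integrableD measurableT iX iY). Qed.

Lemma L1B X Y : L1 X -> L1 Y -> L1 (fun w => X w - Y w).
Proof. by move=> iX iY; exact: (integrableB measurableT iX iY). Qed.

Lemma L1Z (c : R) X : L1 X -> L1 (fun w => c * X w).
Proof. by move=> iX; exact: (integrableZl measurableT c iX). Qed.

Lemma L1_cst (c : R) : L1 (fun=> c).
Proof. exact: finite_measure_integrable_cst. Qed.

Lemma L1_abs X : L1 X -> L1 (fun w => `|X w|).
Proof. by move=> iX; exact: integrable_norm. Qed.

Lemma L1_sum (I : Type) (s : seq I) (X : I -> T -> R) : (forall i, L1 (X i)) ->
  L1 (fun w => \sum_(i <- s) X i w).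
Proof.
move=> iX; rewrite /L1.
rewrite [X in _.-integrable _ X](_ : _ =
  (fun w => (\sum_(i <- s) (EFin \o X i) w)%E)); last first.
  by apply/funext => w /=; rewrite sumEFin.
by apply: (integrable_sum measurableT) => i _; exact: iX.
Qed.

Lemma L1_bounded X Y (M : R) : measurable_fun [set: T] X ->
  (forall w, `|X w| <= M) -> L1 Y -> L1 (fun w => Y w * X w).
Proof.
move=> mX XM iY; apply: (@le_L1 _ (fun w => M * Y w)).
- by apply: measurable_funM => //; exact: L1_measurable.
- exact: L1Z.
- move=> w; rewrite !normrM mulrC ler_wpM2r//.
  by rewrite (le_trans (XM w)) // ler_norm.
Qed.

Lemma mean_cst (c : R) : mean (fun=> c) = c.
Proof.
by rewrite /mean Rintegral_cst//= probability_setT mulr1.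
Qed.

Lemma meanD X Y : L1 X -> L1 Y -> mean (fun w => X w + Y w) = mean X + mean Y.
Proof. exact: RintegralD. Qed.

Lemma meanB X Y : L1 X -> L1 Y -> mean (fun w => X w - Y w) = mean X - mean Y.
Proof. exact: RintegralB. Qed.

Lemma meanZ (c : R) X : L1 X -> mean (fun w => c * X w) = c * mean X.
Proof. exact: RintegralZl. Qed.

Lemma le_mean X Y : L1 X -> L1 Y -> (forall w, X w <= Y w) -> mean X <= mean Y.
Proof. by move=> iX iY XY; apply: le_Rintegral. Qed.

Lemma eq_mean X Y : (forall w, X w = Y w) -> mean X = mean Y.
Proof. by move=> XY; apply: eq_Rintegral. Qed.

Lemma mean_ge0 X : (forall w, 0 <= X w) -> 0 <= mean X.
Proof. by move=> X0; apply: Rintegral_ge0. Qed.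

Lemma norm_mean X : L1 X -> `|mean X| <= mean (fun w => `|X w|).
Proof. by move=> iX; exact: le_normr_Rintegral. Qed.

Lemma mean_sum (I : Type) (s : seq I) (X : I -> T -> R) :
  (forall i, L1 (X i)) ->
  mean (fun w => \sum_(i <- s) X i w) = \sum_(i <- s) mean (X i).
Proof.
move=> iX; elim: s => [|i s IH].
  by rewrite big_nil -[RHS](mean_cst 0); apply: eq_mean => w; rewrite big_nil.
rewrite big_cons -IH -meanD//; last exact: L1_sum.
by apply: eq_mean => w; rewrite big_cons.
Qed.

Lemma EFin_mean X : L1 X -> (\int[P]_w (X w)%:E = (mean X)%:E)%E.
Proof. by move=> iX; rewrite /mean /Rintegral fineK// integrable_fin_num. Qed.

Lemma fine_expectation X : fine 'E_P[X]%E = mean X.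
Proof. by rewrite unlock. Qed.

Lemma L1M X Y : L2 X -> L2 Y -> L1 (fun w => X w * Y w).
Proof.
move=> [mX iX] [mY iY]; apply: (@le_L1 _ (fun w => X w ^+ 2 + Y w ^+ 2)).
- exact: measurable_funM.
- exact: L1D.
- move=> w; rewrite normrM [leRHS]ger0_norm ?addr_ge0 ?sqr_ge0//.
  rewrite -[X w ^+ 2]real_normK ?num_real// -[Y w ^+ 2]real_normK ?num_real//.
  have := sqr_ge0 (`|X w| - `|Y w|).
  by have := normr_ge0 (X w); have := normr_ge0 (Y w); nra.
Qed.

Lemma L2_cst (c : R) : L2 (fun=> c).
Proof. by split; [exact: measurable_cst|exact: L1_cst]. Qed.

Lemma L2_L1 X : L2 X -> L1 X.
Proof.
move=> iX; rewrite (_ : X = fun w => X w * 1); last first.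
  by apply/funext => w; rewrite mulr1.
by apply: L1M => //; exact: L2_cst.
Qed.

Lemma L2D X Y : L2 X -> L2 Y -> L2 (fun w => X w + Y w).
Proof.
move=> hX hY; have [mX iX] := hX; have [mY iY] := hY; split.
  exact: measurable_funD.
rewrite (_ : (fun w => _) =
    fun w => X w ^+ 2 + Y w ^+ 2 + (2 * (X w * Y w))); last first.
  by apply/funext => w; ring.
by apply: L1D; [exact: L1D|apply: L1Z; exact: L1M].
Qed.

Lemma L2Z (c : R) X : L2 X -> L2 (fun w => c * X w).
Proof.
move=> [mX iX]; split; first exact: measurable_funM.
rewrite (_ : (fun w => _) = fun w => c ^+ 2 * X w ^+ 2); last first.
  by apply/funext => w; rewrite exprMn.
exact: L1Z.
Qed.

Lemma L2B X Y : L2 X -> L2 Y -> L2 (fun w => X w - Y w).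
Proof.
move=> iX iY; rewrite (_ : (fun w => _) = fun w => X w + (-1) * Y w); last first.
  by apply/funext => w; ring.
by apply: L2D => //; exact: L2Z.
Qed.

Lemma L2_sum (I : Type) (s : seq I) (X : I -> T -> R) : (forall i, L2 (X i)) ->
  L2 (fun w => \sum_(i <- s) X i w).
Proof.
move=> iX; elim: s => [|i s IH].
  by under eq_fun do rewrite big_nil; exact: L2_cst.
by under eq_fun do rewrite big_cons; exact: L2D.
Qed.

(** The variance of |X| is nonnegative. *)
Lemma mean_norm_le_sqrt X : L2 X ->
  mean (fun w => `|X w|) <= Num.sqrt (mean (fun w => X w ^+ 2)).
Proof.
move=> iX; set m := mean _; have i1 := L1_abs (L2_L1 iX).
rewrite -[leLHS]ger0_norm; last exact: mean_ge0.
rewrite -sqrtr_sqr ler_wsqrtr//.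
have : 0 <= mean (fun w => (`|X w| - m) ^+ 2).
  by apply: mean_ge0 => w; rewrite sqr_ge0.
rewrite (_ : mean _ =
    mean (fun w => X w ^+ 2 - (2 * m * `|X w| - m ^+ 2))); last first.
  apply: eq_mean => w; rewrite -[X w ^+ 2]real_normK ?num_real//; ring.
have i2 : L1 (fun w => 2 * m * `|X w|) by exact: L1Z.
rewrite meanB; [|by case: iX|apply: L1B => //; exact: L1_cst].
by rewrite meanB//; [|exact: L1_cst]; rewrite meanZ// mean_cst -/m; lra.
Qed.

End moments.

(** * Gaussian laws *)

Local Notation pushforward_measure :=
  measure_function_pushforward__canonical__measure_function_Measure.

Section normal_law.
Context (R : realType).
Local Notation mu := (@lebesgue_measure R).

Lemma measurable_affine (c b : R) :
  measurable_fun [set: R] (fun x : R => c * x + b).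
Proof. by apply: measurable_funD => //; exact: measurable_funM. Qed.

(** The left side, as a measure in A, gives each interval ]x, y] its length, and Lebesgue measure is
    the only measure that does. A negative slope flips the half-open interval, hence two cases. *)
Lemma lebesgue_measure_affine (c b : R) (A : set R) : c != 0 ->
  measurable A ->
  (`|c|%:E * mu ((fun x : R => (c * x + b)%R) @^-1` A) = mu A)%E.
Proof.
move=> c0 mA.
have mphi : measurable_fun [set: measurableTypeR R]
    (fun x : measurableTypeR R => (c * x + b)%R : measurableTypeR R).
  exact: measurable_affine.
pose m := mscale (NngNum (normr_ge0 c)) (pushforward_measure mu mphi).
suff : mu A = m A by [].
apply: lebesgue_measure_unique => // _ [[x y]] _ <- /=.
rewrite /m /mscale/= /pushforward.
case: (ltrgt0P c) c0 => // cs _.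
  rewrite (_ : _ @^-1` _ = `](x - b) / c, (y - b) / c]%classic); last first.
    apply/seteqP; split => z /=; rewrite !in_itv/= => /andP[z1 z2];
    by apply/andP; move: z1 z2;
      rewrite ltr_pdivrMr// ler_pdivlMr// ltrBlDr lerBrDr ![z * c]mulrC.
  rewrite !lebesgue_measure_itv/= !lte_fin ltr_pM2r ?invr_gt0// ltrD2r.
  case: ifPn => _; last by rewrite mule0.
  by rewrite -!EFinD -EFinM; congr EFin; field; rewrite gt_eqF.
rewrite (_ : _ @^-1` _ = `[(y - b) / c, (x - b) / c[%classic); last first.
  apply/seteqP; split => z /=; rewrite !in_itv/= => /andP[z1 z2];
  by apply/andP; move: z1 z2;
    rewrite ltr_ndivlMr// ler_ndivrMr// ltrBlDr lerBrDr ![z * c]mulrC.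
rewrite !lebesgue_measure_itv/= !lte_fin ltr_nM2r ?invr_lt0// ltrD2r.
case: ifPn => _; last by rewrite mule0.
by rewrite -!EFinD -EFinM; congr EFin; field; rewrite lt_eqF.
Qed.

Lemma ge0_integral_affine (c b : R) (g : R -> \bar R) : c != 0 ->
  measurable_fun [set: R] g -> (forall x, 0 <= g x)%E ->
  (\int[mu]_x g x = `|c|%:E * \int[mu]_x g (c * x + b)%R)%E.
Proof.
move=> c0 mg g0.
have mphi : measurable_fun [set: measurableTypeR R]
    (fun x : measurableTypeR R => (c * x + b)%R : measurableTypeR R).
  exact: measurable_affine.
pose m := mscale (NngNum (normr_ge0 c)) (pushforward_measure mu mphi).
rewrite (eq_measure_integral m); last first.
  by move=> A mA _; rewrite /= /m /mscale/= lebesgue_measure_affine.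
by rewrite ge0_integral_mscale//= ge0_integral_pushforward.
Qed.

Lemma normal_pdf_scale (c s x : R) : c != 0 -> 0 < s ->
  normal_pdf 0 s x = `|c| * normal_pdf 0 (`|c| * s) (c * x).
Proof.
move=> c0 s0; have cs0 : `|c| * s != 0 by rewrite mulf_neq0// ?normr_eq0// gt_eqF.
rewrite !normal_pdfE// ?gt_eqF// /normal_peak /normal_fun.
rewrite mulrA; congr (_ * expR _); last first.
  rewrite !subr0 !exprMn real_normK ?num_real//.
  by field; rewrite c0 gt_eqF.
rewrite (_ : (`|c| * s) ^+ 2 * pi *+ 2 = `|c| ^+ 2 * (s ^+ 2 * pi *+ 2)); last by ring.
rewrite sqrtrM ?sqr_ge0// sqrtr_sqr normr_id.
by rewrite invfM mulrA divff ?mul1r// normr_eq0.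
Qed.

Lemma normal_prob_scale (c s : R) (A : set R) : c != 0 -> 0 < s ->
  measurable A ->
  normal_prob 0 s ((fun x => c * x) @^-1` A) = normal_prob 0 (`|c| * s) A.
Proof.
move=> c0 s0 mA; rewrite /normal_prob.
rewrite [LHS]integral_mkcond [RHS]integral_mkcond.
rewrite [RHS](@ge0_integral_affine c 0)//; last 2 first.
- apply/(measurable_restrictT _ _).1 => //.
  by apply/measurable_EFinP/measurable_funTS; exact: measurable_normal_pdf.
- by move=> x; apply: erestrict_ge0 => y _; rewrite lee_fin normal_pdf_ge0.
rewrite -ge0_integralZl//; last 2 first.
- apply: measurableT_comp; last exact: measurable_affine.
  apply/(measurable_restrictT _ _).1 => //.
  by apply/measurable_EFinP/measurable_funTS; exact: measurable_normal_pdf.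
- by move=> x _; apply: erestrict_ge0 => y _; rewrite lee_fin normal_pdf_ge0.
apply: eq_integral => x _; rewrite !patchE addr0.
have -> : (x \in (fun x => c * x) @^-1` A) = (c * x \in A).
  by apply/idP/idP; rewrite !inE.
case: ifPn => _; last by rewrite mule0.
by rewrite -EFinM; congr EFin; exact: normal_pdf_scale.
Qed.

(* Completing the square in the product of two Gaussian densities. *)
Lemma normal_pdf_mul (p q z y : R) : 0 < p -> 0 < q ->
  let s := Num.sqrt (p ^+ 2 + q ^+ 2) in
  normal_pdf 0 p (z - y) * normal_pdf 0 q y =
  normal_pdf 0 s z * normal_pdf (z * q ^+ 2 / s ^+ 2) (p * q / s) y.
Proof.
move=> p0 q0 s.
have s2 : s ^+ 2 = p ^+ 2 + q ^+ 2.
  by rewrite sqr_sqrtr// addr_ge0// sqr_ge0.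
have s0 : 0 < s by rewrite sqrtr_gt0 addr_gt0// exprn_gt0.
have pqs : p * q / s != 0 by rewrite gt_eqF// divr_gt0// mulr_gt0.
rewrite !normal_pdfE// ?gt_eqF// /normal_fun /normal_peak.
rewrite mulrACA [RHS]mulrACA -!expRD; congr (_ * expR _); last first.
  have nz : p ^+ 2 + q ^+ 2 != 0 by rewrite -s2 expf_neq0// gt_eqF.
  rewrite !expr_div_n !exprMn s2.
  by field; rewrite nz !gt_eqF.
have pp := @pi_gt0 R.
have h (x : R) : 0 <= x ^+ 2 * pi *+ 2 by rewrite mulrn_wge0// mulr_ge0 ?sqr_ge0// ltW.
rewrite -!invfM -!sqrtrM//; congr (Num.sqrt _)^-1.
rewrite !expr_div_n !exprMn.
by field; rewrite gt_eqF.
Qed.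

(** After the substitution z = x + y and Tonelli, completing the square turns the integral over y
    into that of a Gaussian density, which is one. *)
Lemma normal_prob_convolution (p q : R) (A : set R) : 0 < p -> 0 < q ->
  measurable A ->
  (\int[mu]_x \int[mu]_y
    (\1_A (x + y)%R * normal_pdf 0 p x * normal_pdf 0 q y)%R%:E =
   normal_prob 0 (Num.sqrt (p ^+ 2 + q ^+ 2)) A)%E.
Proof.
move=> p0 q0 mA; set s := Num.sqrt _.
have mA1 : measurable_fun [set: R * R] (fun z : R * R => \1_A (z.1 + z.2) : R).
  apply: (measurableT_comp (f := (\1_A : R -> R))); first exact: measurable_indic.
  exact: measurable_funD.
have m1 (r : R) : measurable_fun [set: R * R] (fun z : R * R => normal_pdf 0 r z.1).
  by apply: (measurableT_comp (f := normal_pdf 0 r)) => //; exact: measurable_normal_pdf.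
have m2 (r : R) : measurable_fun [set: R * R] (fun z : R * R => normal_pdf 0 r z.2).
  by apply: (measurableT_comp (f := normal_pdf 0 r)) => //; exact: measurable_normal_pdf.
pose F (z : R * R) := (\1_A (z.1 + z.2) * normal_pdf 0 p z.1 * normal_pdf 0 q z.2)%:E.
have mF : measurable_fun [set: R * R] F.
  by apply/measurable_EFinP; apply: measurable_funM => //; exact: measurable_funM.
rewrite (fubini_tonelli (m1 := mu) (m2 := mu) F)//=; last first.
  by move=> z; rewrite lee_fin !mulr_ge0 ?normal_pdf_ge0.
transitivity (\int[mu]_y \int[mu]_z
    (\1_A z * normal_pdf 0 p (z - y) * normal_pdf 0 q y)%R%:E)%E.
  apply: eq_integral => y _; rewrite [RHS](@ge0_integral_affine 1 y)//.
  - rewrite normr1 mul1e; apply: eq_integral => x _.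
    by rewrite /F/= mul1r addrK.
  - apply/measurable_EFinP; apply: measurable_funM => //; apply: measurable_funM.
      exact: measurable_indic.
    apply: measurableT_comp; first exact: measurable_normal_pdf.
    exact: measurable_funB.
  - by move=> z; rewrite lee_fin !mulr_ge0 ?normal_pdf_ge0.
pose G (z : R * R) := (\1_A z.2 * normal_pdf 0 p (z.2 - z.1) * normal_pdf 0 q z.1)%:E.
have mG : measurable_fun [set: R * R] G.
  apply/measurable_EFinP; apply: measurable_funM => //; apply: measurable_funM.
    by apply: (measurableT_comp (f := (\1_A : R -> R))).
  apply: (measurableT_comp (f := normal_pdf 0 p)); first exact: measurable_normal_pdf.
  exact: measurable_funB.
rewrite (fubini_tonelli (m1 := mu) (m2 := mu) G)//=; last first.
  by move=> z; rewrite lee_fin !mulr_ge0 ?normal_pdf_ge0.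
rewrite /normal_prob [RHS]integral_mkcond; apply: eq_integral => z _.
rewrite (eq_integral (fun y : measurableTypeR R => (\1_A z * normal_pdf 0 s z)%:E *
  (normal_pdf (z * q ^+ 2 / s ^+ 2) (p * q / s) y)%:E)%E); last first.
  move=> y _; rewrite /G/= -EFinM; congr EFin.
  by rewrite -mulrA -[RHS]mulrA; congr (_ * _); exact: normal_pdf_mul.
rewrite ge0_integralZl//; last 3 first.
- by apply/measurable_EFinP; exact: measurable_normal_pdf.
- by move=> y _; rewrite lee_fin normal_pdf_ge0.
- by rewrite lee_fin mulr_ge0 ?normal_pdf_ge0.
rewrite integral_normal_pdf mule1 patchE indicE.
by case: (z \in A); rewrite ?mul1r ?mul0r.
Qed.

End normal_law.

(** * Integration against a measure with a density *)

Section density.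
Context (d : measure_display) (T : measurableType d) (R : realType).
Variables (mu nu : {measure set T -> \bar R}) (p : T -> R).
Hypothesis mp : measurable_fun [set: T] p.
Hypothesis p0 : forall x, 0 <= p x.
Hypothesis nuE : forall A, measurable A -> nu A = (\int[mu]_(x in A) (p x)%:E)%E.

Import HBNNSimple.

Let density_nnsfun (h : {nnsfun T >-> R}) :
  (\int[nu]_x (h x)%:E = \int[mu]_x (h x * p x)%:E)%E.
Proof.
under [LHS]eq_integral do rewrite fimfunE -fsumEFin//.
rewrite [LHS]ge0_integral_fsum//; last 2 first.
  - by move=> r; exact/measurable_EFinP/measurableT_comp.
  - by move=> n x _; rewrite EFinM nnfun_muleindic_ge0.
under [RHS]eq_integral.
  move=> x xD; rewrite EFinM muleC fimfunE -fsumEFin// ge0_mule_fsumr; last first.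
    by move=> r; rewrite EFinM nnfun_muleindic_ge0.
  over.
rewrite [RHS]ge0_integral_fsum//; last 2 first.
  - move=> r; apply/measurable_EFinP/measurable_funM => //.
    exact: measurable_funM.
  - move=> n x _; apply: mule_ge0; first by rewrite lee_fin.
    by rewrite EFinM nnfun_muleindic_ge0.
apply: eq_fsbigr => r _; rewrite integralZl_indic_nnsfun//.
rewrite integral_indic// setIT nuE//.
have [r0|r0] := ltP r 0.
  rewrite preimage_nnfun0// integral_set0 mule0.
  by rewrite integral0_eq// => x _; rewrite indic0 mulr0 mule0.
under [RHS]eq_integral => x _ do rewrite EFinM muleCA.
rewrite ge0_integralZl//; last 2 first.
- by apply/measurable_EFinP/measurable_funM => //; exact: measurable_indic.
- by move=> x _; rewrite lee_fin mulr_ge0.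
congr (_ * _)%E; rewrite integral_mkcond; apply: eq_integral => x _.
by rewrite patchE indicE; case: ifPn => _; rewrite ?mule1 ?mule0.
Qed.

Lemma ge0_integral_density (f : T -> \bar R) :
  measurable_fun [set: T] f -> (forall x, 0 <= f x)%E ->
  (\int[nu]_x f x = \int[mu]_x (f x * (p x)%:E))%E.
Proof.
move=> mf f0; pose f_ := nnsfun_approx measurableT mf.
transitivity (lim (\int[nu]_x (f_ n x)%:E @[n --> \oo])%E).
  rewrite -monotone_convergence//=.
  - apply: eq_integral => ? /[!inE] xD; apply/esym/cvg_lim => //=.
    exact: cvg_nnsfun_approx.
  - by move=> n; exact/measurable_EFinP/measurable_funTS.
  - by move=> n ? _; rewrite lee_fin.
  - by move=> ? _ ? ? mn; rewrite lee_fin; exact/lefP/nd_nnsfun_approx.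
transitivity (lim (\int[mu]_x (f_ n x * p x)%:E @[n --> \oo])%E).
  by apply: congr_lim; apply/funext => n /=; exact: density_nnsfun.
rewrite -monotone_convergence//=.
- apply: eq_integral => x _; apply/cvg_lim => //=.
  under eq_fun do rewrite EFinM.
  by apply: cvgeZr => //; exact: cvg_nnsfun_approx.
- by move=> n; apply/measurable_EFinP/measurable_funM.
- by move=> n ? _; rewrite lee_fin mulr_ge0.
- by move=> ? _ ? ? mn; rewrite lee_fin ler_wpM2r//; exact/lefP/nd_nnsfun_approx.
Qed.

Lemma integrable_density (f : T -> R) : measurable_fun [set: T] f ->
  mu.-integrable [set: T] (fun x => (f x * p x)%:E) ->
  nu.-integrable [set: T] (EFin \o f).
Proof.
move=> mf /integrableP[_ fp]; apply/integrableP; split; first exact/measurable_EFinP.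
rewrite ge0_integral_density//; last first.
  by apply/measurable_EFinP; exact: measurableT_comp.
rewrite (le_lt_trans _ fp)// le_eqVlt; apply/orP; left; apply/eqP.
by apply: eq_integral => x _ /=; rewrite -EFinM normrM (ger0_norm (p0 x)).
Qed.

Lemma integral_density (f : T -> R) : measurable_fun [set: T] f ->
  mu.-integrable [set: T] (fun x => (f x * p x)%:E) ->
  (\int[nu]_x (f x)%:E = \int[mu]_x (f x * p x)%:E)%E.
Proof.
move=> mf fp; pose f1 x := Num.max (f x) 0; pose f2 x := Num.max (- f x) 0.
have m1 : measurable_fun [set: T] f1 by exact: measurable_maxr.
have m2 : measurable_fun [set: T] f2.
  by apply: measurable_maxr => //; exact: measurableT_comp.
have f12 x : f x = f1 x - f2 x.
  by rewrite /f1 /f2; case: (leP (f x) 0) => h;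
    [rewrite max_l ?oppr_ge0// sub0r opprK|rewrite max_r ?oppr_le0 ?ltW// subr0].
have f10 x : 0 <= f1 x by rewrite le_max lexx orbT.
have f20 x : 0 <= f2 x by rewrite le_max lexx orbT.
have dom (g : T -> R) : measurable_fun [set: T] g ->
    (forall x, 0 <= g x <= `|f x|) ->
    mu.-integrable [set: T] (fun x => (g x * p x)%:E).
  move=> mg gf; apply: le_integrable fp => //.
    by apply/measurable_EFinP; exact: measurable_funM.
  move=> x _; rewrite lee_fin !normrM; have /andP[g0 gf'] := gf x.
  by rewrite ler_wpM2r// ger0_norm.
have d1 : mu.-integrable [set: T] (fun x => (f1 x * p x)%:E).
  by apply: dom => // x; rewrite f10 ge_max normr_ge0 ler_norm.
have d2 : mu.-integrable [set: T] (fun x => (f2 x * p x)%:E).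
  by apply: dom => // x; rewrite f20 ge_max normr_ge0 -normrN ler_norm.
transitivity (\int[nu]_x ((f1 x)%:E - (f2 x)%:E))%E.
  by apply: eq_integral => x _; rewrite {1}f12.
rewrite integralB_EFin//; [|exact: integrable_density..].
transitivity (\int[mu]_x ((f1 x * p x)%:E - (f2 x * p x)%:E))%E; last first.
  by apply: eq_integral => x _; rewrite {1}f12 -EFinD -mulNr -mulrDl.
rewrite integralB_EFin//.
by rewrite !ge0_integral_density//; exact/measurable_EFinP.
Qed.

End density.

(** * The standard normal density: decay and boundary terms *)

Section stein.
Context (R : realType).
Local Notation mu := (@lebesgue_measure R).
Local Notation p := (normal_pdf (0 : R) 1).

Lemma normal_pdf01E x : p x = normal_peak 1 * expR (- (x ^+ 2 / 2)).
Proof.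
rewrite normal_pdfE ?oner_neq0// /normal_fun subr0; congr (_ * expR _).
by rewrite expr1n mulNr.
Qed.

Lemma is_derive_normal_pdf01 (x : R) : is_derive x 1 p (- x * p x).
Proof.
rewrite (_ : p = fun x => normal_peak 1 * expR (- (x ^+ 2 / 2))); last first.
  by apply/funext => y; exact: normal_pdf01E.
apply: is_derive_eq.
rewrite /GRing.scale/=.
by field.
Qed.

(* (1 + x^2) exp(- x^2 / 2) <= 8 exp(- x^2 / 8) *)
Lemma normal_pdf01_decay x : (1 + x ^+ 2) * p x <=
  8 * (normal_peak 1 / normal_peak 2) * normal_pdf 0 2 x.
Proof.
have k1 : 0 < normal_peak (1 : R) by rewrite normal_peak_gt0// oner_neq0.
have k2 : 0 < normal_peak (2 : R) by rewrite normal_peak_gt0// pnatr_eq0.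
rewrite normal_pdf01E normal_pdfE ?pnatr_eq0// /normal_fun subr0.
set y := x ^+ 2 / 8.
have -> : - x ^+ 2 / (2 ^+ 2 *+ 2) = - y.
  by rewrite /y; field.
(* With y = x^2 / 8 the density contains four factors exp(- y): one is the density of variance 4 up
   to its constant, one absorbs 1 + 8 y through 1 + y <= exp y, and the other two are at most 1. *)
have -> : x ^+ 2 / 2 = y + (y + (y + y)) by rewrite /y; field.
rewrite !opprD !expRD.
have -> : x ^+ 2 = 8 * y by rewrite /y; field.
have y0 : 0 <= y by rewrite divr_ge0 ?sqr_ge0.
have e0 := expR_gt0 (- y).
have e1 : expR (- y) <= 1 by rewrite -expR0 ler_expR oppr_le0.
have e2 : (1 + y) * expR (- y) <= 1.
  by rewrite expRN -ler_pdivlMr ?invr_gt0 ?expR_gt0// invrK mul1r expR_ge1Dx.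
have -> : 8 * (normal_peak 1 / normal_peak 2) * (normal_peak 2 * expR (- y)) =
    normal_peak 1 * (8 * expR (- y)).
  by field; rewrite gt_eqF.
rewrite mulrCA ler_pM2l// mulrA.
have h : (1 + 8 * y) * expR (- y) <= 8.
  by apply: (@le_trans _ _ (8 * ((1 + y) * expR (- y)))); nra.
have h0 : 0 <= (1 + 8 * y) * expR (- y) by rewrite mulr_ge0 ?expR_ge0//; lra.
have e3 : 0 <= expR (- y) * (expR (- y) * expR (- y)) by rewrite !mulr_ge0 ?expR_ge0.
rewrite [leLHS](_ : _ = (1 + 8 * y) * expR (- y) * (expR (- y) * (expR (- y) * expR (- y)))); last by ring.
apply: ler_pM => //.
by rewrite -[leRHS]mulr1 ler_wpM2l ?expR_ge0 ?mulr_ile1 ?expR_ge0.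
Qed.

(** The decay estimate dominates the integrand by a multiple of the density of variance 4. Quadratic
    growth is what x phi(x) has when phi grows linearly. *)
Lemma integrable_normal_pdf01 (g : R -> R) (C : R) :
  measurable_fun [set: R] g -> (forall x, `|g x| <= C * (1 + x ^+ 2)) ->
  mu.-integrable [set: R] (fun x => (g x * p x)%:E).
Proof.
move=> mg gC.
have C0 : 0 <= C by have := gC 0; rewrite expr0n/= addr0 mulr1; exact: le_trans.
pose K := C * (8 * (normal_peak 1 / normal_peak 2)).
apply: (le_integrable measurableT _ _
  (integrableZl measurableT K (integrable_normal_pdf 0 2))).
- apply/measurable_EFinP; apply: measurable_funM => //.
  exact: measurable_normal_pdf.
- move=> x _; rewrite -EFinM/= lee_fin normrM.
  rewrite (ger0_norm (normal_pdf_ge0 _ _ _)).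
  apply: (@le_trans _ _ (C * ((1 + x ^+ 2) * p x))).
    by rewrite mulrA ler_wpM2r ?normal_pdf_ge0.
  apply: le_trans (ler_norm _).
  rewrite /K -mulrA ler_wpM2l//; exact: normal_pdf01_decay.
Qed.

(* The product phi p vanishes at infinity because (1 + |x|)^2 p(x) is bounded. *)
Lemma normal_pdf01_lin (x : R) :
  (1 + `|x|) * p x <= 16 * normal_peak 1 / (1 + `|x|).
Proof.
have k1 : 0 < normal_peak (1 : R) by rewrite normal_peak_gt0// oner_neq0.
have k2 : 0 < normal_peak (2 : R) by rewrite normal_peak_gt0// pnatr_eq0.
have x1 : 0 < 1 + `|x| by rewrite ltr_wpDr.
rewrite ler_pdivlMr// mulrAC -expr2.
apply: (@le_trans _ _ (2 * ((1 + x ^+ 2) * p x))).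
  rewrite mulrA ler_wpM2r ?normal_pdf_ge0// -[x ^+ 2]real_normK ?num_real//.
  by have := sqr_ge0 (1 - `|x|); nra.
rewrite (_ : 16 = 2 * 8); last by ring.
rewrite -!mulrA ler_wpM2l// (le_trans (normal_pdf01_decay x))//.
rewrite -!mulrA ler_wpM2l// ler_piMr ?(ltW k1)//.
rewrite ler_pdivrMl// mulr1.
by apply: normal_pdf_ub; rewrite pnatr_eq0.
Qed.

(** The boundary terms of the integration by parts; the condition on [x] covers the endpoints n and
    - n at once. *)
Lemma cvg_normal_pdf01 (phi : R -> R) (C : R) (x : nat -> R) :
  (forall y, `|phi y| <= C * (1 + `|y|)) -> (forall n, `|x n| = n%:R) ->
  phi (x n) * p (x n) @[n --> \oo] --> (0 : R).
Proof.
move=> phiC xn.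
have C0 : 0 <= C by have := phiC 0; rewrite normr0 addr0 mulr1; exact: le_trans.
have c0 : (C * (16 * normal_peak 1)) * n.+1%:R^-1 @[n --> \oo] --> (0 : R).
  by rewrite -[0](mulr0 (C * (16 * normal_peak 1))); apply: cvgMr; exact: cvg_harmonic.
apply: norm_cvg0; apply: squeeze_cvgr (cvg_cst (0 : R)) c0.
apply: nearW => n; rewrite normr_ge0/= normrM (ger0_norm (normal_pdf_ge0 _ _ _)).
apply: (@le_trans _ _ (C * ((1 + `|x n|) * p (x n)))).
  by rewrite mulrA ler_wpM2r ?normal_pdf_ge0.
rewrite -mulrA ler_wpM2l// (le_trans (normal_pdf01_lin _))//.
by rewrite xn [1 + _]addrC natr1.
Qed.

(** The fundamental theorem of calculus on growing symmetric intervals, then dominated convergence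
    with majorant |h|. *)
Lemma integral_derive_eq0 (F h : R -> R) :
  (forall x : R, is_derive x 1 F (h x)) -> continuous h ->
  mu.-integrable [set: R] (EFin \o h) ->
  F n%:R @[n --> \oo] --> (0 : R) -> F (- n%:R) @[n --> \oo] --> (0 : R) ->
  (\int[mu]_x (h x)%:E = 0)%E.
Proof.
move=> dF ch ih F1 F2.
have cF : continuous F.
  by move=> x; apply: differentiable_continuous; exact/derivable1_diffP.
(* [n.+1] rather than [n]: the fundamental theorem asks for a nondegenerate interval. *)
have ftc n : (\int[mu]_x ((h \_ `[(- n.+1%:R)%R, n.+1%:R]) x)%:E =
    (F n.+1%:R - F (- n.+1%:R))%:E)%E.
  transitivity (\int[mu]_(x in `[(- n.+1%:R)%R, n.+1%:R]) (h x)%:E)%E.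
    rewrite [RHS]integral_mkcond; apply: eq_integral => x _.
    by rewrite !patchE; case: ifP.
  rewrite EFinB; apply: continuous_FTC2.
  - by rewrite gtrN.
  - by apply: continuous_subspaceT.
  - split; [by move=> x _; case: (dF x)|exact/cvg_at_right_filter/cF|].
    exact/cvg_at_left_filter/cF.
  - by move=> x _; rewrite derive1E; case: (dF x).
have mh : measurable_fun [set: R] h by exact: continuous_measurable_fun.
have [] := @dominated_convergence _ (measurableTypeR R) R mu setT measurableT
  (fun n x => ((h \_ `[(- n.+1%:R)%R, n.+1%:R]) x)%:E) (fun x => (h x)%:E)
  (fun x => `|h x|%:E).
- by move=> n; apply/measurable_EFinP/measurable_restrict => //;
    exact: measurable_funTS.
- exact/measurable_EFinP.
- apply: aeW => x _; apply/cvg_EFin; first by near=> n.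
  apply: cvg_near_cst; near=> n; rewrite /= patchE mem_set// /= in_itv/= -ler_norml.
  rewrite -natr1; apply/ltW/ltr_pwDr => //.
  by near: n; exact: nbhs_infty_ger.
- exact: integrable_norm.
- apply: aeW => x n _; rewrite lee_fin patchE.
  by case: ifPn => // _; rewrite normr0.
move=> _ _ cvh; apply: (cvg_unique _ cvh) => //=.
rewrite (eq_cvg _ _ ftc).
apply/cvg_EFin; first by near=> n.
rewrite -[0](subr0 0); apply: cvgB.
  by rewrite (cvg_shiftS (fun n => F n%:R)).
by rewrite (cvg_shiftS (fun n => F (- n%:R))).
Unshelve. all: by end_near. Qed.

End stein.

(** * Stein's identity for a standard normal variable *)

Section standard_normal.
Context (R : realType) (d : measure_display) (T : measurableType d).
Variables (P : probability T R) (X : T -> R).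
Local Notation mu := (@lebesgue_measure R).
Local Notation p := (normal_pdf (0 : R) 1).
Hypotheses (mX : measurable_fun [set: T] X) (nX : has_normal_law P X 0 1).

Lemma normal_law_mean (g : R -> R) (C : R) :
  measurable_fun [set: R] g -> (forall x, `|g x| <= C * (1 + x ^+ 2)) ->
  L1 P (fun w => g (X w)) /\
  (mean P (fun w => g (X w)))%:E = (\int[mu]_x (g x * p x)%:E)%E.
Proof.
move=> mg gC.
have ig := integrable_normal_pdf01 mg gC.
have mE : measurable_fun [set: R] (EFin \o g) by exact/measurable_EFinP.
have mX' : measurable_fun [set: T] (X : T -> measurableTypeR R) by [].
have PE (f : R -> \bar R) : measurable_fun [set: R] f -> (forall x, 0 <= f x)%E ->
    (\int[P]_w f (X w) = \int[normal_prob 0 1]_x f x)%E.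
  move=> mf f0; transitivity (\int[pushforward_measure P mX']_x f x)%E.
    by rewrite ge0_integral_pushforward.
  by apply: eq_measure_integral => A mA _; exact: nX.
have mp : measurable_fun [set: measurableTypeR R] p by exact: measurable_normal_pdf.
have p0 x : 0 <= p x by exact: normal_pdf_ge0.
have nuE (A : set (measurableTypeR R)) : measurable A ->
    normal_prob 0 1 A = (\int[mu]_(x in A) (p x)%:E)%E by [].
have i1 : (normal_prob 0 1).-integrable [set: R] (EFin \o g).
  exact: (integrable_density mp p0 nuE mg ig).
have L1g : L1 P (fun w => g (X w)).
  apply/integrableP; split.
    by apply/measurable_EFinP; exact: measurableT_comp.
  rewrite (PE (fun x => `|(g x)%:E|%E))//; last exact: measurableT_comp.
  by case/integrableP : i1.
split=> //; rewrite -EFin_mean//.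
rewrite -(integral_density mp p0 nuE mg ig).
transitivity (\int[pushforward_measure P mX']_x (EFin \o g) x)%E.
  by rewrite integral_pushforward.
by apply: eq_measure_integral => A mA _; exact: nX.
Qed.

(** Since p' = - x p, the function phi' p - x phi p is the derivative of phi p, which vanishes at
    infinity. Linear growth of [phi] is allowed so that phi(x) = x yields the variance. *)
Lemma stein (phi phi' : R -> R) (C : R) :
  (forall x : R, is_derive x 1 phi (phi' x)) -> continuous phi' ->
  (forall x, `|phi x| <= C * (1 + `|x|)) -> (forall x, `|phi' x| <= C) ->
  L1 P (fun w => X w * phi (X w)) /\
  mean P (fun w => X w * phi (X w)) = mean P (fun w => phi' (X w)).
Proof.
move=> dphi cphi' bphi bphi'.
have C0 : 0 <= C by exact: le_trans (bphi' 0).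
have cphi : continuous phi.
  by move=> x; apply: differentiable_continuous; exact/derivable1_diffP.
have m1 : measurable_fun [set: R] (fun x => x * phi x).
  by apply: measurable_funM => //; exact: continuous_measurable_fun.
have m2 : measurable_fun [set: R] phi' by exact: continuous_measurable_fun.
have b1 x : `|x * phi x| <= (2 * C) * (1 + x ^+ 2).
  rewrite normrM -[x ^+ 2]real_normK ?num_real//.
  apply: (@le_trans _ _ (`|x| * (C * (1 + `|x|)))); first by rewrite ler_wpM2l.
  by have := sqr_ge0 (1 - `|x|); have := normr_ge0 x; nra.
have b2 x : `|phi' x| <= (2 * C) * (1 + x ^+ 2).
  by apply: (le_trans (bphi' x)); have := sqr_ge0 x; nra.
have [l1 e1] := normal_law_mean m1 b1.
have [l2 e2] := normal_law_mean m2 b2.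
split=> //; apply: EFin_inj; rewrite e1 e2.
have i1 := integrable_normal_pdf01 m1 b1.
have i2 := integrable_normal_pdf01 m2 b2.
have f1 := integrable_fin_num measurableT i1.
have f2 := integrable_fin_num measurableT i2.
suff H : (\int[mu]_x (phi' x * p x)%:E - \int[mu]_x (x * phi x * p x)%:E = 0)%E.
  by move: H; rewrite -(fineK f1) -(fineK f2) -EFinB => -[] /eqP;
    rewrite subr_eq0 => /eqP ->.
rewrite -integralB_EFin//.
pose h x := phi' x * p x - x * phi x * p x.
under eq_integral => x _ do rewrite -EFinB -/(h x).
apply: (@integral_derive_eq0 _ (fun x => phi x * p x)).
- move=> x; have := is_derive_normal_pdf01 x; move=> dp.
  apply: is_derive_eq; rewrite /GRing.scale/= /h; ring.
- move=> x; apply: cvgB; apply: cvgM; [exact: cphi'|..].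
  + by apply: continuous_normal_pdf; exact: oner_neq0.
  + by apply: cvgM; [exact: cvg_id|exact: cphi].
  + by apply: continuous_normal_pdf; exact: oner_neq0.
- have := integrableB measurableT i2 i1.
  by apply: eq_integrable => // x _.
- by apply: (cvg_normal_pdf01 bphi) => n; rewrite normr_nat.
- by apply: (cvg_normal_pdf01 bphi) => n; rewrite normrN normr_nat.
Qed.

End standard_normal.

(** * Independence *)

Lemma measurable_fun_pairl d1 d2 d3 (S1 : measurableType d1)
    (S2 : measurableType d2) (S3 : measurableType d3) (H : S1 * S2 -> S3) y :
  measurable_fun [set: S1 * S2] H -> measurable_fun [set: S1] (fun x => H (x, y)).
Proof.
by move=> mH; apply: (measurableT_comp mH); exact: measurable_fun_pair.
Qed.

Section independence.
Context (R : realType) (d d1 d2 : measure_display) (T : measurableType d)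
  (S1 : measurableType d1) (S2 : measurableType d2).
Variable P : probability T R.

(** The value spaces are arbitrary, so that independence from a whole tuple of past variables can be
    expressed. *)
Definition indep_RV (X : T -> S1) (Y : T -> S2) :=
  forall A C, measurable A -> measurable C ->
    P ((X @^-1` A) `&` (Y @^-1` C)) = (P (X @^-1` A) * P (Y @^-1` C))%E.

Variables (X : T -> S1) (Y : T -> S2).
Hypotheses (mX : measurable_fun [set: T] X) (mY : measurable_fun [set: T] Y).
Hypothesis XY : indep_RV X Y.

Let X' : {mfun T >-> S1} := HB.pack X (isMeasurableFun.Build _ _ _ _ _ mX).
Let Y' : {mfun T >-> S2} := HB.pack Y (isMeasurableFun.Build _ _ _ _ _ mY).
Let XY' w := (X w, Y w).
Let mXY : measurable_fun [set: T] XY'.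
Proof. exact: measurable_fun_pair. Qed.
Let XY'' : {mfun T >-> (S1 * S2)%type} :=
  HB.pack XY' (isMeasurableFun.Build _ _ _ _ _ mXY).

Let joint_law A : measurable A ->
  (distribution P X' \x distribution P Y')%E A = distribution P XY'' A.
Proof.
apply: product_measure_unique => C D mC mD.
by rewrite /distribution /pushforward /= -XY.
Qed.

Lemma ge0_indep_integral (H : S1 * S2 -> \bar R) :
  measurable_fun [set: S1 * S2] H -> (forall z, 0 <= H z)%E ->
  (\int[P]_w H (X w, Y w) = \int[P]_w \int[P]_w' H (X w', Y w))%E.
Proof.
move=> mH H0.
rewrite -[LHS](@ge0_integral_distribution _ _ _ _ _ P XY'' H)//.
rewrite (eq_measure_integral (distribution P X' \x distribution P Y')%E); last first.
  by move=> A mA _; exact/esym/joint_law.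
rewrite fubini_tonelli2//.
rewrite (@ge0_integral_distribution _ _ _ _ _ P Y')//; last 2 first.
- exact: measurable_fun_fubini_tonelli_G.
- by move=> y; apply: integral_ge0.
apply: eq_integral => w _ /=; rewrite /fubini_G.
rewrite (@ge0_integral_distribution _ _ _ _ _ P X' (fun x => H (x, Y w)))//.
exact: measurable_fun_pairl.
Qed.

(** Fubini for the joint law. Integrability of the section at every y, not merely almost every y,
    makes the inner expectation a genuine [mean] at each point. *)
Lemma indep_mean (H : S1 * S2 -> R) :
  measurable_fun [set: S1 * S2] H -> L1 P (fun w => H (X w, Y w)) ->
  (forall y, L1 P (fun w => H (X w, y))) ->
  mean P (fun w => H (X w, Y w)) =
  mean P (fun w => mean P (fun w' => H (X w', Y w))).
Proof.
move=> mH iH iHy.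
have mE : measurable_fun [set: S1 * S2] (EFin \o H) by exact/measurable_EFinP.
have iD : (distribution P XY'').-integrable [set: S1 * S2] (EFin \o H).
  exact: integrable_pushforward.
have iP : (distribution P X' \x distribution P Y')%E.-integrable [set: S1 * S2] (EFin \o H).
  case/integrableP : iD => _ Hoo; apply/integrableP; split=> //.
  rewrite (eq_measure_integral (distribution P XY''))//.
  by move=> A mA _; exact: joint_law.
rewrite /mean /Rintegral; congr fine.
rewrite -[LHS](@integral_distribution _ _ _ _ _ P XY'' (EFin \o H))//.
rewrite (eq_measure_integral (distribution P X' \x distribution P Y')%E); last first.
  by move=> A mA _; exact/esym/joint_law.
rewrite -integral21_prod_meas1//.
have mG := measurable_fubini_G iP.
have mA : measurable_fun [set: S1 * S2] (fun z => `|(H z)%:E|%E).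
  exact: measurableT_comp.
have Goo : (\int[distribution P Y']_y
    `|fubini_G (distribution P X') (EFin \o H) y| < +oo)%E.
  apply: le_lt_trans ((integrable21ltyP (distribution P X') (distribution P Y') mE).1 iP).
  apply: ge0_le_integral => //.
  - exact: measurableT_comp.
  - apply: (measurable_fun_fubini_tonelli_G (m1 := distribution P X') (abse \o (EFin \o H)) mA).
    by move=> z; exact: abse_ge0.
  - move=> y _; rewrite /fubini_G; apply: le_abse_integral => //.
    exact: measurableT_comp.
rewrite (@integral_distribution _ _ _ _ _ P Y')//; last first.
  apply/integrableP; split; first exact: measurableT_comp.
  move: Goo; rewrite (@ge0_integral_distribution _ _ _ _ _ P Y')//.
  exact: measurableT_comp.
apply: eq_integral => w _ /=; rewrite /fubini_G -EFin_mean//.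
rewrite (@integral_distribution _ _ _ _ _ P X' (fun x => (H (x, Y w))%:E))//; last 2 first.
- by apply/measurable_EFinP; exact: measurable_fun_pairl.
- exact: iHy.
Qed.

End independence.

Section independent_products.
Context (R : realType) (d : measure_display) (T : measurableType d).
Variable P : probability T R.
Variables (X Y : T -> R).
Hypotheses (iX : L1 P X) (iY : L1 P Y) (XY : indep_RV P X Y).

(** By Tonelli E|X Y| = E|X| E|Y|. Integrability of the factors suffices, so X may be a squared
    increment and Y a squared coefficient. *)
Lemma indep_L1M : L1 P (fun w => X w * Y w).
Proof.
have mX := L1_measurable iX; have mY := L1_measurable iY.
apply/integrableP; split; first by apply/measurable_EFinP; exact: measurable_funM.
have mH : measurable_fun [set: R * R] (fun z : R * R => `|z.1 * z.2|%:E).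
  by apply/measurable_EFinP; apply: measurableT_comp => //; exact: measurable_funM.
rewrite (ge0_indep_integral mX mY XY mH)//=.
under eq_integral => w _.
  under eq_integral => w' _ do rewrite normrM EFinM.
  rewrite ge0_integralZr//; last by apply/measurable_EFinP; exact: measurableT_comp.
  rewrite (EFin_mean (L1_abs iX)) -EFinM.
  over.
rewrite (EFin_mean (X := fun w => mean P (fun w => `|X w|) * `|Y w|)) ?ltry//.
exact/L1Z/L1_abs.
Qed.

Lemma indep_meanM : mean P (fun w => X w * Y w) = mean P X * mean P Y.
Proof.
have mX := L1_measurable iX; have mY := L1_measurable iY.
rewrite (@indep_mean _ _ _ _ _ _ _ P X Y mX mY XY (fun z => z.1 * z.2))//=.
- rewrite -meanZ//; apply: eq_mean => w.
  by under eq_mean do rewrite mulrC; rewrite meanZ// mulrC.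
- exact: measurable_funM.
- exact: indep_L1M.
- by move=> y; under eq_fun do rewrite mulrC; exact: L1Z.
Qed.

End independent_products.

(** * Brownian increments *)

Section normal_moments.
Context (R : realType) (d : measure_display) (T : measurableType d).
Variable P : probability T R.
Implicit Types X : T -> R.

Lemma has_normal_lawZ X (c s : R) : c != 0 -> 0 < s ->
  has_normal_law P X 0 s -> has_normal_law P (fun w => c * X w) 0 (`|c| * s).
Proof.
move=> c0 s0 nX A mA; rewrite -normal_prob_scale//.
rewrite -nX//; rewrite -[X in measurable X]setTI.
exact: (@measurable_funM _ _ _ setT (cst c) id).
Qed.

(** Stein's identity with phi = 1 gives the mean; with phi = x it gives the second moment together
    with its integrability. *)
Lemma standard_normal_moments X : measurable_fun [set: T] X ->
  has_normal_law P X 0 1 ->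
  [/\ L2 P X, mean P X = 0 & mean P (fun w => X w ^+ 2) = 1].
Proof.
move=> mX nX.
have b (x : R) : `|x| <= 1 * (1 + `|x|) by rewrite mul1r lerDr.
have h1 : forall x : R, is_derive x 1 (fun=> 1 : R) (0 : R) by move=> x; exact: is_derive_cst.
have h2 : forall x : R, is_derive x 1 (fun x => x : R) (1 : R) by move=> x; exact: is_derive_id.
have c1 : continuous (fun _ : R => 0 : R) by move=> x; exact: cvg_cst.
have c2 : continuous (fun _ : R => 1 : R) by move=> x; exact: cvg_cst.
have b1 x : `|1 : R| <= 1 * (1 + `|x : R|) by rewrite normr1 mul1r lerDl.
have b0 (x : R) : `|0 : R| <= 1 by rewrite normr0.
have b2 (x : R) : `|1 : R| <= 1 by rewrite normr1.
have [l1 e1] := stein mX nX h1 c1 b1 b0.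
have [l2 e2] := stein mX nX h2 c2 b b2.
split.
- split=> //; rewrite (_ : (fun w => _) = fun w => X w * X w)//.
- by rewrite -[RHS](mean_cst P) -e1; apply: eq_mean => w; rewrite mulr1.
- by rewrite -[RHS](mean_cst P) -e2.
Qed.

Lemma normal_moments X (s : R) : measurable_fun [set: T] X -> 0 < s ->
  has_normal_law P X 0 s ->
  [/\ L2 P X, mean P X = 0 & mean P (fun w => X w ^+ 2) = s ^+ 2].
Proof.
move=> mX s0 nX; have sV : s^-1 != 0 by rewrite invr_neq0// gt_eqF.
have mU : measurable_fun [set: T] (fun w => s^-1 * X w) by exact: measurable_funM.
have nU : has_normal_law P (fun w => s^-1 * X w) 0 1.
  have := has_normal_lawZ sV s0 nX.
  by rewrite ger0_norm ?invr_ge0 ?ltW// mulVf// gt_eqF.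
have [l2 m1 m2] := standard_normal_moments mU nU.
have XE : X = fun w => s * (s^-1 * X w).
  by apply/funext => w; rewrite mulVKf// gt_eqF.
split.
- by rewrite XE; exact: L2Z.
- by rewrite XE meanZ ?m1 ?mulr0//; exact: L2_L1.
- transitivity (mean P (fun w => s ^+ 2 * (s^-1 * X w) ^+ 2)).
    by apply: eq_mean => w; rewrite -exprMn mulVKf// gt_eqF.
  by rewrite meanZ ?m2 ?mulr1//; case: l2.
Qed.

Lemma normalized_law X (s : R) : 0 < s -> has_normal_law P X 0 s ->
  has_normal_law P (fun w => s^-1 * X w) 0 1.
Proof.
move=> s0 nX; have sV : s^-1 != 0 by rewrite invr_neq0// gt_eqF.
have := has_normal_lawZ sV s0 nX.
by rewrite ger0_norm ?invr_ge0 ?ltW// mulVf// gt_eqF.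
Qed.

End normal_moments.

Section brownian.
Context (R : realType) (d : measure_display) (T : measurableType d).
Variables (P : probability T R) (B : R -> {RV P >-> R}).

Definition past_events (t : R) : set (set T) := [set E | exists s, exists A : set R,
  [/\ 0 <= s <= t, measurable A & E = B s @^-1` A]].

(** Being determined by the path up to time t is encoded as ordinary measurability on T with the
    generated sigma-algebra, so the closure lemmas for sums, products and pairs apply as they
    are. *)
Definition known (d' : measure_display) (S : measurableType d') (t : R)
    (X : T -> S) :=
  measurable_fun [set: g_sigma_algebraType (past_events t)]
    (X : g_sigma_algebraType (past_events t) -> S).

Lemma past_measurable t (E : set T) :
  natural_filtration (fun t => B t : T -> R) t E -> measurable E.
Proof.
apply: smallest_sub; first exact: sigma_algebra_measurable.
move=> _ [s [A [_ mA ->]]]; rewrite -[X in measurable X]setTI.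
exact: measurable_funP.
Qed.

Lemma past_le s t : s <= t ->
  natural_filtration (fun t => B t : T -> R) s `<=`
  natural_filtration (fun t => B t : T -> R) t.
Proof.
move=> st; apply: sub_sigma_algebra2 => _ [r [A [/andP[r0 rs] mA ->]]].
by exists r, A; split=> //; rewrite r0 (le_trans rs st).
Qed.

Lemma knownP (d' : measure_display) (S : measurableType d') (t : R) (X : T -> S) :
  (forall A, measurable A ->
     natural_filtration (fun t => B t : T -> R) t (X @^-1` A)) <-> known t X.
Proof.
split=> [tX _ A mA|tX A mA]; first by rewrite setTI; exact: tX.
by have := tX measurableT A mA; rewrite setTI.
Qed.

Lemma known_measurable (d' : measure_display) (S : measurableType d') (t : R)
  (X : T -> S) : known t X -> measurable_fun [set: T] X.
Proof.
move=> /knownP tX _ A mA; rewrite setTI.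
exact: (past_measurable (tX A mA)).
Qed.

Lemma known_le (d' : measure_display) (S : measurableType d') (s t : R)
  (X : T -> S) : s <= t -> known s X -> known t X.
Proof. by move=> st /knownP sX; apply/knownP => A mA; exact: (past_le st (sX A mA)). Qed.

Lemma known_path (s t : R) : 0 <= s -> s <= t -> known t (B s).
Proof.
move=> s0 st; apply/knownP => A mA; apply: sub_sigma_algebra.
by exists s, A; split=> //; rewrite s0.
Qed.

Definition incr (s t : R) (w : T) : R := B t w - B s w.

Lemma known_incr (s t u : R) : 0 <= s -> s <= t -> t <= u -> known u (incr s t).
Proof.
move=> s0 st tu; apply: measurable_funB; apply: known_path => //.
- exact: le_trans st.
- exact: le_trans tu.
Qed.

Lemma measurable_incr s t : measurable_fun [set: T] (incr s t).
Proof. exact: measurable_funB. Qed.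

Hypothesis hB : standard_brownian_motion B.

Lemma incr_law s t : 0 <= s -> s < t -> t <= 1 ->
  has_normal_law P (incr s t) 0 (Num.sqrt (t - s)).
Proof. by case: hB => _ h _ _; exact: h. Qed.

Lemma incr_indep (d' : measure_display) (S : measurableType d') (s t : R)
    (Y : T -> S) : 0 <= s -> s < t -> t <= 1 -> known s Y ->
  indep_RV P (incr s t) Y.
Proof.
move=> s0 st t1 /knownP sY A C mA mC; case: hB => _ _ h _.
by apply: h => //; exact: sY.
Qed.

(** The hypotheses on B concern s < t; the case s = t is included because simple processes may
    repeat a node. *)
Lemma incr_moments s t : 0 <= s -> s <= t -> t <= 1 ->
  [/\ L2 P (incr s t), mean P (incr s t) = 0
    & mean P (fun w => incr s t w ^+ 2) = t - s].
Proof.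
move=> s0; rewrite le_eqVlt => /predU1P[<- _|st t1].
  have -> : incr s s = fun=> 0 by apply/funext => w; rewrite /incr subrr.
  by split; [exact: L2_cst|exact: mean_cst|rewrite expr0n/= mean_cst subrr].
have st0 : 0 < t - s by rewrite subr_gt0.
have := normal_moments (@measurable_incr s t) _ (incr_law s0 st t1).
by rewrite sqrtr_gt0 sqr_sqrtr ?ltW// => /(_ st0).
Qed.

(** The martingale property: the increment is centred and independent of what is known at time s. *)
Lemma mean_incrM s t (H : T -> R) : 0 <= s -> s <= t -> t <= 1 ->
  known s H -> L1 P H ->
  L1 P (fun w => H w * incr s t w) /\ mean P (fun w => H w * incr s t w) = 0.
Proof.
move=> s0 st t1 kH iH; have [l2 m1 _] := incr_moments s0 st t1.
move: st; rewrite le_eqVlt => /predU1P[ts|st].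
  have -> : (fun w => H w * incr s t w) = fun=> 0.
    by apply/funext => w; rewrite /incr ts subrr mulr0.
  by split; [exact: L1_cst|exact: mean_cst].
have ind := incr_indep s0 st t1 kH.
rewrite (_ : (fun w => _) = fun w => incr s t w * H w); last first.
  by apply/funext => w; rewrite mulrC.
split; first by apply: indep_L1M => //; exact: L2_L1.
by rewrite indep_meanM// ?m1 ?mul0r//; exact: L2_L1.
Qed.

Lemma indep_RV_comp (d1 d2 d3 : measure_display) (S1 : measurableType d1)
    (S2 : measurableType d2) (S3 : measurableType d3) (X : T -> S1) (Y : T -> S2)
    (g : S1 -> S3) : measurable_fun [set: S1] g ->
  indep_RV P X Y -> indep_RV P (fun w => g (X w)) Y.
Proof.
move=> mg XY A C mA mC; apply: (XY (g @^-1` A) C) => //.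
by rewrite -[X in measurable X]setTI; exact: mg.
Qed.

Lemma mean_incr_sqrM s t (H : T -> R) : 0 <= s -> s <= t -> t <= 1 ->
  known s H -> L1 P H ->
  L1 P (fun w => H w * incr s t w ^+ 2) /\
  mean P (fun w => H w * incr s t w ^+ 2) = mean P H * (t - s).
Proof.
move=> s0 st t1 kH iH; have [[ml l2] m1 m2] := incr_moments s0 st t1.
move: st; rewrite le_eqVlt => /predU1P[ts|st].
  have -> : (fun w => H w * incr s t w ^+ 2) = fun=> 0.
    by apply/funext => w; rewrite /incr ts subrr expr0n mulr0.
  by rewrite ts subrr mulr0; split; [exact: L1_cst|exact: mean_cst].
have ind : indep_RV P (fun w => incr s t w ^+ 2) H.
  apply: (@indep_RV_comp _ _ _ R R R (incr s t) H (fun x => x ^+ 2)) => //.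
  exact: incr_indep.
rewrite (_ : (fun w => _) = fun w => incr s t w ^+ 2 * H w); last first.
  by apply/funext => w; rewrite mulrC.
split; first exact: indep_L1M.
by rewrite indep_meanM// m2 mulrC.
Qed.

(** The square is a product of two independent integrable factors, H^2 and the squared increment. *)
Lemma L2M_incr s t (H : T -> R) : 0 <= s -> s <= t -> t <= 1 ->
  known s H -> L2 P H -> L2 P (fun w => H w * incr s t w).
Proof.
move=> s0 st t1 kH [mH iH]; split.
  by apply: measurable_funM => //; exact: measurable_incr.
rewrite (_ : (fun w => _) = fun w => H w ^+ 2 * incr s t w ^+ 2); last first.
  by apply/funext => w; rewrite exprMn.
have kH2 : known s (fun w => H w ^+ 2) by exact: measurable_funX.
by have [] := mean_incr_sqrM s0 st t1 kH2 iH.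
Qed.

End brownian.

(** * The Ito isometry *)

Section isometry.
Context (R : realType) (d : measure_display) (T : measurableType d).
Variables (P : probability T R) (B : R -> {RV P >-> R}).
Hypothesis hB : standard_brownian_motion B.
Local Notation mu := (@lebesgue_measure R).
Local Notation known := (@known R d T P B _ R).
Local Notation dB := (incr B).

(** B_t equals its increment from time 0 only almost surely, hence the detour through integrals of
    indicators. *)
Lemma path_law t : 0 < t -> t <= 1 -> has_normal_law P (B t) 0 (Num.sqrt t).
Proof.
move=> t0 t1 A mA; have := incr_law hB (lexx 0) t0 t1; rewrite subr0 => <- //.
have m1 : measurable (B t @^-1` A).
  by rewrite -[X in measurable X]setTI; exact: measurable_funP.
have m2 : measurable (dB 0 t @^-1` A).
  by rewrite -[X in measurable X]setTI; exact: measurable_incr.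
rewrite -[X in P X = _]setIT -[X in _ = P X]setIT -!integral_indic//.
apply: ge0_ae_eq_integral => //; try by move=> w _; rewrite lee_fin.
- exact/measurable_EFinP/measurable_indic.
- exact/measurable_EFinP/measurable_indic.
case: hB => + _ _ _; apply: filterS => w B0 _.
rewrite !indicE; congr ((_ : bool)%:R%:E).
by apply/idP/idP; rewrite !inE /= /incr B0 subr0.
Qed.

Lemma path_moments t : 0 < t -> t <= 1 ->
  L2 P (B t) /\ mean P (fun w => B t w ^+ 2) = t.
Proof.
move=> t0 t1; have st0 : 0 < Num.sqrt t by rewrite sqrtr_gt0.
have [l _ m] := normal_moments (measurable_funP (B t)) st0 (path_law t0 t1).
by rewrite m sqr_sqrtr// ltW.
Qed.

(** The length of the intersection of ]s, t] and ]u, v], which is the covariance of the two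
    increments. *)
Definition overlap (s t u v : R) := Num.max 0 (Num.min t v - Num.max s u).

Lemma overlapC s t u v : overlap s t u v = overlap u v s t.
Proof. by rewrite /overlap minC (maxC s). Qed.

(** By symmetry s <= u. If t <= u, the later increment is centred given the rest. Otherwise cut at
    u, m = min(t, v) and M = max(t, v): besides the square of the increment over ]u, m], each
    product ends in an increment that is independent of its other factors and centred. *)
Lemma ito_product s t u v (xi eta : T -> R) :
  0 <= s -> s <= t -> t <= 1 -> 0 <= u -> u <= v -> v <= 1 ->
  known s xi -> L2 P xi -> known u eta -> L2 P eta ->
  mean P (fun w => (xi w * dB s t w) * (eta w * dB u v w)) =
  mean P (fun w => xi w * eta w) * overlap s t u v.
Proof.
wlog su : s t u v xi eta / s <= u.
  move=> H s0 st t1 u0 uv v1 kxi ixi keta ieta.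
  have [su|/ltW us] := leP s u; first exact: H.
  rewrite overlapC; transitivity (mean P (fun w => eta w * xi w) * overlap u v s t).
    by rewrite -H//; apply: eq_mean => w; rewrite mulrC.
  by congr (_ * _); apply: eq_mean => w; rewrite mulrC.
move=> s0 st t1 u0 uv v1 kxi ixi keta ieta.
have kxiu : known u xi by exact: known_le kxi.
have ixe : L1 P (fun w => xi w * eta w) by exact: L1M.
have [tu|ut] := leP t u.
  have k1 : known u (fun w => (xi w * dB s t w) * eta w).
    apply: measurable_funM => //; apply: measurable_funM => //.
    exact: known_incr.
  have i1 : L1 P (fun w => (xi w * dB s t w) * eta w).
    by apply: L1M => //; exact: (L2M_incr hB).
  have [_ m1] := mean_incrM hB u0 uv v1 k1 i1.
  rewrite (_ : overlap _ _ _ _ = 0) ?mulr0; last first.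
    rewrite /overlap max_l// (max_r su) subr_le0 ge_min tu//.
  by rewrite -m1; apply: eq_mean => w; ring.
have u1 : u <= 1 by exact: le_trans uv v1.
set m := Num.min t v; set M := Num.max t v.
have um : u <= m by rewrite le_min uv ltW.
have mM : m <= M by rewrite /m /M le_max ge_min lexx.
have m1 : m <= 1 by rewrite ge_min t1.
have M1 : M <= 1 by rewrite ge_max t1.
have m0 : 0 <= m by exact: le_trans um.
have k1 : known u (fun w => (xi w * dB s u w) * eta w).
  by apply: measurable_funM => //; apply: measurable_funM => //; exact: known_incr.
have i1 : L1 P (fun w => (xi w * dB s u w) * eta w).
  by apply: L1M => //; exact: (L2M_incr hB).
have [l1 e1] := mean_incrM hB u0 uv v1 k1 i1.
have kxe : known u (fun w => xi w * eta w) by exact: measurable_funM.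
have [l2 e2] := mean_incr_sqrM hB u0 um m1 kxe ixe.
have k3 : known m (fun w => (xi w * eta w) * dB u m w).
  by apply: measurable_funM; [exact: known_le kxe|exact: known_incr].
have i3 : L1 P (fun w => (xi w * eta w) * dB u m w).
  by case: (mean_incrM hB u0 um m1 kxe ixe).
have [l3 e3] := mean_incrM hB m0 mM M1 k3 i3.
rewrite (_ : overlap _ _ _ _ = m - u); last first.
  by rewrite /overlap (max_r su) -/m max_r// subr_ge0.
rewrite -e2 -[RHS]add0r -[X in _ = X + _]e1 -[RHS]addr0 -[X in _ = _ + X]e3.
rewrite -meanD// -meanD//; last exact: L1D.
apply: eq_mean => w; rewrite /incr.
suff : (B t w - B u w) * (B v w - B u w) =
    (B m w - B u w) ^+ 2 + (B m w - B u w) * (B M w - B m w).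
  by move=> E; transitivity (xi w * eta w * ((B u w - B s w) * (B v w - B u w) +
     (B t w - B u w) * (B v w - B u w))); [ring|rewrite E; ring].
by rewrite /m /M; case: (leP t v) => _; ring.
Qed.

Definition itv_indic (s t r : R) : R := \1_(`]s, t]%classic) r.

Lemma measurable_itv_indic s t : measurable_fun [set: R] (itv_indic s t).
Proof. exact: measurable_indic. Qed.

Lemma itv_indicM s t u v r : itv_indic s t r * itv_indic u v r =
  itv_indic (Num.max s u) (Num.min t v) r.
Proof.
rewrite /itv_indic !indicE !mem_setE !in_itv/= -natrM mulnb; congr (_%:R).
rewrite gt_max le_min.
by case: (s < r); case: (u < r); case: (r <= t); case: (r <= v).
Qed.

Lemma integral_itv_indicM s t u v : 0 <= s -> t <= 1 -> 0 <= u -> v <= 1 ->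
  (\int[mu]_(r in `[0%R, 1%R]) (itv_indic s t r * itv_indic u v r)%:E =
   (overlap s t u v)%:E)%E.
Proof.
move=> s0 t1 u0 v1; under eq_integral => r _ do rewrite itv_indicM.
rewrite integral_indic//= setIidl; last first.
  move=> r /=; rewrite !in_itv/= gt_max le_min => /andP[/andP[sr _] /andP[rt _]].
  by rewrite (ltW (le_lt_trans s0 sr)) (le_trans rt t1).
rewrite lebesgue_measure_itv/= lte_fin /overlap -EFinD.
case: ltP => h; first by rewrite (@max_r _ _ 0)// subr_ge0 ltW.
by rewrite (@max_l _ _ 0)// subr_le0.
Qed.

Section family.
Variables (I : finType) (s t : I -> R) (xi : I -> T -> R).
Hypotheses (s0 : forall i, 0 <= s i) (st : forall i, s i <= t i)
  (t1 : forall i, t i <= 1).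
Hypotheses (kxi : forall i, known (s i) (xi i)) (ixi : forall i, L2 P (xi i)).

(** The index is any finite type and the intervals may overlap, so the difference of two simple
    processes on unrelated partitions is again of this form. *)
Definition family_int w : R := \sum_i xi i w * dB (s i) (t i) w.
Definition family_val r w : R := \sum_i xi i w * itv_indic (s i) (t i) r.

Lemma L2_family_int : L2 P family_int.
Proof. by apply: L2_sum => i; exact: (L2M_incr hB). Qed.

Lemma L2_family_val r : L2 P (family_val r).
Proof.
apply: L2_sum => i; under eq_fun do rewrite mulrC; exact: L2Z.
Qed.

Lemma mean_sqr_family_int : mean P (fun w => family_int w ^+ 2) =
  \sum_i \sum_j mean P (fun w => xi i w * xi j w) *
    overlap (s i) (t i) (s j) (t j).
Proof.
transitivity (mean P (fun w => \sum_i \sum_j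
    (xi i w * dB (s i) (t i) w) * (xi j w * dB (s j) (t j) w))).
  by apply: eq_mean => w; rewrite expr2 /family_int big_distrlr.
have iM i j : L1 P (fun w => (xi i w * dB (s i) (t i) w) * (xi j w * dB (s j) (t j) w)).
  by apply: L1M; exact: (L2M_incr hB).
rewrite mean_sum; last by move=> i; exact: L1_sum.
apply: eq_bigr => i _; rewrite mean_sum//.
by apply: eq_bigr => j _; exact: ito_product.
Qed.

Lemma mean_sqr_family_val r : mean P (fun w => family_val r w ^+ 2) =
  \sum_i \sum_j mean P (fun w => xi i w * xi j w) *
    (itv_indic (s i) (t i) r * itv_indic (s j) (t j) r).
Proof.
transitivity (mean P (fun w => \sum_i \sum_j
    (itv_indic (s i) (t i) r * itv_indic (s j) (t j) r) * (xi i w * xi j w))).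
  apply: eq_mean => w; rewrite expr2 /family_val big_distrlr/=.
  by apply: eq_bigr => i _; apply: eq_bigr => j _; ring.
have iM i j : L1 P (fun w => (itv_indic (s i) (t i) r * itv_indic (s j) (t j) r) *
    (xi i w * xi j w)).
  by apply: L1Z; exact: L1M.
rewrite mean_sum; last by move=> i; exact: L1_sum.
apply: eq_bigr => i _; rewrite mean_sum//.
by apply: eq_bigr => j _; rewrite meanZ 1?mulrC//; exact: L1M.
Qed.

Lemma measurable_mean_sqr_family :
  measurable_fun [set: R] (fun r => mean P (fun w => family_val r w ^+ 2)).
Proof.
under eq_fun do rewrite mean_sqr_family_val.
apply: measurable_sum => i; apply: measurable_sum => j.
by apply: measurable_funM => //; apply: measurable_funM; exact: measurable_itv_indic.
Qed.

Lemma integrable_itv_indicM i j (c : R) : mu.-integrable `[0%R, 1%R]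
  (fun r => (c * (itv_indic (s i) (t i) r * itv_indic (s j) (t j) r))%:E).
Proof.
rewrite (_ : (fun r => _) = fun r => (c%:E *
    (itv_indic (Num.max (s i) (s j)) (Num.min (t i) (t j)) r)%:E)%E); last first.
  by apply/funext => r; rewrite itv_indicM.
have m01 : measurable (`[0%R, 1%R] : set (measurableTypeR R)) by exact: measurable_itv.
apply: (integrableZl m01 c); apply: (integrableS measurableT) => //.
exact: integrable_indic_itv.
Qed.

(** Both sides are the same double sum over pairs: the overlap is at once the integral of the
    product of two indicators and the covariance of two increments. *)
Lemma ito_isometry :
  (\int[mu]_(r in `[0%R, 1%R]) (mean P (fun w => family_val r w ^+ 2))%:E =
   (mean P (fun w => family_int w ^+ 2))%:E)%E.
Proof.
rewrite mean_sqr_family_int.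
under eq_integral => r _ do rewrite mean_sqr_family_val -sumEFin.
rewrite integral_sum//=; last first.
  move=> i; rewrite (_ : (fun r => _) = fun r => (\sum_j (mean P (fun w => xi i w * xi j w) *
      (itv_indic (s i) (t i) r * itv_indic (s j) (t j) r))%:E)%E); last first.
    by apply/funext => r; rewrite sumEFin.
  by apply: integrable_sum => // j _; exact: integrable_itv_indicM.
rewrite -sumEFin; apply: eq_bigr => i _.
under eq_integral => r _ do rewrite -sumEFin.
rewrite integral_sum//=; last by move=> j; exact: integrable_itv_indicM.
rewrite -sumEFin; apply: eq_bigr => j _.
rewrite EFinM -integral_itv_indicM// -integralZl//.
have := integrable_itv_indicM i j 1.
by apply: eq_integrable => // r _; rewrite mul1r.
Qed.

End family.

End isometry.

(* No measurability: the integral of a nonnegative function is a supremum over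
   the simple functions below it. *)
Lemma ge0_le_integral_sup (R : realType) (d : measure_display)
    (T : measurableType d) (mu : {measure set T -> \bar R}) (D : set T)
    (f g : T -> \bar R) :
  (forall x, D x -> 0 <= f x)%E -> (forall x, D x -> f x <= g x)%E ->
  (\int[mu]_(x in D) f x <= \int[mu]_(x in D) g x)%E.
Proof.
move=> f0 fg; have g0 x : D x -> (0 <= g x)%E by move=> Dx; exact: le_trans (f0 x Dx) (fg x Dx).
rewrite !ge0_integralE//; apply: le_ereal_sup => _ [h hf <-]; exists h => // x.
apply: (le_trans (hf x)); rewrite !patchE; case: ifPn => // /set_mem; exact: fg.
Qed.

(** * Approximation of the Ito integral by elementary integrals *)

Section ito_integral.
Context (R : realType) (d : measure_display) (T : measurableType d).
Variables (P : probability T R) (B : R -> {RV P >-> R}).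
Hypothesis hB : standard_brownian_motion B.
Local Notation mu := (@lebesgue_measure R).

Lemma mean_sqrD_le (X Y : T -> R) : L2 P X -> L2 P Y ->
  mean P (fun w => (X w + Y w) ^+ 2) <=
  2 * mean P (fun w => X w ^+ 2) + 2 * mean P (fun w => Y w ^+ 2).
Proof.
move=> iX iY; have [_ iX2] := iX; have [_ iY2] := iY.
rewrite -!meanZ// -meanD; [|exact: L1Z..].
apply: le_mean; first by case: (L2D iX iY).
  by apply: L1D; exact: L1Z.
by move=> w; have := sqr_ge0 (X w - Y w); nra.
Qed.

Lemma L2_bounded (X : T -> R) (M : R) : measurable_fun [set: T] X ->
  (forall w, `|X w| <= M) -> L2 P X.
Proof.
move=> mX XM; split=> //; apply: (@le_L1 _ _ _ _ _ (fun=> M ^+ 2)).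
- exact: measurable_funX.
- exact: L1_cst.
- move=> w; rewrite !normrX lerXn2r ?nnegrE// (le_trans (XM w))//.
  exact: ler_norm.
Qed.

Lemma expectation_sqr (X : T -> R) : L2 P X ->
  'E_P[fun w => (X w ^+ 2)%R]%E = (mean P (fun w => X w ^+ 2))%:E.
Proof. by case=> _ iX; rewrite unlock EFin_mean. Qed.

(* The Ito isometry, applied to the difference of two elementary processes,
   transports an L^2([0,1] x Omega) estimate to the integrals. *)
Lemma ito_integral_approx (u : R -> T -> R) (Z : T -> R) (J : finType)
    (s t : J -> R) (eta : J -> T -> R) (e : R) :
  is_ito_integral B u Z -> measurable_fun [set: T] Z ->
  (forall r, 0 <= r <= 1 -> L2 P (u r)) ->
  (forall i, 0 <= s i) -> (forall i, s i <= t i) -> (forall i, t i <= 1) ->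
  (forall i, @known R d T P B _ R (s i) (eta i)) -> (forall i, L2 P (eta i)) ->
  (forall r, 0 <= r <= 1 ->
     mean P (fun w => (family_val s t eta r w - u r w) ^+ 2) <= e) ->
  L2 P Z /\ mean P (fun w => (Z w - family_int B s t eta w) ^+ 2) <= 4 * e.
Proof.
move=> [X [aX cX cZ]] mZ iu s0 st t1 keta ieta bnd.
have e0 : 0 <= e.
  by apply: le_trans (bnd 0 _); rewrite ?lexx ?ler01// mean_ge0// => w; exact: sqr_ge0.
have iY := L2_family_int hB s0 st t1 keta ieta.
(* Let S be the elementary integral of a simple process within e' of [u] and of [Z]. The error is at
   most 2 E(S - Z)^2 plus twice the squared distance from S to the family integral, that is 2 e' + 2
   (2 e' + 2 e). Finally e' is sent to 0. *)
have key (e' : R) : 0 < e' -> L2 P Z /\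
    mean P (fun w => (Z w - family_int B s t eta w) ^+ 2) <= 4 * e + 6 * e'.
  move=> e'0.
  have E0 : (0 < e'%:E)%E by rewrite lte_fin.
  have : \forall k \near \oo,
      (\int[mu]_(t in `[0%R, 1%R])
         'E_P[fun w => ((sp_val (X k) t w - u t w) ^+ 2)%R] < e'%:E)%E /\
      ('E_P[fun w => ((sp_int (fun t => B t : T -> R) (X k) w - Z w) ^+ 2)%R] < e'%:E)%E.
    have N0 : nbhs 0%E [set x : \bar R | (x < e'%:E)%E].
      by apply: open_nbhs_nbhs; split=> //; exact: open_ereal_lt_ereal.
    by near=> k; split; near: k; [exact: (cX _ N0)|exact: (cZ _ N0)].
  move=> [k _ /(_ k (leqnn k))] [hX hZ].
  have [n0 n1 nd kX bX] := aX k.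
  set N := sp_size (X k) in n1 nd kX bX.
  have node0 i : (i <= N)%N -> 0 <= sp_node (X k) i.
    by elim: i => // i IH iN; rewrite (le_trans (IH (ltnW iN)))// nd.
  have node1 i : (i <= N)%N -> sp_node (X k) i <= 1.
    move=> iN; apply: le_trans n1.
    have up m : (i + m <= N)%N -> sp_node (X k) i <= sp_node (X k) (i + m).
      elim: m => [|m IH]; first by rewrite addn0.
      by rewrite addnS => mN; rewrite (le_trans (IH (ltnW mN)))// nd.
    by have := up (N - i)%N; rewrite subnKC// => ->.
  pose sX (i : 'I_N) := sp_node (X k) i.
  pose tX (i : 'I_N) := sp_node (X k) i.+1.
  pose xX (i : 'I_N) := sp_coef (X k) i.
  have sX0 i : 0 <= sX i by apply: node0; exact: ltnW.
  have stX i : sX i <= tX i by apply: nd.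
  have tX1 i : tX i <= 1 by apply: node1.
  have kxX i : @known R d T P B _ R (sX i) (xX i) by apply/knownP; exact: kX.
  have ixX i : L2 P (xX i).
    have [M XM] := bX i (ltn_ord i).
    by apply: L2_bounded XM; exact: known_measurable (kxX i).
  (* The difference of the two processes is one family over the disjoint sum of the index types,
     with negated coefficients on the second summand. *)
  pose K := ('I_N + J)%type.
  pose sK (i : K) := match i with inl a => sX a | inr b => s b end.
  pose tK (i : K) := match i with inl a => tX a | inr b => t b end.
  pose xK (i : K) : T -> R :=
    match i with inl a => xX a | inr b => fun w => -1 * eta b w end.
  have sK0 i : 0 <= sK i by case: i => i /=.
  have stK i : sK i <= tK i by case: i => i /=.
  have tK1 i : tK i <= 1 by case: i => i /=.
  have kxK i : @known R d T P B _ R (sK i) (xK i).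
    by case: i => i //=; apply: measurable_funM => //; exact: keta.
  have ixK i : L2 P (xK i) by case: i => i //=; exact: L2Z.
  have intK w : family_int B sK tK xK w =
      sp_int (fun t => B t : T -> R) (X k) w - family_int B s t eta w.
    rewrite /family_int big_sumType/=; congr (_ + _).
    rewrite -sumrN; apply: eq_bigr => i _ /=; ring.
  have valK r w : family_val sK tK xK r w = sp_val (X k) r w - family_val s t eta r w.
    rewrite /family_val big_sumType/=; congr (_ + _).
    rewrite -sumrN; apply: eq_bigr => i _ /=; ring.
  have iso := ito_isometry hB sK0 stK tK1 kxK ixK.
  have iXk r : L2 P (sp_val (X k) r) := L2_family_val sX tX ixX r.
  have iSk : L2 P (sp_int (fun t => B t : T -> R) (X k)).
    exact: (L2_family_int hB sX0 stX tX1 kxX ixX).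
  pose q r := mean P (fun w => family_val sK tK xK r w ^+ 2).
  have q0 r : 0 <= q r by apply: mean_ge0 => w; exact: sqr_ge0.
  have mq : measurable_fun [set: R] q by exact: measurable_mean_sqr_family.
  have qle r : 0 <= r <= 1 -> q r <= 2 *
      mean P (fun w => (sp_val (X k) r w - u r w) ^+ 2) + 2 * e.
    move=> r01; have iur := iu r r01.
    apply: (@le_trans _ _ (2 * mean P (fun w => (sp_val (X k) r w - u r w) ^+ 2) +
        2 * mean P (fun w => (- 1 * (family_val s t eta r w - u r w)) ^+ 2))).
      apply: le_trans (mean_sqrD_le _ _).
      - by rewrite le_eqVlt; apply/orP; left; apply/eqP; apply: eq_mean => w;
          rewrite valK; ring.
      - exact: L2B.
      - by apply: L2Z; apply: L2B => //; exact: L2_family_val.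
    rewrite lerD2l ler_wpM2l// (le_trans _ (bnd r r01))//.
    by rewrite le_eqVlt; apply/orP; left; apply/eqP; apply: eq_mean => w; ring.
  have D_lt : mean P (fun w => family_int B sK tK xK w ^+ 2) <= 2 * e' + 2 * e.
    rewrite -lee_fin -iso.
    pose g r := Num.max (q r / 2 - e) 0.
    have mg : measurable_fun [set: R] g.
      by apply: measurable_maxr => //; apply: measurable_funB => //; exact: measurable_funM.
    have g0 r : 0 <= g r by rewrite le_max lexx orbT.
    have gX : (\int[mu]_(r in `[0%R, 1%R]) (g r)%:E <= e'%:E)%E.
      apply: le_trans (ltW hX); apply: ge0_le_integral_sup.
        by move=> r _; rewrite lee_fin.
      move=> r r01; have iur := iu r r01.
      rewrite (expectation_sqr (L2B (iXk r) iur)) lee_fin ge_max mean_ge0 ?andbT; last first.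
        by move=> w; exact: sqr_ge0.
      by have := qle r r01; lra.
    apply: (@le_trans _ _ (\int[mu]_(r in `[0%R, 1%R]) (2 * g r + 2 * e)%:E)%E).
      apply: ge0_le_integral_sup => r _; first by rewrite lee_fin q0.
      have : q r / 2 - e <= g r by rewrite le_max lexx.
      by rewrite lee_fin -/(q r); lra.
    under eq_integral => r _ do rewrite EFinD EFinM.
    have mgE : measurable_fun (`[0%R, 1%R] : set R) (fun r => (g r)%:E).
      by apply/measurable_EFinP; exact: measurable_funTS.
    have mg2 : measurable_fun (`[0%R, 1%R] : set R) (fun r => 2%:E * (g r)%:E)%E.
      exact: measurable_funeM.
    have g2 (r : R) : (0 <= 2%:E * (g r)%:E)%E by rewrite mule_ge0// lee_fin.
    have e2 : (0 <= (2 * e)%:E)%E by rewrite lee_fin mulr_ge0.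
    rewrite ge0_integralD//.
    have gE (r : R) : (0 <= (g r)%:E)%E by rewrite lee_fin.
    rewrite ge0_integralZl//.
    rewrite integral_cst//= lebesgue_measure_itv/= lte_fin ltr01 oppr0 adde0 mule1.
    apply: (@le_trans _ _ (2%:E * e'%:E + (2 * e)%:E)%E); last by rewrite -EFinM -EFinD.
    by rewrite leeD2r// lee_pmul2l// lte_fin.
  (* [Z] is only measurable a priori; its square integrability is read off the finiteness of its
     distance to an elementary integral. *)
  have iDk : L2 P (fun w => sp_int (fun t => B t : T -> R) (X k) w - Z w).
    split; first by apply: measurable_funB => //; exact: L2_measurable iSk.
    apply/integrableP; split.
      apply/measurable_EFinP/measurable_funX; apply: measurable_funB => //.
      exact: L2_measurable iSk.
    apply: (@le_lt_trans _ _ e'%:E); last exact: ltry.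
    apply: le_trans (ltW hZ); rewrite unlock le_eqVlt; apply/orP; left; apply/eqP.
    by apply: eq_integral => w _ /=; rewrite ger0_norm// sqr_ge0.
  have iZ : L2 P Z.
    rewrite (_ : Z = fun w => sp_int (fun t => B t : T -> R) (X k) w -
       (sp_int (fun t => B t : T -> R) (X k) w - Z w)); first exact: L2B.
    by apply/funext => w; ring.
  split=> //.
  move: hZ; rewrite expectation_sqr// lte_fin => hZ.
  apply: (@le_trans _ _ (2 * mean P (fun w =>
     (-1 * (sp_int (fun t => B t : T -> R) (X k) w - Z w)) ^+ 2) +
     2 * mean P (fun w => family_int B sK tK xK w ^+ 2))).
    apply: le_trans (mean_sqrD_le _ _).
    - rewrite le_eqVlt; apply/orP; left; apply/eqP; apply: eq_mean => w.
      by rewrite intK; ring.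
    - exact: L2Z.
    - exact: (L2_family_int hB).
  rewrite (_ : mean P (fun w => (-1 * _) ^+ 2) = mean P (fun w =>
     (sp_int (fun t => B t : T -> R) (X k) w - Z w) ^+ 2)); last first.
    by apply: eq_mean => w; ring.
  by lra.
split; first by case: (key 1 ltr01).
apply/ler_addgt0Pr => e1 e10.
have e16 : 0 < e1 / 6 by rewrite divr_gt0.
by have [_] := key _ e16; rewrite (_ : 6 * (e1 / 6) = e1)//; field.
Unshelve. all: by end_near. Qed.

End ito_integral.

(** * Gaussian integration by parts *)

Section gaussian_calculus.
Context (R : realType) (d : measure_display) (T : measurableType d).
Variable P : probability T R.
Local Notation mu := (@lebesgue_measure R).

Lemma ge0_normal_law_integral (X : T -> R) (s : R) (g : R -> \bar R) :
  measurable_fun [set: T] X -> has_normal_law P X 0 s ->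
  measurable_fun [set: R] g -> (forall x, 0 <= g x)%E ->
  (\int[P]_w g (X w) = \int[mu]_x (g x * (normal_pdf 0 s x)%:E))%E.
Proof.
move=> mX nX mg g0.
have mX' : measurable_fun [set: T] (X : T -> measurableTypeR R) by [].
transitivity (\int[pushforward_measure P mX']_x g x)%E.
  by rewrite ge0_integral_pushforward.
transitivity (\int[normal_prob 0 s]_x g x)%E.
  by apply: eq_measure_integral => A mA _; exact: nX.
have mp : measurable_fun [set: measurableTypeR R] (normal_pdf 0 s).
  exact: measurable_normal_pdf.
have p0 x : 0 <= normal_pdf 0 s x by exact: normal_pdf_ge0.
have nuE (A : set (measurableTypeR R)) : measurable A ->
    normal_prob 0 s A = (\int[mu]_(x in A) (normal_pdf 0 s x)%:E)%E by [].
by rewrite (ge0_integral_density mp p0 nuE).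
Qed.

Lemma normal_add (X Y : T -> R) (p q : R) :
  measurable_fun [set: T] X -> measurable_fun [set: T] Y ->
  0 < p -> 0 < q -> has_normal_law P X 0 p -> has_normal_law P Y 0 q ->
  indep_RV P X Y ->
  has_normal_law P (fun w => X w + Y w) 0 (Num.sqrt (p ^+ 2 + q ^+ 2)).
Proof.
move=> mX mY p0 q0 nX nY XY A mA.
have mS : measurable_fun [set: T] (fun w => X w + Y w) by exact: measurable_funD.
have mSA : measurable ((fun w => X w + Y w) @^-1` A).
  by rewrite -[X in measurable X]setTI; exact: mS.
rewrite -[X in P X = _]setIT -integral_indic//.
have mi : measurable_fun [set: R] (\1_A : R -> R) by exact: measurable_indic.
pose H (z : R * R) := (\1_A (z.1 + z.2) : R)%:E.
have mH : measurable_fun [set: R * R] H.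
  apply/measurable_EFinP; apply: (measurableT_comp mi); exact: measurable_funD.
transitivity (\int[P]_w H (X w, Y w))%E.
  by apply: eq_integral => w _; rewrite /H/= !indicE;
    congr ((_ : bool)%:R%:E); apply/idP/idP; rewrite !inE.
have H0 z : (0 <= H z)%E by rewrite lee_fin.
rewrite (ge0_indep_integral mX mY XY mH H0).
have mpdf s : measurable_fun [set: R] (normal_pdf 0 s) by exact: measurable_normal_pdf.
pose G (z : R * R) := (\1_A (z.1 + z.2) * normal_pdf 0 p z.2)%:E.
have mG : measurable_fun [set: R * R] G.
  apply/measurable_EFinP; apply: measurable_funM; last exact: (measurableT_comp (mpdf p)).
  by apply: (measurableT_comp mi); exact: measurable_funD.
have G0 z : (0 <= G z)%E by rewrite lee_fin mulr_ge0 ?normal_pdf_ge0.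
have inner y : (\int[P]_w H (X w, y) = \int[mu]_x G (y, x))%E.
  rewrite (@ge0_normal_law_integral X p (fun x => H (x, y)))//.
  - by apply: eq_integral => x _; rewrite /G/= addrC.
  - exact: measurable_fun_pairl.
under eq_integral => w _ do rewrite inner.
rewrite (@ge0_normal_law_integral Y q (fun y => \int[mu]_x G (y, x))%E)//.
- rewrite addrC -normal_prob_convolution//; apply: eq_integral => y _.
  rewrite -ge0_integralZr//; last 2 first.
  + apply: (measurableT_comp mG); exact: measurable_fun_pair.
  + by rewrite lee_fin normal_pdf_ge0.
  apply: eq_integral => x _; rewrite /G/= -EFinM; congr EFin; ring.
- exact: (measurable_fun_fubini_tonelli_F (m2 := mu) G mG).
- by move=> y; apply: integral_ge0.
Qed.

(** Integrating out W given (V, Y) leaves [psi] evaluated at V, which does not involve Y;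
    independence of V and Y then factors the probability. *)
Lemma indep_RVD (d' : measure_display) (S : measurableType d')
    (V W : T -> R) (Y : T -> S) :
  measurable_fun [set: T] V -> measurable_fun [set: T] W ->
  measurable_fun [set: T] Y -> indep_RV P V Y ->
  indep_RV P W (fun w => (V w, Y w)) ->
  indep_RV P (fun w => V w + W w) Y.
Proof.
move=> mV mW mY VY WVY A C mA mC.
have mi : measurable_fun [set: R] (\1_A : R -> R) by exact: measurable_indic.
have mS : measurable_fun [set: T] (fun w => V w + W w) by exact: measurable_funD.
have mSA : measurable ((fun w => V w + W w) @^-1` A).
  by rewrite -[X in measurable X]setTI; exact: mS.
have mVY : measurable_fun [set: T] (fun w => (V w, Y w)) by exact: measurable_fun_pair.
pose F (z : R * R) := (\1_A (z.2 + z.1) : R)%:E.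
have mF : measurable_fun [set: R * R] F.
  apply/measurable_EFinP; apply: (measurableT_comp mi); exact: measurable_funD.
have F0 z : (0 <= F z)%E by rewrite lee_fin.
pose psi v := (\int[P]_w F (W w, v))%E.
have psi0 v : (0 <= psi v)%E by apply: integral_ge0.
have mpsi : measurable_fun [set: R] psi.
  pose G (z : R * T) := F (W z.2, z.1).
  have mG : measurable_fun [set: R * T] G.
    apply: (measurableT_comp mF); apply: measurable_fun_pair => //.
    exact: measurableT_comp.
  have G0 z : (0 <= G z)%E by exact: F0.
  exact: (measurable_fun_fubini_tonelli_F (m2 := P) G mG).
have key (D : set S) : measurable D ->
    (P ((fun w => (V w + W w)%R) @^-1` A `&` Y @^-1` D) =
     (\int[P]_w psi (V w)) * P (Y @^-1` D))%E.
  move=> mD.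
  have mjD : measurable_fun [set: S] (\1_D : S -> R) by exact: measurable_indic.
  have mYD : measurable (Y @^-1` D) by rewrite -[X in measurable X]setTI; exact: mY.
  pose H (z : R * (R * S)) := (\1_A (z.2.1 + z.1) * \1_D z.2.2 : R)%:E.
  have mH : measurable_fun [set: R * (R * S)] H.
    apply/measurable_EFinP; apply: measurable_funM.
      apply: (measurableT_comp mi); apply: measurable_funD => //.
      exact: (measurableT_comp measurable_fst measurable_snd).
    apply: (measurableT_comp mjD).
    exact: (measurableT_comp measurable_snd measurable_snd).
  have H0 z : (0 <= H z)%E by rewrite lee_fin mulr_ge0.
  pose K (z : R * S) := (psi z.1 * (\1_D z.2 : R)%:E)%E.
  have mK : measurable_fun [set: R * S] K.
    apply: emeasurable_funM; first exact: (measurableT_comp mpsi).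
    by apply/measurable_EFinP; exact: (measurableT_comp mjD).
  have K0 z : (0 <= K z)%E by rewrite mule_ge0// lee_fin.
  rewrite -[X in P X = _]setIT -integral_indic//; last exact: measurableI.
  transitivity (\int[P]_w H (W w, (V w, Y w)))%E.
    apply: eq_integral => w _; rewrite /H/= !indicE -natrM mulnb.
    congr ((_ : bool)%:R%:E).
    apply/idP/andP => [/set_mem[h1 h2]|[/set_mem h1 /set_mem h2]].
      by split; exact: mem_set.
    by apply: mem_set.
  rewrite (ge0_indep_integral mW mVY WVY mH H0).
  transitivity (\int[P]_w K (V w, Y w))%E.
    apply: eq_integral => w _; rewrite /K/= /psi -ge0_integralZr//; last first.
      apply: (measurableT_comp mF); exact: measurable_fun_pair.
  rewrite (ge0_indep_integral mV mY VY mK K0).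
  under eq_integral => w _.
    rewrite /K/= ge0_integralZr//; last first.
      exact: (measurableT_comp mpsi).
    over.
  rewrite ge0_integralZl//; last 2 first.
  - by apply/measurable_EFinP; exact: (measurableT_comp mjD).
  - by apply: integral_ge0.
  by congr (_ * _)%E; rewrite -[X in _ = P X]setIT -integral_indic.
rewrite key//; congr (_ * _)%E.
(* Taking D to be the whole space identifies the integral of [psi] at V as the probability that V +
   W lies in A. *)
have := key setT measurableT; rewrite preimage_setT setIT => ->.
by rewrite probability_setT mule1.
Qed.

Lemma stein_normal (X : T -> R) (s : R) (psi psi' : R -> R) (C : R) :
  measurable_fun [set: T] X -> 0 < s -> has_normal_law P X 0 s ->
  (forall x : R, is_derive x 1 psi (psi' x)) -> continuous psi' ->
  (forall x, `|psi x| <= C) -> (forall x, `|psi' x| <= C) ->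
  mean P (fun w => X w * psi (X w)) = s ^+ 2 * mean P (fun w => psi' (X w)).
Proof.
move=> mX s0 nX dpsi cpsi' bpsi bpsi'.
have mU : measurable_fun [set: T] (fun w => s^-1 * X w) by exact: measurable_funM.
have nU := normalized_law s0 nX.
have sU w : s * (s^-1 * X w) = X w by rewrite mulVKf// gt_eqF.
have C0 : 0 <= C by exact: le_trans (bpsi 0).
(* A common bound for psi(s x) and its derivative s psi'(s x), since [stein] takes a single
   constant. *)
pose D := C * (1 + s).
have D1 : C <= D by rewrite /D ler_peMr// lerDl ltW.
have D2 : s * C <= D by rewrite /D mulrDr mulr1 mulrC lerDr.
have mpsi' : measurable_fun [set: R] psi' by exact: continuous_measurable_fun.
have l' : L1 P (fun w => psi' (X w)).
  apply: (@le_L1 _ _ _ _ _ (fun=> C)).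
  - exact: measurableT_comp.
  - exact: L1_cst.
  - by move=> w; rewrite (le_trans (bpsi' _))// ler_norm.
have dpsis (x : R) : is_derive x 1 (fun x => psi (s * x)) (s * psi' (s * x)).
  have h : is_derive x 1 (fun x : R => s * x) s.
    by apply: is_derive_eq; rewrite /GRing.scale/= mulr1.
  have h2 := is_derive1_comp (dpsi (s * x)) h.
  by apply: (is_derive_eq h2); rewrite mulrC.
have cs : continuous (fun x => s * psi' (s * x)).
  move=> x; apply: cvgMr; apply: (@cvg_comp _ _ _ (fun x => s * x) psi' _ (nbhs (s * x))).
    by apply: cvgMr; exact: cvg_id.
  exact: cpsi'.
have b1 x : `|psi (s * x)| <= D * (1 + `|x|).
  rewrite (le_trans (bpsi _))// (le_trans D1)// ler_peMr ?lerDl//.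
  exact: le_trans C0 D1.
have b2 x : `|s * psi' (s * x)| <= D.
  by rewrite normrM gtr0_norm// (le_trans _ D2)// ler_wpM2l// ltW.
have [l e] := stein mU nU dpsis cs b1 b2.
transitivity (s * mean P (fun w => s^-1 * X w * psi (s * (s^-1 * X w)))).
  by rewrite -meanZ//; apply: eq_mean => w; rewrite sU mulrA mulVKf ?gt_eqF.
rewrite e; transitivity (s * mean P (fun w => s * psi' (X w))).
  by congr (_ * _); apply: eq_mean => w; rewrite sU.
by rewrite meanZ// mulrA expr2.
Qed.

End gaussian_calculus.

Section gaussian_ibp.
Context (R : realType) (d : measure_display) (T : measurableType d).
Variable P : probability T R.

(* Gaussian integration by parts in the coordinate X, the linear functional
   y + a X + V playing the role of a Wiener integral. *)
Lemma gaussian_ibp (X V th be y : T -> R) (s a M : R) (phi phi' : R -> R) :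
  measurable_fun [set: T] V -> L2 P X -> 0 < s -> has_normal_law P X 0 s ->
  L2 P th -> L2 P be -> measurable_fun [set: T] y ->
  indep_RV P X (fun w => (th w, (be w, y w))) ->
  indep_RV P V (fun w => (X w, (th w, (be w, y w)))) ->
  (forall x : R, is_derive x 1 phi (phi' x)) -> continuous phi' ->
  (forall x, `|phi x| <= M) -> (forall x, `|phi' x| <= M) ->
  mean P (fun w => X w * th w * phi (be w * (y w + a * X w + V w))) =
  s ^+ 2 * a * mean P (fun w => th w * be w * phi' (be w * (y w + a * X w + V w))).
Proof.
move=> mV iX s0 nX ith ibe my XY VXY dphi cphi' bphi bphi'.
have mX := L2_measurable iX; have mth := L2_measurable ith.
have mbe := L2_measurable ibe.
have M0 : 0 <= M by exact: le_trans (bphi 0).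
have cphi : continuous phi.
  by move=> x; apply: differentiable_continuous; exact/derivable1_diffP.
have mphi : measurable_fun [set: R] phi by exact: continuous_measurable_fun.
have mphi' : measurable_fun [set: R] phi' by exact: continuous_measurable_fun.
have mY : measurable_fun [set: T] (fun w => (th w, (be w, y w))).
  by apply: measurable_fun_pair => //; exact: measurable_fun_pair.
have mXY : measurable_fun [set: T] (fun w => (X w, (th w, (be w, y w)))).
  exact: measurable_fun_pair.
have marg (g : T -> R) : measurable_fun [set: T] g ->
    measurable_fun [set: T] (fun w => be w * (y w + a * X w + g w)).
  move=> mg; apply: measurable_funM => //; apply: measurable_funD => //.
  by apply: measurable_funD => //; exact: measurable_funM.
have iXth : L1 P (fun w => X w * th w) by exact: L1M.
have ithbe : L1 P (fun w => th w * be w) by exact: L1M.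
have i1 (g : T -> R) : measurable_fun [set: T] g ->
    L1 P (fun w => X w * th w * phi (be w * (y w + a * X w + g w))).
  move=> mg; apply: (@L1_bounded _ _ _ _ _ _ M) => //.
  by apply: (measurableT_comp mphi); exact: marg.
have i2 (g : T -> R) : measurable_fun [set: T] g ->
    L1 P (fun w => th w * be w * phi' (be w * (y w + a * X w + g w))).
  move=> mg; apply: (@L1_bounded _ _ _ _ _ _ M) => //.
  by apply: (measurableT_comp mphi'); exact: marg.
pose RR := (R * (R * R))%type.
have m1 : measurable_fun [set: R * RR] (fun z : R * RR => z.2.1).
  exact: (measurableT_comp measurable_fst measurable_snd).
have m2 : measurable_fun [set: R * RR] (fun z : R * RR => z.2.2.1).
  apply: (measurableT_comp measurable_fst).
  exact: (measurableT_comp measurable_snd measurable_snd).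
have m3 : measurable_fun [set: R * RR] (fun z : R * RR => z.2.2.2).
  apply: (measurableT_comp measurable_snd).
  exact: (measurableT_comp measurable_snd measurable_snd).
have marg2 (c : R) : measurable_fun [set: R * RR]
    (fun z : R * RR => z.2.2.1 * (z.2.2.2 + a * z.1 + c)).
  apply: measurable_funM => //; apply: measurable_funD => //.
  by apply: measurable_funD => //; exact: measurable_funM.
(* V is frozen at the value c, and (th, be, y) by their independence from X; what remains is Stein's
   identity for x -> phi(be (y + a x + c)). *)
have step1 c :
    mean P (fun w => X w * th w * phi (be w * (y w + a * X w + c))) =
    s ^+ 2 * a * mean P (fun w => th w * be w * phi' (be w * (y w + a * X w + c))).
  pose H1 (z : R * RR) := z.1 * z.2.1 * phi (z.2.2.1 * (z.2.2.2 + a * z.1 + c)).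
  pose H2 (z : R * RR) :=
    s ^+ 2 * a * (z.2.1 * z.2.2.1 * phi' (z.2.2.1 * (z.2.2.2 + a * z.1 + c))).
  have mH1 : measurable_fun [set: R * RR] H1.
    apply: measurable_funM; first exact: measurable_funM.
    exact: (measurableT_comp mphi).
  have mH2 : measurable_fun [set: R * RR] H2.
    apply: measurable_funM => //; apply: measurable_funM; first exact: measurable_funM.
    exact: (measurableT_comp mphi').
  have mc : measurable_fun [set: T] (fun=> c) by [].
  have mcst (z : RR) : measurable_fun [set: T] (fun w => z.2.1 * (z.2.2 + a * X w + c)).
    apply: measurable_funM => //; apply: measurable_funD => //.
    by apply: measurable_funD => //; exact: measurable_funM.
  have iH1 (z : RR) : L1 P (fun w => H1 (X w, z)).
    rewrite /H1/=; apply: (@L1_bounded _ _ _ _ _ _ M) => //.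
      exact: (measurableT_comp mphi).
    by under eq_fun do rewrite mulrC; apply: L1Z; exact: L2_L1.
  have iH2 (z : RR) : L1 P (fun w => H2 (X w, z)).
    rewrite /H2/=; apply: L1Z; apply: (@L1_bounded _ _ _ _ (fun w => phi' _) (fun=> _) M) => //.
      exact: (measurableT_comp mphi').
    exact: L1_cst.
  rewrite -meanZ; last exact: i2.
  rewrite (indep_mean mX mY XY mH1 (i1 _ mc) iH1).
  have iH2' : L1 P (fun w => H2 (X w, (th w, (be w, y w)))) by exact/L1Z/i2.
  rewrite -[RHS]/(mean P (fun w => H2 (X w, (th w, (be w, y w))))).
  rewrite (indep_mean mX mY XY mH2 iH2' iH2).
  apply: eq_mean => w; rewrite /H1 /H2/=.
  pose psi x := phi (be w * (y w + a * x + c)).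
  pose psi' x := be w * a * phi' (be w * (y w + a * x + c)).
  have dpsi (x : R) : is_derive x 1 psi (psi' x).
    have h : is_derive x 1 (fun x : R => be w * (y w + a * x + c)) (be w * a).
      by apply: is_derive_eq; rewrite /GRing.scale/=; ring.
    have h2 := @is_derive1_comp _ phi (fun x : R => be w * (y w + a * x + c)) x _ _ (dphi _) h.
    by apply: (is_derive_eq h2); rewrite mulrC.
  have cpsi' : continuous psi'.
    move=> x; apply: cvgMr.
    apply: (@cvg_comp _ _ _ (fun x => be w * (y w + a * x + c)) phi' _
      (nbhs (be w * (y w + a * x + c)))); last exact: cphi'.
    apply: cvgMr; apply: cvgD; last exact: cvg_cst.
    by apply: cvgD; [exact: cvg_cst|apply: cvgMr; exact: cvg_id].
  (* The bound may depend on [be w], since w is fixed in the inner expectation; [be] itself is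
     unbounded. *)
  pose C := M * (1 + `|be w * a|).
  have b1 x : `|psi x| <= C.
    by rewrite (le_trans (bphi _))// /C ler_peMr// lerDl.
  have b2 x : `|psi' x| <= C.
    apply: (@le_trans _ _ (`|be w * a| * M)); first by rewrite normrM ler_wpM2l.
    by rewrite /C mulrC ler_wpM2l// lerDr.
  have mpsi : measurable_fun [set: R] psi.
    by apply: continuous_measurable_fun => x;
      apply: differentiable_continuous; exact/derivable1_diffP.
  have mpsi' : measurable_fun [set: R] psi' by exact: continuous_measurable_fun.
  have st := stein_normal mX s0 nX dpsi cpsi' b1 b2.
  have ipsi : L1 P (fun w' => X w' * psi (X w')).
    by apply: (L1_bounded _ (fun w' => b1 (X w')) (L2_L1 iX)); exact: measurableT_comp.
  have ipsi' : L1 P (fun w' => psi' (X w')).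
    apply: (@le_L1 _ _ _ _ _ (fun=> C)); [exact: measurableT_comp|exact: L1_cst|].
    by move=> w'; rewrite (le_trans (b2 _))// ler_norm.
  transitivity (th w * mean P (fun w' => X w' * psi (X w'))).
    by rewrite -meanZ//; apply: eq_mean => w'; rewrite /psi; ring.
  rewrite st mulrA -meanZ//; apply: eq_mean => w'; rewrite /psi'; ring.
pose W w := (X w, (th w, (be w, y w))).
have WV : indep_RV P W V by move=> A C mA mC; rewrite setIC VXY// muleC.
pose H1 (z : R * RR * R) :=
  z.1.1 * z.1.2.1 * phi (z.1.2.2.1 * (z.1.2.2.2 + a * z.1.1 + z.2)).
pose H2 (z : R * RR * R) := s ^+ 2 * a *
  (z.1.2.1 * z.1.2.2.1 * phi' (z.1.2.2.1 * (z.1.2.2.2 + a * z.1.1 + z.2))).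
have mX3 : measurable_fun [set: R * RR * R] (fun z : R * RR * R => z.1.1).
  exact: (measurableT_comp measurable_fst measurable_fst).
have mth3 : measurable_fun [set: R * RR * R] (fun z : R * RR * R => z.1.2.1).
  exact: (measurableT_comp m1 measurable_fst).
have mbe3 : measurable_fun [set: R * RR * R] (fun z : R * RR * R => z.1.2.2.1).
  exact: (measurableT_comp m2 measurable_fst).
have marg3 : measurable_fun [set: R * RR * R]
    (fun z : R * RR * R => z.1.2.2.1 * (z.1.2.2.2 + a * z.1.1 + z.2)).
  apply: measurable_funM => //; apply: measurable_funD => //.
  apply: measurable_funD; first exact: (measurableT_comp m3 measurable_fst).
  exact: measurable_funM.
have mH1 : measurable_fun [set: R * RR * R] H1.
  apply: measurable_funM; first exact: measurable_funM.
  exact: (measurableT_comp mphi).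
have mH2 : measurable_fun [set: R * RR * R] H2.
  apply: measurable_funM => //; apply: measurable_funM; first exact: measurable_funM.
  exact: (measurableT_comp mphi').
have mc (c : R) : measurable_fun [set: T] (fun=> c) by [].
have iH1 c : L1 P (fun w => H1 (W w, c)) by exact: (i1 _ (mc c)).
have iH2 c : L1 P (fun w => H2 (W w, c)) by exact/L1Z/(i2 _ (mc c)).
rewrite -meanZ; last exact: i2.
have iH1' : L1 P (fun w => H1 (W w, V w)) by exact: i1.
have iH2' : L1 P (fun w => H2 (W w, V w)) by exact/L1Z/i2.
rewrite -[LHS]/(mean P (fun w => H1 (W w, V w))).
rewrite -[RHS]/(mean P (fun w => H2 (W w, V w))).
rewrite (indep_mean mXY mV WV mH1 iH1' iH1) (indep_mean mXY mV WV mH2 iH2' iH2).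
apply: eq_mean => w; rewrite [RHS]meanZ; last exact: (i2 _ (mc (V w))).
exact: step1.
Qed.

End gaussian_ibp.

(** * The second chaos on a grid *)

Section grid.
Context (R : realType) (d : measure_display) (T : measurableType d).
Variables (P : probability T R) (B : R -> {RV P >-> R}).
Hypothesis hB : standard_brownian_motion B.
Variables (N : nat) (tau h : R) (a : nat -> R).
Hypotheses (tau0 : 0 < tau) (h0 : 0 < h) (tauN : tau + N%:R * h <= 1).
Hypothesis a0 : forall k, (k < N)%N -> 0 < a k.

Definition node i : R := tau + i%:R * h.
Definition step i : T -> R := incr B (node i) (node i.+1).
Definition tail l (w : T) : R := \sum_(l <= k < N) a k * step k w.

Lemma node_le i j : (i <= j)%N -> node i <= node j.
Proof. by move=> ij; rewrite lerD2l ler_wpM2r ?ler_nat// ltW. Qed.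

Lemma node_lt i : node i < node i.+1.
Proof. by rewrite ltrD2l ltr_pM2r// ltr_nat. Qed.

Lemma node_ge0 i : 0 <= node i.
Proof. by rewrite addr_ge0 ?mulr_ge0// ltW. Qed.

Lemma node_le1 i : (i <= N)%N -> node i <= 1.
Proof. by move=> /node_le/le_trans; apply. Qed.

Lemma nodeB i : node i.+1 - node i = h.
Proof. by rewrite /node -natr1; ring. Qed.

Lemma known_step i j : (i < j)%N -> known B (node j) (step i).
Proof.
move=> ij; apply: known_incr; [exact: node_ge0|exact/ltW/node_lt|exact: node_le].
Qed.

Lemma step_moments i : (i < N)%N -> L2 P (step i).
Proof.
move=> iN; have [] := incr_moments hB (node_ge0 i) (ltW (node_lt i)) (node_le1 iN).
by [].
Qed.

Lemma step_law i : (i < N)%N -> has_normal_law P (step i) 0 (Num.sqrt h).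
Proof.
move=> iN; rewrite -(nodeB i).
exact: (incr_law hB (node_ge0 i) (node_lt i) (node_le1 iN)).
Qed.

Lemma step_indep (d' : measure_display) (S : measurableType d') i (Y : T -> S) :
  (i < N)%N -> known B (node i) Y -> indep_RV P (step i) Y.
Proof.
by move=> iN kY; exact: (incr_indep hB (node_ge0 i) (node_lt i) (node_le1 iN)).
Qed.

Lemma measurable_step i : measurable_fun [set: T] (step i).
Proof. exact: measurable_incr. Qed.

Lemma measurable_sum_steps (s : seq nat) :
  measurable_fun [set: T] (fun w => \sum_(k <- s) a k * step k w).
Proof.
by apply: measurable_sum => k; apply: measurable_funM => //; exact: measurable_step.
Qed.

(** Backward induction from the empty tail at l = N: the increment over cell l is independent of Y,
    and the tail from l + 1 on is independent of the pair of that increment and Y, both known at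
    node l + 1. *)
Lemma tail_indep (d' : measure_display) (S : measurableType d') l (Y : T -> S) :
  (l <= N)%N -> known B (node l) Y -> indep_RV P (tail l) Y.
Proof.
move=> lN; rewrite -(subKn lN); move: (N - l)%N (leq_subr l N) => m {l lN}.
elim: m d' S Y => [|m IH] d' S Y mN kY.
  move=> A C mA mC; have -> : tail (N - 0) = fun=> 0.
    by apply/funext => w; rewrite /tail subn0 big_geq.
  rewrite preimage_cst; case: ifPn => _; last by rewrite set0I measure0 mul0e.
  by rewrite setTI probability_setT mul1e.
have lN : (N - m.+1 < N)%N by rewrite ltn_subrL /= (leq_trans _ mN).
have lS : (N - m.+1).+1 = (N - m)%N by rewrite subnSK.
have -> : tail (N - m.+1) =
    fun w => a (N - m.+1)%N * step (N - m.+1) w + tail (N - m) w.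
  by apply/funext => w; rewrite /tail big_ltn// lS.
apply: indep_RVD.
- by apply: measurable_funM => //; exact: measurable_step.
- exact: measurable_sum_steps.
- exact: known_measurable kY.
- have mg : measurable_fun [set: R] (fun x : R => a (N - m.+1)%N * x).
    exact: measurable_funM.
  exact: (indep_RV_comp mg (step_indep lN kY)).
- apply: IH; first exact: ltnW.
  apply: measurable_fun_pair; last first.
    by apply: known_le kY; apply: node_le; rewrite -lS.
  by apply: measurable_funM => //; apply: known_step; rewrite -lS.
Qed.

(** Backward induction through [normal_add]; the conditions l < N and a k > 0 keep all standard
    deviations positive, as that lemma asks. *)
Lemma tail_law l : (l < N)%N ->
  has_normal_law P (tail l) 0 (Num.sqrt (h * \sum_(l <= k < N) a k ^+ 2)).
Proof.
move=> lN; rewrite -(subKn (ltnW lN)).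
have : (0 < N - l)%N by rewrite subn_gt0.
move: (N - l)%N (leq_subr l N) => m {l lN}; case: m => // m mN _.
have sh : 0 < Num.sqrt h by rewrite sqrtr_gt0.
have head m' : (m' < N)%N -> has_normal_law P
    (fun w => a (N - m'.+1)%N * step (N - m'.+1) w) 0
    (a (N - m'.+1)%N * Num.sqrt h).
  move=> m'N; have lN : (N - m'.+1 < N)%N by rewrite ltn_subrL /= (leq_trans _ m'N).
  have := has_normal_lawZ (lt0r_neq0 (a0 lN)) sh (step_law lN).
  by rewrite gtr0_norm ?a0.
elim: m mN => [|m IH] mN.
  have lN : (N - 1 < N)%N by rewrite ltn_subrL /=.
  have lS : (N - 1).+1 = N by rewrite subnSK ?subn0.
  have -> : tail (N - 1) = fun w => a (N - 1)%N * step (N - 1) w.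
    by apply/funext => w; rewrite /tail big_ltn// lS big_geq// addr0.
  rewrite big_ltn// lS big_geq// addr0 sqrtrM ?ltW// sqrtr_sqr.
  by rewrite gtr0_norm ?a0// mulrC; exact: head.
have lN : (N - m.+2 < N)%N by rewrite ltn_subrL /= (leq_trans _ mN).
have lS : (N - m.+2).+1 = (N - m.+1)%N by rewrite subnSK.
have -> : tail (N - m.+2) =
    fun w => a (N - m.+2)%N * step (N - m.+2) w + tail (N - m.+1) w.
  by apply/funext => w; rewrite /tail big_ltn// lS.
have v0 : 0 < h * \sum_(N - m.+1 <= k < N) a k ^+ 2.
  rewrite mulr_gt0// big_ltn ?ltn_subrL ?(leq_trans _ mN)//.
  rewrite ltr_pwDl ?exprn_gt0 ?a0 ?ltn_subrL ?(leq_trans _ mN)//.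
  by rewrite sumr_ge0// => k _; exact: sqr_ge0.
rewrite (_ : Num.sqrt _ = Num.sqrt ((a (N - m.+2)%N * Num.sqrt h) ^+ 2 +
    Num.sqrt (h * \sum_(N - m.+1 <= k < N) a k ^+ 2) ^+ 2)); last first.
  congr Num.sqrt; rewrite big_ltn// lS exprMn !sqr_sqrtr ?ltW//; ring.
apply: normal_add => //.
- by apply: measurable_funM => //; exact: measurable_step.
- exact: measurable_sum_steps.
- by rewrite mulr_gt0 ?a0.
- by rewrite sqrtr_gt0.
- exact: head.
- exact/IH/ltnW.
- move=> A C mA mC; rewrite setIC muleC; apply: tail_indep => //.
    exact: leq_subr.
  by apply: measurable_funM => //; apply: known_step; rewrite -lS.
Qed.

Definition gsum := tail 0.
Definition start : T -> R := B tau.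

Lemma tau_le1 : tau <= 1.
Proof. by rewrite (le_trans _ tauN)// lerDl mulr_ge0// ltW. Qed.

Lemma start_moments : L2 P start /\ mean P (fun w => start w ^+ 2) = tau.
Proof. exact: (path_moments hB tau0 tau_le1). Qed.

Lemma known_start i : known B (node i) start.
Proof.
by apply: known_path; [exact: ltW|rewrite lerDl mulr_ge0// ltW].
Qed.

Lemma measurable_gsum : measurable_fun [set: T] gsum.
Proof. exact: measurable_sum_steps. Qed.

Lemma L2_gsum : L2 P gsum.
Proof.
rewrite /gsum /tail; under eq_fun do rewrite big_mkord.
by apply: L2_sum => k; apply: L2Z; exact: step_moments.
Qed.

(** g splits into the increments before cell i, the one of cell i and the later ones, which are y, a
    X and V in [gaussian_ibp]; [start] is the factor be. *)
Lemma step_ibp i (th : T -> R) (M : R) (phi phi' : R -> R) : (i < N)%N ->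
  known B (node i) th -> L2 P th ->
  (forall x : R, is_derive x 1 phi (phi' x)) -> continuous phi' ->
  (forall x, `|phi x| <= M) -> (forall x, `|phi' x| <= M) ->
  mean P (fun w => step i w * th w * phi (start w * gsum w)) =
  h * a i * mean P (fun w => th w * start w * phi' (start w * gsum w)).
Proof.
move=> iN kth ith dphi cphi' b1 b2.
pose y w := \sum_(0 <= k < i) a k * step k w.
have ky : known B (node i) y.
  rewrite /known /y; under eq_fun do rewrite big_mkord.
  apply: measurable_sum => k; apply: measurable_funM => //.
  exact: known_step.
have kY : known B (node i) (fun w => (th w, (start w, y w))).
  apply: measurable_fun_pair => //; apply: measurable_fun_pair => //.
  exact: known_start.
have kXY : known B (node i.+1) (fun w => (step i w, (th w, (start w, y w)))).
  apply: measurable_fun_pair; first exact: known_step.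
  exact: known_le (ltW (node_lt i)) kY.
have gE w : gsum w = y w + a i * step i w + tail i.+1 w.
  by rewrite /gsum /tail (big_cat_nat (n := i))//= 1?ltnW// -addrA -big_ltn.
have sh : 0 < Num.sqrt h by rewrite sqrtr_gt0.
have := gaussian_ibp (a i) (measurable_sum_steps (index_iota i.+1 N))
  (step_moments iN) sh (step_law iN) ith start_moments.1 (known_measurable ky)
  (step_indep iN kY) (tail_indep iN kXY) dphi cphi' b1 b2.
rewrite sqr_sqrtr ?ltW//.
move=> E; transitivity (mean P (fun w => step i w * th w *
    phi (start w * (y w + a i * step i w + tail i.+1 w)))).
  by apply: eq_mean => w; rewrite gE.
by rewrite E; congr (_ * _); apply: eq_mean => w; rewrite gE.
Qed.

Definition displ i : T -> R := incr B tau (node i).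

Lemma tau_le_node i : tau <= node i.
Proof. by rewrite lerDl mulr_ge0// ltW. Qed.

Lemma displE i w : displ i w = \sum_(j < i) step j w.
Proof.
elim: i => [|i IH]; first by rewrite big_ord0 /displ /incr /node mul0r addr0 subrr.
by rewrite big_ord_recr/= -IH /displ /step /incr; ring.
Qed.

Lemma known_displ i : known B (node i) (displ i).
Proof. by apply: known_incr => //; [exact: ltW|exact: tau_le_node]. Qed.

Lemma displ_moments i : (i <= N)%N ->
  L2 P (displ i) /\ mean P (fun w => displ i w ^+ 2) = i%:R * h.
Proof.
move=> iN; have [l _ m] := incr_moments hB (ltW tau0) (tau_le_node i) (node_le1 iN).
by split=> //; rewrite m /node; ring.
Qed.

Definition chaos w : R := \sum_(i < N) a i * displ i w * step i w.
(** The sum of h^2 a_i^2 a_j over j < i, grouped as the successive integrations by parts in cells i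
    and j produce it. *)
Definition second_coef : R := \sum_(i < N) (h * a i ^+ 2) * \sum_(j < i) (h * a j).

Lemma chaosE w : \sum_(i < N) a i * B (node i) w * step i w =
  start w * gsum w + chaos w.
Proof.
rewrite /gsum /tail big_mkord mulr_sumr -big_split/=; apply: eq_bigr => i _.
by rewrite /displ /incr /start; ring.
Qed.

Lemma L2_displ_step i : (i < N)%N -> L2 P (fun w => displ i w * step i w).
Proof.
move=> iN; apply: (L2M_incr hB (node_ge0 i) (ltW (node_lt i)) (node_le1 iN)).
  exact: known_displ.
by case: (displ_moments (ltnW iN)).
Qed.

Lemma L2_chaos : L2 P chaos.
Proof.
apply: L2_sum => i; under eq_fun do rewrite -mulrA.
by apply: L2Z; exact: L2_displ_step.
Qed.

Lemma L1M_bounded (X : T -> R) (g : R -> R) (M : R) : L1 P X -> continuous g ->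
  (forall x, `|g x| <= M) -> L1 P (fun w => X w * g (start w * gsum w)).
Proof.
move=> iX cg gM; apply: (L1_bounded _ (fun w => gM _) iX).
apply: measurableT_comp; first exact: continuous_measurable_fun.
by apply: measurable_funM; [exact: measurable_funP|exact: measurable_gsum].
Qed.

(** Integrating by parts in cell i uses up its increment and brings out h a_i B_tau. The remaining
    factor B_(t_i) - B_tau is the sum of the increments of the cells j < i, and a second integration
    by parts in cell j brings out h a_j B_tau. *)
Lemma mean_chaos (M : R) (f1 f2 f3 : R -> R) :
  (forall x : R, is_derive x 1 f1 (f2 x)) ->
  (forall x : R, is_derive x 1 f2 (f3 x)) -> continuous f3 ->
  (forall x, `|f1 x| <= M) -> (forall x, `|f2 x| <= M) -> (forall x, `|f3 x| <= M) ->
  mean P (fun w => chaos w * f1 (start w * gsum w)) =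
  second_coef * mean P (fun w => start w ^+ 2 * f3 (start w * gsum w)).
Proof.
move=> df1 df2 cf3 b1 b2 b3.
have cont (g g' : R -> R) : (forall x : R, is_derive x 1 g (g' x)) -> continuous g.
  by move=> dg x; apply: differentiable_continuous; exact/derivable1_diffP.
have cf1 := cont _ _ df1; have cf2 := cont _ _ df2.
have [istart _] := start_moments.
have i1 (i : 'I_N) : L1 P (fun w => step i w * displ i w * f1 (start w * gsum w)).
  apply: L1M_bounded b1 => //; apply: L1M; first exact: step_moments.
  by case: (displ_moments (ltnW (ltn_ord i))).
transitivity (mean P (fun w => \sum_(i < N)
    a i * (step i w * displ i w * f1 (start w * gsum w)))).
  by apply: eq_mean => w; rewrite mulr_suml; apply: eq_bigr => i _; ring.
rewrite mean_sum; last by move=> i; exact: L1Z.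
rewrite mulr_suml; apply: eq_bigr => i _; rewrite meanZ//.
have [idi _] := displ_moments (ltnW (ltn_ord i)).
rewrite (step_ibp (ltn_ord i) (@known_displ i) idi df1 cf2 b1 b2).
rewrite mulrA [h * _]mulrC mulrA -expr2 [_ * h]mulrC -mulrA; congr (_ * _).
have i2 (j : 'I_i) : L1 P (fun w => step j w * start w * f2 (start w * gsum w)).
  apply: L1M_bounded b2 => //; apply: L1M => //.
  by apply: step_moments; exact: ltn_trans (ltn_ord i).
transitivity (mean P (fun w => \sum_(j < i)
    step j w * start w * f2 (start w * gsum w))).
  by apply: eq_mean => w; rewrite displE !mulr_suml.
rewrite mean_sum// mulr_suml; apply: eq_bigr => j _.
have jN : (j < N)%N by exact: ltn_trans (ltn_ord i).
by rewrite (step_ibp jN (@known_start j) istart df2 cf3 b2 b3).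
Qed.

(** The cells are disjoint, so only the diagonal terms a_i^2 (i h) h of the isometry remain, and i h
    <= 1 - tau. *)
Lemma mean_sqr_chaos : mean P (fun w => chaos w ^+ 2) <=
  (1 - tau) * (h * \sum_(0 <= k < N) a k ^+ 2).
Proof.
pose xi (i : 'I_N) w := a i * displ i w.
have kxi (i : 'I_N) : @known R d T P B _ R (node i) (xi i).
  by apply: measurable_funM => //; exact: known_displ.
have ixi (i : 'I_N) : L2 P (xi i).
  by apply: L2Z; case: (displ_moments (ltnW (ltn_ord i))).
rewrite (@mean_sqr_family_int _ _ _ _ _ hB 'I_N (fun i => node i)
  (fun i => node i.+1) xi) //; last 3 first.
- by move=> i; exact: node_ge0.
- by move=> i; exact/ltW/node_lt.
- by move=> i; exact: node_le1.
rewrite big_mkord !mulr_sumr; apply: ler_sum => i _.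
rewrite (bigD1 i)//= [X in _ + X]big1 ?addr0; last first.
  move=> j ji; rewrite (_ : overlap _ _ _ _ = 0) ?mulr0//.
  rewrite /overlap max_l// subr_le0.
  have [ij|ij] := ltnP i j.
    apply: (@le_trans _ _ (node i.+1)); first by rewrite ge_min lexx.
    by apply: (le_trans (node_le ij)); rewrite le_max lexx orbT.
  have {}ij : (j < i)%N by rewrite ltn_neqAle ij andbT.
  apply: (@le_trans _ _ (node j.+1)); first by rewrite ge_min lexx orbT.
  by apply: (le_trans (node_le ij)); rewrite le_max lexx.
rewrite /overlap minxx maxxx nodeB max_r ?(ltW h0)//.
rewrite (_ : mean P _ = a i ^+ 2 * (i%:R * h)); last first.
  have [[_ l] m] := displ_moments (ltnW (ltn_ord i)).
  by rewrite -m -meanZ//; apply: eq_mean => w; rewrite /xi; ring.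
rewrite [leRHS](_ : _ = a i ^+ 2 * ((1 - tau) * h)); last by ring.
rewrite -mulrA ler_wpM2l ?sqr_ge0// ler_wpM2r ?(ltW h0)//.
rewrite lerBrDl (le_trans _ tauN)// lerD2l ler_wpM2r ?(ltW h0)//.
by rewrite ler_nat ltnW.
Qed.

End grid.

(** * Mean value and Taylor estimates *)

Section taylor.
Context (R : realType).
Variables (f f' : R -> R) (M : R).
Hypotheses (df : forall x : R, is_derive x 1 f (f' x)).

Lemma derivable_continuous_within (a b : R) : {within `[a, b], continuous f}.
Proof.
apply: continuous_subspaceT => x.
by apply: differentiable_continuous; exact/derivable1_diffP.
Qed.

Lemma mean_value (x y : R) : exists2 c, `|c - x| <= `|y - x| &
  f y - f x = f' c * (y - x).
Proof.
have [xy|/ltW yx] := leP x y.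
  have [c cxy E] := MVT_segment xy (fun z _ => df z) (derivable_continuous_within (a := x) (b := y)).
  exists c => //; move: cxy; rewrite in_itv/= => /andP[xc cy].
  by rewrite !ger0_norm ?subr_ge0// lerD2r.
have [c cxy E] := MVT_segment yx (fun z _ => df z) (derivable_continuous_within (a := y) (b := x)).
exists c; last by rewrite -[LHS]opprB E; ring.
move: cxy; rewrite in_itv/= => /andP[yc cx].
by rewrite !ler0_norm ?subr_le0// lerN2 lerD2r.
Qed.

Lemma lipschitz_of_bound (bf' : forall x, `|f' x| <= M) (x y : R) :
  `|f y - f x| <= M * `|y - x|.
Proof. by have [c _ ->] := mean_value x y; rewrite normrM ler_wpM2r. Qed.

End taylor.

(** The mean value theorem applied twice, to f and then to f1; this gives M where Taylor's formula
    has M / 2. *)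
Lemma taylor1 (R : realType) (f f1 f2 : R -> R) (M : R) :
  (forall x : R, is_derive x 1 f (f1 x)) ->
  (forall x : R, is_derive x 1 f1 (f2 x)) -> (forall x, `|f2 x| <= M) ->
  forall x y, `|f (x + y) - f x - y * f1 x| <= M * y ^+ 2.
Proof.
move=> df df1 b2 x y; have M0 : 0 <= M by exact: le_trans (b2 0).
have [c cx E] := mean_value df x (x + y).
move: cx E; rewrite addrAC subrr add0r => cx ->.
rewrite [f1 c * y]mulrC -mulrBr normrM -[y ^+ 2]real_normK ?num_real// expr2.
rewrite mulrCA ler_wpM2l//.
by apply: (le_trans (lipschitz_of_bound df1 b2 x c)); rewrite ler_wpM2l.
Qed.

(** * Pairs of independent standard normal variables *)

Section standard_pair.
Context (R : realType) (d : measure_display) (T : measurableType d).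
Variable P : probability T R.

Definition standard_pair (X Y : T -> R) :=
  forall A C : set R, measurable A -> measurable C ->
  P ((X @^-1` A) `&` (Y @^-1` C)) = (normal_prob 0 1 A * normal_prob 0 1 C)%E.

(** Rectangles determine the joint law, which is the product of two standard normal laws for both
    pairs. Expectations thus pass from the rescaled (B_tau, g) to (B_1, sgn(B_1) zeta). *)
Lemma standard_pair_mean (X Y X' Y' : T -> R) (g : R * R -> R) :
  measurable_fun [set: T] X -> measurable_fun [set: T] Y ->
  measurable_fun [set: T] X' -> measurable_fun [set: T] Y' ->
  standard_pair X Y -> standard_pair X' Y' ->
  measurable_fun [set: R * R] g -> L1 P (fun w => g (X w, Y w)) ->
  L1 P (fun w => g (X' w, Y' w)) /\
  mean P (fun w => g (X' w, Y' w)) = mean P (fun w => g (X w, Y w)).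
Proof.
move=> mX mY mX' mY' XY XY' mg ig.
pose D := (measurableTypeR R * measurableTypeR R)%type.
have m1 : measurable_fun [set: T] ((fun w => (X w, Y w)) : T -> D).
  exact: measurable_fun_pair.
have m2 : measurable_fun [set: T] ((fun w => (X' w, Y' w)) : T -> D).
  exact: measurable_fun_pair.
have mgD : measurable_fun [set: D] (EFin \o g) by exact/measurable_EFinP.
have lawE (A : set D) : measurable A ->
    pushforward_measure P m1 A = pushforward_measure P m2 A.
  move=> mA; transitivity ((normal_prob (0 : R) 1 \x normal_prob (0 : R) 1)%E A).
    by apply/esym/product_measure_unique => // C E mC mE; exact: XY.
  by apply: product_measure_unique => // C E mC mE; exact: XY'.
have ig' : L1 P (fun w => g (X' w, Y' w)).
  apply/integrableP; split.
    by apply/measurable_EFinP; apply: (measurableT_comp mg); exact: measurable_fun_pair.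
  have mabs : measurable_fun [set: D] (fun z => `|(g z)%:E|%E) by exact: measurableT_comp.
  case/integrableP : ig => _; congr (_ < _)%E.
  transitivity (\int[pushforward_measure P m1]_z `|(g z)%:E|)%E.
    by rewrite ge0_integral_pushforward.
  rewrite (eq_measure_integral (pushforward_measure P m2))//; last by move=> A mA _; exact: lawE.
  by rewrite ge0_integral_pushforward.
split=> //; rewrite /mean /Rintegral; congr fine.
transitivity (\int[pushforward_measure P m2]_z (EFin \o g) z)%E.
  by rewrite integral_pushforward.
rewrite (eq_measure_integral (pushforward_measure P m1)); last by move=> A mA _; exact/esym/lawE.
by rewrite integral_pushforward.
Qed.

Lemma indep_standard_pair (X Y : T -> R) (s t : R) : 0 < s -> 0 < t ->
  has_normal_law P X 0 s -> has_normal_law P Y 0 t -> indep_RV P X Y ->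
  standard_pair (fun w => s^-1 * X w) (fun w => t^-1 * Y w).
Proof.
move=> s0 t0 nX nY XY A C mA mC.
have sm (c : R) (E : set R) : measurable E -> measurable ((fun x => c * x) @^-1` E).
  move=> mE; rewrite -[X in measurable X]setTI.
  exact: (@measurable_funM _ _ _ setT (cst c) id).
rewrite -(normalized_law s0 nX mA) -(normalized_law t0 nY mC).
by apply: (XY ((fun x => s^-1 * x) @^-1` A) ((fun x => t^-1 * x) @^-1` C)); exact: sm.
Qed.

(* |X| Y = X (sgn X) Y, and (X, (sgn X) Y) has the law of (X, Y). *)
Lemma sign_standard_pair (X Y : T -> R) :
  measurable_fun [set: T] X -> measurable_fun [set: T] Y ->
  has_normal_law P X 0 1 -> has_normal_law P Y 0 1 -> indep_RV P Y X ->
  standard_pair X (fun w => if 0 <= X w then Y w else - Y w).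
Proof.
move=> mX mY nX nY YX A C mA mC.
have n1 : (-1 : R) != 0 by rewrite oppr_eq0 oner_neq0.
have mN : measurable ((fun x : R => -1 * x) @^-1` C).
  rewrite -[X in measurable X]setTI.
  exact: (@measurable_funM _ _ _ setT (cst (-1)) id).
have nNY : P (Y @^-1` ((fun x : R => -1 * x) @^-1` C)) = normal_prob 0 1 C.
  have := has_normal_lawZ n1 ltr01 nY.
  by rewrite normrN1 mulr1 => /(_ C mC).
pose D : set R := `[0, +oo[%classic.
have mD : measurable D by exact: measurable_itv.
have mX' (E : set R) : measurable E -> measurable (X @^-1` E).
  by move=> mE; rewrite -[X in measurable X]setTI; exact: mX.
have mY' (E : set R) : measurable E -> measurable (Y @^-1` E).
  by move=> mE; rewrite -[X in measurable X]setTI; exact: mY.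
have mAD : measurable (A `&` D) by exact: measurableI.
have mAND : measurable (A `\` D) by exact: measurableD.
(* The event is split by the sign of X. On X < 0 it says that - Y lies in C, which is as likely as Y
   in C by symmetry; independence then recombines the two parts of A. *)
rewrite (_ : _ `&` _ = (Y @^-1` C `&` X @^-1` (A `&` D)) `|`
    (Y @^-1` ((fun x : R => -1 * x) @^-1` C) `&` X @^-1` (A `\` D))); last first.
  apply/seteqP; split => w /=; rewrite /D /= !in_itv/= !andbT.
    move=> [Aw]; case: (boolP (0 <= X w)) => Xw Cw; [left|right].
      by split.
    by split; [rewrite mulN1r|split=> //; exact/negP].
  move=> [[Cw [Aw ->]]|[+ [Aw /negP/negbTE ->]]] => //.
  by rewrite mulN1r.
rewrite measureU; last 3 first.
- by apply: measurableI; [exact: mY'|exact: mX'].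
- by apply: measurableI; [exact: mY'|exact: mX'].
- by apply/seteqP; split => // w [[_ [_ h]] [_ [_ /(_ h)]]].
rewrite [X in (X + _)%E]YX// [X in (_ + X)%E]YX// nNY (nY _ mC) !nX//.
rewrite -ge0_muleDr// muleC; congr (_ * _)%E.
by rewrite addeC -measureDI.
Qed.

End standard_pair.

(** * Expansion on the grid *)

Section lipschitz.
Context (R : realType) (d : measure_display) (T : measurableType d).
Variable P : probability T R.
Variables (f f1 : R -> R) (M : R).
Hypotheses (df : forall x : R, is_derive x 1 f (f1 x)).
Hypothesis (b1 : forall x, `|f1 x| <= M).

Lemma is_derive_continuous : continuous f.
Proof. by move=> x; apply: differentiable_continuous; exact/derivable1_diffP. Qed.

(** [f] may be unbounded, but |f x| <= |f 0| + M |x|. *)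
Lemma L1_lipschitz (X : T -> R) : L1 P X -> L1 P (fun w => f (X w)).
Proof.
move=> iX; have M0 : 0 <= M by exact: le_trans (b1 0).
apply: (@le_L1 _ _ _ _ _ (fun w => `|f 0| + M * `|X w|)).
- apply: measurableT_comp; last exact: L1_measurable iX.
  by apply: continuous_measurable_fun; exact: is_derive_continuous.
- by apply: L1D; [exact: L1_cst|apply: L1Z; exact: L1_abs].
- move=> w; rewrite [leRHS]ger0_norm ?addr_ge0 ?mulr_ge0//.
  rewrite -lerBlDl (le_trans (lerB_dist _ _))//.
  by have := lipschitz_of_bound df b1 0 (X w); rewrite subr0.
Qed.

Lemma mean_lipschitz (X Y : T -> R) : L1 P X -> L1 P Y ->
  `|mean P (fun w => f (X w)) - mean P (fun w => f (Y w))| <=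
  M * mean P (fun w => `|X w - Y w|).
Proof.
move=> iX iY; have iXY := L1B iX iY.
rewrite -meanB; [|exact: L1_lipschitz..].
have iD : L1 P (fun w => f (X w) - f (Y w)) by apply: L1B; exact: L1_lipschitz.
rewrite (le_trans (norm_mean iD))// -meanZ; last exact: L1_abs.
apply: le_mean; [exact: L1_abs|exact/L1Z/L1_abs|].
by move=> w; exact: (lipschitz_of_bound df b1).
Qed.

End lipschitz.

Section grid_expansion.
Context (R : realType) (d : measure_display) (T : measurableType d).
Variables (P : probability T R) (B : R -> {RV P >-> R}).
Hypothesis hB : standard_brownian_motion B.
Variables (N : nat) (tau h : R) (a : nat -> R).
Hypotheses (tau0 : 0 < tau) (h0 : 0 < h) (tauN : tau + N%:R * h <= 1).
Hypotheses (a0 : forall k, (k < N)%N -> 0 < a k) (N0 : (0 < N)%N).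
Variable zs : T -> R.
Hypotheses (mzs : measurable_fun [set: T] zs) (pzs : standard_pair P (B 1) zs).
Variables (f f1 f2 f3 : R -> R) (M : R).
Hypotheses (df : forall x : R, is_derive x 1 f (f1 x))
  (df1 : forall x : R, is_derive x 1 f1 (f2 x))
  (df2 : forall x : R, is_derive x 1 f2 (f3 x)) (cf3 : continuous f3).
Hypotheses (b1 : forall x, `|f1 x| <= M) (b2 : forall x, `|f2 x| <= M)
  (b3 : forall x, `|f3 x| <= M).

Definition grid_var : R := h * \sum_(0 <= k < N) a k ^+ 2.
Local Notation v := grid_var.
Local Notation b := (start B tau).
Local Notation g := (gsum B N tau h a).
Local Notation r := (chaos B N tau h a).
Local Notation kappa := (second_coef N h a).
Let c : R := Num.sqrt tau * Num.sqrt v.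

Lemma grid_var_gt0 : 0 < v.
Proof.
rewrite mulr_gt0// big_ltn// ltr_pwDl ?exprn_gt0 ?a0//.
by rewrite sumr_ge0// => k _; exact: sqr_ge0.
Qed.

(** Dividing B_tau and g by their standard deviations gives a standard pair. [zs] stands for
    sgn(B_1) zeta, so that B_1 zs = |B_1| zeta. *)
Lemma mean_start_gsum (F : R * R -> R) : measurable_fun [set: R * R] F ->
  L1 P (fun w => F (b w, g w)) ->
  L1 P (fun w => F (Num.sqrt tau * B 1 w, Num.sqrt v * zs w)) /\
  mean P (fun w => F (Num.sqrt tau * B 1 w, Num.sqrt v * zs w)) =
  mean P (fun w => F (b w, g w)).
Proof.
move=> mF iF.
have s0 : 0 < Num.sqrt tau by rewrite sqrtr_gt0.
have t0 : 0 < Num.sqrt v by rewrite sqrtr_gt0 grid_var_gt0.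
have mb : measurable_fun [set: T] b by exact: measurable_funP.
have mg : measurable_fun [set: T] g by exact: measurable_gsum.
have tau1 := tau_le1 h0 tauN.
have nb : has_normal_law P b 0 (Num.sqrt tau) by exact: path_law.
have ng : has_normal_law P g 0 (Num.sqrt v) by exact: (tail_law hB tau0 h0 tauN a0).
have bg : indep_RV P b g.
  move=> A C mA mC; rewrite setIC muleC.
  by apply: (tail_indep hB a tau0 h0 tauN (leq0n N)) => //; exact: known_start.
have pUV := indep_standard_pair s0 t0 nb ng bg.
pose G (z : R * R) := F (Num.sqrt tau * z.1, Num.sqrt v * z.2).
have mG : measurable_fun [set: R * R] G.
  apply: (measurableT_comp mF).
  by apply: measurable_fun_pair; exact: measurable_funM.
have GE w : G ((Num.sqrt tau)^-1 * b w, (Num.sqrt v)^-1 * g w) = F (b w, g w).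
  by rewrite /G/= !mulVKf ?gt_eqF.
have iG : L1 P (fun w => G ((Num.sqrt tau)^-1 * b w, (Num.sqrt v)^-1 * g w)).
  by under eq_fun do rewrite GE.
have mU : measurable_fun [set: T] (fun w => (Num.sqrt tau)^-1 * b w).
  exact: measurable_funM.
have mV : measurable_fun [set: T] (fun w => (Num.sqrt v)^-1 * g w).
  exact: measurable_funM.
have [l e] := standard_pair_mean mU mV (measurable_funP (B 1)) mzs pUV pzs mG iG.
split; first exact: l.
by rewrite -[LHS]/(mean P (fun w => G (B 1 w, zs w))) e; apply: eq_mean => w; rewrite GE.
Qed.

(** The factor tau next to kappa appears because B_tau^2 has the law of tau B_1^2; the error is the
    Taylor remainder M E r^2. *)
Lemma grid_expansion :
  `|mean P (fun w => f (b w * g w + r w)) -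
    mean P (fun w => f (c * (B 1 w * zs w))) -
    kappa * tau * mean P (fun w => B 1 w ^+ 2 * f3 (c * (B 1 w * zs w)))| <=
  M * ((1 - tau) * v).
Proof.
have M0 : 0 <= M by exact: le_trans (b1 0).
have cf1 : continuous f1 := is_derive_continuous df1.
have [ib _] := start_moments hB tau0 h0 tauN.
have ig : L2 P g := L2_gsum hB a tau0 h0 tauN.
have ir : L2 P r := L2_chaos hB a tau0 h0 tauN.
have ibg : L1 P (fun w => b w * g w) by exact: L1M.
have ibgr : L1 P (fun w => b w * g w + r w) by apply: L1D => //; exact: L2_L1.
have if1 : L1 P (fun w => f (b w * g w)) by exact: (L1_lipschitz df b1).
have if2 : L1 P (fun w => f (b w * g w + r w)) by exact: (L1_lipschitz df b1).
have irf : L1 P (fun w => r w * f1 (b w * g w)).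
  by apply: L1M_bounded b1 => //; exact: L2_L1.
have [ir1 ir2] := ir.
pose F1 (z : R * R) := f (z.1 * z.2).
pose F2 (z : R * R) := z.1 ^+ 2 * f3 (z.1 * z.2).
have mm : measurable_fun [set: R * R] (fun z : R * R => z.1 * z.2) by exact: measurable_funM.
have mF1 : measurable_fun [set: R * R] F1.
  apply: measurableT_comp mm.
  by apply: continuous_measurable_fun; exact: (is_derive_continuous df).
have mF2 : measurable_fun [set: R * R] F2.
  apply: measurable_funM; first exact: measurable_funX.
  by apply: measurableT_comp mm; exact: continuous_measurable_fun.
have iF2 : L1 P (fun w => b w ^+ 2 * f3 (b w * g w)).
  by apply: L1M_bounded b3 => //; case: ib.
have [_ e1] := mean_start_gsum mF1 if1.
have [iF2' e2] := mean_start_gsum mF2 iF2.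
have st2 : Num.sqrt tau ^+ 2 = tau by rewrite sqr_sqrtr// ltW.
have E1 : mean P (fun w => f (c * (B 1 w * zs w))) = mean P (fun w => f (b w * g w)).
  by rewrite -e1; apply: eq_mean => w; rewrite /F1/= /c mulrACA.
have E2 : mean P (fun w => b w ^+ 2 * f3 (b w * g w)) =
    tau * mean P (fun w => B 1 w ^+ 2 * f3 (c * (B 1 w * zs w))).
  rewrite -e2; have FE w : F2 (Num.sqrt tau * B 1 w, Num.sqrt v * zs w) =
      tau * (B 1 w ^+ 2 * f3 (c * (B 1 w * zs w))).
    by rewrite /F2/= exprMn st2 -mulrA; congr (_ * (_ * f3 _)); rewrite /c; ring.
  rewrite (eq_mean _ FE) meanZ//.
  rewrite (_ : (fun w => _) =
      fun w => tau^-1 * F2 (Num.sqrt tau * B 1 w, Num.sqrt v * zs w)); first exact: L1Z.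
  by apply/funext => w; rewrite FE mulKf ?gt_eqF.
rewrite E1 -mulrA -E2 -(mean_chaos hB a tau0 h0 tauN df1 df2 cf3 b1 b2 b3).
rewrite -meanB// -meanB//; last exact: L1B.
have iD : L1 P (fun w => f (b w * g w + r w) - f (b w * g w) - r w * f1 (b w * g w)).
  by apply: L1B => //; exact: L1B.
apply: (le_trans (norm_mean iD)).
apply: (@le_trans _ _ (mean P (fun w => M * r w ^+ 2))).
  apply: le_mean; [exact: L1_abs|exact: L1Z|].
  by move=> w; exact: (taylor1 df df1 b2).
rewrite meanZ// ler_wpM2l//.
exact: (mean_sqr_chaos hB).
Qed.

End grid_expansion.

(** * Distance from the stochastic integral to the grid *)

Lemma ler_subX (R : realDomainType) (s r : R) n : 0 <= s -> s <= r -> r <= 1 ->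
  0 <= r ^+ n - s ^+ n <= n%:R * (r - s).
Proof.
move=> s0 sr r1; have r0 := le_trans s0 sr.
elim: n => [|n /andP[IH0 IH]]; first by rewrite !expr0 subrr mul0r lexx.
have -> : r ^+ n.+1 - s ^+ n.+1 = r * (r ^+ n - s ^+ n) + (r - s) * s ^+ n.
  by rewrite !exprS; ring.
have sn0 : 0 <= s ^+ n by exact: exprn_ge0.
have sn1 : s ^+ n <= 1 by rewrite exprn_ile1// (le_trans sr).
have rs : 0 <= r - s by rewrite subr_ge0.
apply/andP; split; first by rewrite addr_ge0// mulr_ge0.
rewrite -natr1 [leRHS]mulrDl mul1r lerD//; last by rewrite ler_piMr.
by apply: le_trans IH; rewrite ler_piMl.
Qed.

Section grid_approx.
Context (R : realType) (d : measure_display) (T : measurableType d).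
Variables (P : probability T R) (B : R -> {RV P >-> R}).
Hypothesis hB : standard_brownian_motion B.
Variables (n N : nat) (tau h : R).
Hypotheses (n0 : (0 < n)%N) (tau0 : 0 < tau) (h0 : 0 < h)
  (tauN : tau + N%:R * h = 1).
Local Notation nd := (node tau h).
Let u (t : R) (w : T) : R := Num.sqrt n%:R * t ^+ n * B t w.
Let a k : R := Num.sqrt n%:R * nd k ^+ n.
Let eta (i : 'I_N) (w : T) : R := a i * B (nd i) w.
(** The first term bounds E u_r^2 for r <= tau, where the step process vanishes. Within a cell,
    moving r^n to the node costs n^2 h^2 and moving B_r costs h; the factor 2 n comes from (x + y)^2
    <= 2 x^2 + 2 y^2 and from the sqrt n in [u]. *)
Let e : R := n%:R * tau ^+ (2 * n) + 2 * n%:R * (n%:R ^+ 2 * h ^+ 2 + h).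

Let tauN' : tau + N%:R * h <= 1. Proof. by rewrite tauN. Qed.

Let node_gt0 i : 0 < nd i.
Proof. by rewrite ltr_pwDl// mulr_ge0// ltW. Qed.

Let sqn : Num.sqrt n%:R ^+ 2 = n%:R :> R.
Proof. by rewrite sqr_sqrtr. Qed.

Let L2_u r : 0 <= r <= 1 -> L2 P (u r).
Proof.
move=> /andP[]; rewrite le_eqVlt => /predU1P[<- _|r0 r1]; last first.
  by apply: L2Z; case: (path_moments hB r0 r1).
rewrite (_ : u 0 = fun=> 0); first exact: L2_cst.
by apply/funext => w; rewrite /u expr0n gtn_eqF// mulr0 mul0r.
Qed.

Lemma mean_sqr_u r : 0 <= r <= 1 ->
  mean P (fun w => u r w ^+ 2) = n%:R * r ^+ (2 * n) * r.
Proof.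
move=> /andP[]; rewrite le_eqVlt => /predU1P[<- _|r0 r1].
  rewrite mulr0 -[RHS](mean_cst P); apply: eq_mean => w.
  by rewrite /u expr0n gtn_eqF// mulr0 mul0r expr0n.
have [[_ l] m] := path_moments hB r0 r1.
rewrite -[X in _ * X]m -meanZ//; apply: eq_mean => w.
by rewrite /u !exprMn sqn mulnC exprM.
Qed.

Lemma family_val_before r w : r <= tau ->
  family_val (fun i : 'I_N => nd i) (fun i : 'I_N => nd i.+1) eta r w = 0.
Proof.
move=> rt; apply: big1 => i _; rewrite /itv_indic indicE memNset ?mulr0//=.
by rewrite in_itv/= ltNge (le_trans rt)// tau_le_node.
Qed.

Lemma family_val_in r w j : (j < N)%N -> nd j < r -> r <= nd j.+1 ->
  family_val (fun i : 'I_N => nd i) (fun i : 'I_N => nd i.+1) eta r w =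
  a j * B (nd j) w.
Proof.
move=> jN jr rj; rewrite /family_val (bigD1 (Ordinal jN))//= [X in _ + X]big1.
  by rewrite /itv_indic indicE mem_set ?mulr1 ?addr0//= in_itv/= jr.
move=> i ij; rewrite /itv_indic indicE memNset ?mulr0//= in_itv/= => /andP[h1 h2].
have {}ij : (i != j :> nat) by apply: contra ij => /eqP ij; apply/eqP/val_inj.
have [h3|h3] := ltnP i j.
  by move: (lt_le_trans jr (le_trans h2 (node_le tau h0 h3))); rewrite ltxx.
have {}h3 : (j < i)%N by rewrite ltn_neqAle eq_sym ij.
by move: (lt_le_trans h1 (le_trans rj (node_le tau h0 h3))); rewrite ltxx.
Qed.

Lemma node_cell r : tau < r -> r <= 1 ->
  exists2 j, (j < N)%N & nd j < r /\ r <= nd j.+1.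
Proof.
move=> tr r1; have ex : exists i, r <= nd i by exists N; rewrite /node tauN.
case: (ex_minnP ex) => -[|j]; first by rewrite /node mul0r addr0 leNgt tr.
move=> rj jmin; exists j.
  by apply: (jmin N); rewrite /node tauN.
split=> //; rewrite ltNge; apply/negP => /jmin; by rewrite ltnn.
Qed.

Lemma grid_approx_pointwise r : 0 <= r <= 1 ->
  mean P (fun w => (family_val (fun i : 'I_N => nd i) (fun i : 'I_N => nd i.+1)
    eta r w - u r w) ^+ 2) <= e.
Proof.
move=> /[dup] r01 /andP[r0 r1].
have n00 : 0 <= n%:R :> R by [].
have [rt|tr] := leP r tau.
  under eq_mean do rewrite family_val_before// sub0r sqrrN.
  rewrite mean_sqr_u// /e -[leLHS]addr0 lerD//.
    rewrite -mulrA ler_wpM2l// -[leRHS]mulr1 ler_pM ?exprn_ge0//.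
    by rewrite lerXn2r ?nnegrE// ltW.
  by rewrite mulr_ge0 ?mulr_ge0// addr_ge0 ?mulr_ge0 ?sqr_ge0// ltW.
have [j jN [jr rj]] := node_cell tr r1.
set s := nd j in jr rj.
have s0 : 0 < s by exact: node_gt0.
have s1 : s <= 1 by rewrite (le_trans (ltW jr)).
have rsh : r - s <= h by have := nodeB tau h j; rewrite -/s; move: rj; lra.
have [ls ms] := path_moments hB s0 s1.
have [li _ mi] := incr_moments hB (ltW s0) (ltW jr) r1.
(* s^n B_s - r^n B_r = (s^n - r^n) B_s - r^n (B_r - B_s) separates the error of the weight from that
   of the path. *)
have E w : (family_val (fun i : 'I_N => nd i) (fun i : 'I_N => nd i.+1)
    eta r w - u r w) ^+ 2 =
    n%:R * ((s ^+ n - r ^+ n) * B s w + (- r ^+ n) * incr B s r w) ^+ 2.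
  by rewrite (family_val_in w jN jr rj) -sqn -exprMn /u /a -/s /incr; congr (_ ^+ 2); ring.
rewrite (eq_mean _ E) meanZ; last first.
  by case: (L2D (L2Z (s ^+ n - r ^+ n) ls) (L2Z (- r ^+ n) li)).
rewrite /e -[leLHS]add0r lerD//; first by rewrite mulr_ge0 ?exprn_ge0// ltW.
rewrite [2 * _]mulrC -mulrA ler_wpM2l//.
apply: (le_trans (mean_sqrD_le (L2Z (s ^+ n - r ^+ n) ls) (L2Z (- r ^+ n) li))).
rewrite -mulrDr ler_wpM2l//.
have -> : mean P (fun w => ((s ^+ n - r ^+ n) * B s w) ^+ 2) =
    (r ^+ n - s ^+ n) ^+ 2 * s.
  rewrite -[X in _ * X]ms -meanZ; last by case: ls.
  by apply: eq_mean => w; ring.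
have -> : mean P (fun w => (- r ^+ n * incr B s r w) ^+ 2) = (r ^+ n) ^+ 2 * (r - s).
  rewrite -mi -meanZ; last by case: li.
  by apply: eq_mean => w; ring.
have /andP[D0 D1] := ler_subX n (ltW s0) (ltW jr) r1.
have rs0 : 0 <= r - s by rewrite subr_ge0 ltW.
apply: lerD.
  rewrite -[leRHS]mulr1 ler_pM ?sqr_ge0 ?(ltW s0)//.
  rewrite -exprMn lerXn2r ?nnegrE ?mulr_ge0 ?(ltW h0)//.
  by rewrite (le_trans D1)// ler_wpM2l.
rewrite -[leRHS]mul1r ler_pM ?sqr_ge0//.
by rewrite !exprn_ile1 ?exprn_ge0.
Qed.

Lemma grid_approx (Z : T -> R) : measurable_fun [set: T] Z ->
  is_ito_integral B u Z ->
  let S w := start B tau w * gsum B N tau h a w + chaos B N tau h a w in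
  [/\ L2 P Z, L2 P S & mean P (fun w => (Z w - S w) ^+ 2) <= 4 * e].
Proof.
move=> mZ hZ S.
have keta (i : 'I_N) : @known R d T P B _ R (nd i) (eta i).
  by apply: measurable_funM => //; apply: known_path => //; exact: node_ge0.
have ieta (i : 'I_N) : L2 P (eta i).
  apply: L2Z; case: (path_moments hB (node_gt0 i)) => //.
  by apply: (node_le1 h0 tauN'); exact: ltnW.
have [lZ mean_le] := ito_integral_approx hB hZ mZ L2_u
  (fun i : 'I_N => node_ge0 tau0 h0 i) (fun i => ltW (node_lt tau h0 i))
  (fun i => node_le1 h0 tauN' (ltn_ord i)) keta ieta grid_approx_pointwise.
have SE : S = family_int B (fun i : 'I_N => nd i) (fun i => nd i.+1) eta.
  by apply/funext => w; rewrite /S -chaosE.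
split=> //; last by rewrite SE.
rewrite SE; apply: (L2_family_int hB) => // i.
- exact: node_ge0.
- exact/ltW/node_lt.
- exact: (node_le1 h0 tauN').
Qed.

End grid_approx.

(** * Riemann sums *)

(** The lower and upper rectangles for the integral of (k + 1) x^k over [s, r]. *)
Lemma subXS_bounds (R : realDomainType) (s r : R) k : 0 <= s -> s <= r ->
  k.+1%:R * s ^+ k * (r - s) <= r ^+ k.+1 - s ^+ k.+1 <=
  k.+1%:R * r ^+ k * (r - s).
Proof.
move=> s0 sr; have r0 := le_trans s0 sr.
have rs : 0 <= r - s by rewrite subr_ge0.
elim: k => [|k /andP[IH1 IH2]]; first by rewrite !expr0 !expr1 !mulr1 !mul1r lexx.
have sk : 0 <= s ^+ k by exact: exprn_ge0.
have sk1 : s ^+ k.+1 <= r ^+ k.+1 by rewrite lerXn2r ?nnegrE.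
have -> : r ^+ k.+2 - s ^+ k.+2 = r * (r ^+ k.+1 - s ^+ k.+1) + (r - s) * s ^+ k.+1.
  by rewrite [r ^+ k.+2]exprS [s ^+ k.+2]exprS; ring.
rewrite -[k.+2%:R]natr1; apply/andP; split.
  apply: (@le_trans _ _ (r * (k.+1%:R * s ^+ k * (r - s)) + (r - s) * s ^+ k.+1)).
    have -> : (k.+1%:R + 1) * s ^+ k.+1 * (r - s) =
        s * (k.+1%:R * s ^+ k * (r - s)) + (r - s) * s ^+ k.+1.
      by rewrite exprS; ring.
    by rewrite lerD2r ler_wpM2r// !mulr_ge0.
  by rewrite lerD2r ler_wpM2l.
have -> : (k.+1%:R + 1) * r ^+ k.+1 * (r - s) =
    r * (k.+1%:R * r ^+ k * (r - s)) + (r - s) * r ^+ k.+1.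
  by rewrite exprS; ring.
by rewrite lerD// ler_wpM2l.
Qed.

Section riemann_sums.
Context (R : realType).
Variables (N : nat) (tau h : R).
Hypotheses (tau0 : 0 < tau) (h0 : 0 < h) (tauN : tau + N%:R * h = 1).
Local Notation nd := (node tau h).

Definition riemann k i : R := \sum_(j < i) h * nd j ^+ k.

Lemma riemann_bounds k i :
  (nd i ^+ k.+1 - tau ^+ k.+1) / k.+1%:R - h * (nd i ^+ k - tau ^+ k) <=
  riemann k i <= (nd i ^+ k.+1 - tau ^+ k.+1) / k.+1%:R.
Proof.
have kp : 0 < k.+1%:R :> R by [].
elim: i => [|i /andP[IH1 IH2]].
  by rewrite /riemann big_ord0 /node mul0r addr0 !subrr mul0r mulr0 subr0 lexx.
rewrite /riemann big_ord_recr/= -/(riemann k i).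
have /andP[L U] := subXS_bounds k (node_ge0 tau0 h0 i) (ltW (node_lt tau h0 i)).
rewrite nodeB in L U.
have L' : h * nd i ^+ k <= (nd i.+1 ^+ k.+1 - nd i ^+ k.+1) / k.+1%:R.
  by rewrite ler_pdivlMr//; move: L; lra.
have U' : (nd i.+1 ^+ k.+1 - nd i ^+ k.+1) / k.+1%:R <= h * nd i.+1 ^+ k.
  by rewrite ler_pdivrMr//; move: U; lra.
have -> : (nd i.+1 ^+ k.+1 - tau ^+ k.+1) / k.+1%:R =
    (nd i.+1 ^+ k.+1 - nd i ^+ k.+1) / k.+1%:R + (nd i ^+ k.+1 - tau ^+ k.+1) / k.+1%:R.
  by rewrite -mulrDl; congr (_ / _); ring.
move: L' U' IH1 IH2.
move: (_ / k.+1%:R) (_ / k.+1%:R) (riemann k i) => Y X rho L' U' IH1 IH2.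
have E (p q : R) : h * (p - q) = h * p - h * q by ring.
by rewrite E; rewrite E in IH1; apply/andP; split; lra.
Qed.

Lemma node_end : nd N = 1.
Proof. exact: tauN. Qed.

Lemma tau_lt1 : (0 < N)%N -> tau < 1.
Proof. by move=> N0; rewrite -tauN ltrDl mulr_gt0 ?ltr0n. Qed.

Lemma riemann_le k i : (i <= N)%N ->
  (nd i ^+ k.+1 - tau ^+ k.+1) / k.+1%:R - h <= riemann k i.
Proof.
move=> iN; have /andP[L _] := riemann_bounds k i; apply: le_trans L.
rewrite lerD2l lerN2 ler_piMr ?(ltW h0)//.
have tauN' : tau + N%:R * h <= 1 by rewrite tauN.
have : nd i ^+ k <= 1 by rewrite exprn_ile1 ?node_ge0// (node_le1 h0 tauN').
have : 0 <= tau ^+ k by rewrite exprn_ge0// ltW.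
by lra.
Qed.

Variable n : nat.
Hypotheses (n0 : (0 < n)%N) (N0 : (0 < N)%N).
Let a k : R := Num.sqrt n%:R * nd k ^+ n.

Let sqn : Num.sqrt n%:R ^+ 2 = n%:R :> R.
Proof. by rewrite sqr_sqrtr. Qed.

Let n1 : 1 <= n%:R :> R. Proof. by rewrite ler1n. Qed.

Lemma grid_varE : grid_var N h a = n%:R * riemann (2 * n) N.
Proof.
rewrite /grid_var big_mkord !mulr_sumr; apply: eq_bigr => i _.
by rewrite /a exprMn sqn mulnC exprM; ring.
Qed.

(** The variance is n times a Riemann sum of x^(2n), whose integral over [0, 1] gives n / (2n + 1),
    below 1/2 by less than 1/n. The other terms pay for the cut at tau and for the mesh. *)
Lemma grid_var_bounds :
  0 <= 2^-1 - grid_var N h a <= n%:R^-1 + tau ^+ n + 2 * n%:R * h.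
Proof.
have n00 : 0 < n%:R :> R by exact: lt_le_trans n1.
have t1 : tau <= 1 by exact/ltW/tau_lt1.
have /andP[_ U] := riemann_bounds (2 * n) N.
have L := riemann_le (2 * n) (leqnn N).
rewrite node_end expr1n in U L; rewrite grid_varE.
set rho := riemann _ _ in U L *; set t := tau ^+ (2 * n).+1 in U L.
have t0 : 0 <= t by rewrite exprn_ge0// ltW.
have tn : t <= tau ^+ n.
  by rewrite /t ler_wiXn2l ?(ltW tau0)// mul2n -addnn ltnW// ltnS leq_addr.
have k0 : 0 < (2 * n).+1%:R :> R by [].
have kE : (2 * n).+1%:R = 2 * n%:R + 1 :> R by rewrite -natr1 natrM.
have U' : rho * (2 * n%:R + 1) <= 1 - t by rewrite -kE -ler_pdivlMr.
have L' : 1 - t <= (rho + h) * (2 * n%:R + 1).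
  by rewrite -kE -ler_pdivrMr// -lerBlDr.
have r0 : 0 <= rho.
  by apply: sumr_ge0 => j _; rewrite mulr_ge0 ?(ltW h0)// exprn_ge0// node_ge0.
have nV : n%:R^-1 * n%:R = 1 :> R by rewrite mulVf// gt_eqF.
have nV0 : 0 < n%:R^-1 :> R by rewrite invr_gt0.
apply/andP; split; first by nra.
have tn0 : 0 <= tau ^+ n by rewrite exprn_ge0// ltW.
have nr : n%:R * rho <= 2^-1 by nra.
have rx : rho <= 2^-1 * n%:R^-1.
  by have := ler_wpM2l (ltW nV0) nr; rewrite mulrA nV mul1r [leRHS]mulrC.
have hn : h <= n%:R * h by rewrite ler_peMl// ltW.
have E : (rho + h) * (2 * n%:R + 1) = 2 * (n%:R * rho) + 2 * (n%:R * h) + rho + h by ring.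
rewrite E in L'; rewrite -mulrA.
by move: (n%:R^-1) (n%:R * h) (n%:R * rho) nV0 nr rx hn L' => x y z; lra.
Qed.

Local Notation kappa := (second_coef N h a).

Lemma second_coefE : kappa =
  n%:R * Num.sqrt n%:R * \sum_(i < N) (h * nd i ^+ (2 * n)) * riemann n i.
Proof.
rewrite /second_coef mulr_sumr; apply: eq_bigr => i _.
rewrite /riemann /a exprMn sqn mulnC exprM.
rewrite (eq_bigr (fun j : 'I_i => Num.sqrt n%:R * (h * nd j ^+ n))); last first.
  by move=> j _; ring.
by rewrite -mulr_sumr; ring.
Qed.

(** The inner sum is close to t_i^(n+1) / (n + 1), which leaves a Riemann sum of x^(3n+1). The limit
    is thus that of n^2 / ((n + 1) (3n + 2)), a quantity below 1/3. *)
Lemma second_coef_bounds :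
  0 <= Num.sqrt n%:R * kappa <= 3^-1 /\
  3^-1 - Num.sqrt n%:R * kappa <= n%:R^-1 + 5 * n%:R ^+ 2 * (tau ^+ n + h).
Proof.
have n00 : 0 < n%:R :> R by exact: lt_le_trans n1.
have t1 : tau <= 1 by exact/ltW/tau_lt1.
have tn0 : 0 <= tau ^+ n by rewrite exprn_ge0// ltW.
have tauN' : tau + N%:R * h <= 1 by rewrite tauN.
have rie0 k i : 0 <= riemann k i.
  by apply: sumr_ge0 => j _; rewrite mulr_ge0 ?(ltW h0)// exprn_ge0// node_ge0.
set S := \sum_(i < N) (h * nd i ^+ (2 * n)) * riemann n i.
have KE : Num.sqrt n%:R * kappa = n%:R ^+ 2 * S.
  rewrite second_coefE -/S.
  rewrite (_ : _ * _ = Num.sqrt n%:R ^+ 2 * n%:R * S); last by ring.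
  by rewrite sqn; ring.
have S0 : 0 <= S.
  by apply: sumr_ge0 => j _; rewrite mulr_ge0// mulr_ge0 ?(ltW h0)// exprn_ge0// node_ge0.
have p1 : 0 < n.+1%:R :> R by [].
have p3 : 0 < (2 * n + n.+1).+1%:R :> R by [].
have E3 : (2 * n + n.+1).+1%:R = 3 * n%:R + 2 :> R.
  by rewrite -natr1 natrD natrM -[n.+1%:R]natr1; ring.
have E1 : n.+1%:R = n%:R + 1 :> R by rewrite natr1.
pose Q := riemann (2 * n + n.+1) N.
have QE : Q = \sum_(i < N) (h * nd i ^+ (2 * n)) * nd i ^+ n.+1.
  by apply: eq_bigr => i _; rewrite exprD mulrA.
have /andP[_ QU] := riemann_bounds (2 * n + n.+1) N.
have QL := riemann_le (2 * n + n.+1) (leqnn N).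
rewrite node_end expr1n -/Q in QU QL.
set t3 := tau ^+ (2 * n + n.+1).+1 in QU QL.
have t30 : 0 <= t3 by rewrite exprn_ge0// ltW.
have t3n : t3 <= tau ^+ n.
  rewrite /t3 ler_wiXn2l ?(ltW tau0)//.
  by rewrite (leq_trans _ (leqnSn _))// (leq_trans (leqnSn n))// leq_addl.
pose W := riemann (2 * n) N.
have W1 : W <= 1.
  have /andP[_ U] := riemann_bounds (2 * n) N; apply: le_trans U _.
  rewrite node_end expr1n ler_pdivrMr// mul1r.
  apply: (@le_trans _ _ 1); last by rewrite ler1n.
  by rewrite gerBl exprn_ge0// ltW.
have W0 : 0 <= W := rie0 _ _.
have SU : S * n.+1%:R <= Q.
  rewrite QE mulr_suml; apply: ler_sum => i _.
  rewrite -mulrA ler_wpM2l//; first by rewrite mulr_ge0 ?(ltW h0)// exprn_ge0// node_ge0.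
  have /andP[_ U] := riemann_bounds n i.
  rewrite -ler_pdivlMr// (le_trans U)// ler_wpM2r ?invr_ge0//.
  by rewrite gerBl exprn_ge0// ltW.
have SL : Q - S * n.+1%:R <= (tau ^+ n + n.+1%:R * h) * W.
  rewrite QE mulr_suml -sumrB /W /riemann mulr_sumr; apply: ler_sum => i _.
  have L := riemann_le n (ltnW (ltn_ord i)).
  have L' : nd i ^+ n.+1 - riemann n i * n.+1%:R <= tau ^+ n + n.+1%:R * h.
    move: L; rewrite lerBlDr ler_pdivrMr//.
    have : tau ^+ n.+1 <= tau ^+ n by rewrite exprSr ler_piMr.
    by move: (tau ^+ n.+1) (tau ^+ n) (nd i ^+ n.+1) => x y z; lra.
  rewrite -[X in _ - X]mulrA -mulrBr [leRHS]mulrC ler_wpM2l//.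
  by rewrite mulr_ge0 ?(ltW h0)// exprn_ge0// node_ge0.
rewrite KE.
have QU' : Q * (3 * n%:R + 2) <= 1 - t3 by rewrite -E3 -ler_pdivlMr.
have QL' : 1 - t3 <= (Q + h) * (3 * n%:R + 2).
  by rewrite -E3 -ler_pdivrMr// -lerBlDr.
have Q0 : 0 <= Q := rie0 _ _.
rewrite E1 in SU SL.
have nV : n%:R^-1 * n%:R = 1 :> R by rewrite mulVf// gt_eqF.
have nV0 : 0 < n%:R^-1 :> R by rewrite invr_gt0.
move: (n%:R : R) (n%:R^-1 : R) (tau ^+ n) n00 n1 nV nV0 SU SL QU' QL' tn0 t3n => x y t.
move=> {KE E3 E1 QU QL QE} x0 x1 yx y0 SU SL QU' QL' tn0 t3n.
have SQ : S * (x + 1) * (3 * x + 2) <= 1.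
  apply: le_trans (_ : Q * (3 * x + 2) <= _); first by rewrite ler_wpM2r//; lra.
  by lra.
have xS : 3 * (x ^+ 2 * S) <= 1.
  apply: le_trans SQ; have : 0 <= x * S by rewrite mulr_ge0// ltW.
  by move: S0; nra.
have xS0 : 0 <= x ^+ 2 * S by rewrite mulr_ge0// exprn_ge0// ltW.
split; first by apply/andP; split=> //; lra.
have Q1 : Q <= S * (x + 1) + (t + (x + 1) * h).
  have : (t + (x + 1) * h) * W <= t + (x + 1) * h.
    by rewrite ler_piMr// addr_ge0// mulr_ge0 ?(ltW h0)//; lra.
  by move: SL; lra.
have Q2 : 1 - t <= (S * (x + 1) + (t + (x + 1) * h) + h) * (3 * x + 2).
  apply: le_trans (_ : 1 - t3 <= _); first by lra.
  apply: (le_trans QL'); rewrite ler_wpM2r//; lra.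
have xSx : 3 * (x * S) <= y.
  have -> : 3 * (x * S) = y * x * (3 * (x * S)) by rewrite yx mul1r.
  rewrite (_ : y * x * (3 * (x * S)) = y * (3 * (x ^+ 2 * S))); last by ring.
  by rewrite ler_piMr// ltW.
have SxS : S <= x * S by rewrite ler_peMl.
have xt : x * t <= x ^+ 2 * t by rewrite ler_wpM2r// expr2 ler_peMl// ltW.
have tt : t <= x * t by rewrite ler_peMl.
have hh : h <= x * h by rewrite ler_peMl// ltW.
have xh : x * h <= x ^+ 2 * h by rewrite ler_wpM2r ?(ltW h0)// expr2 ler_peMl// ltW.
have E : (S * (x + 1) + (t + (x + 1) * h) + h) * (3 * x + 2) =
  3 * (x ^+ 2 * S) + 5 * (x * S) + 2 * S + 3 * (x * t) + 2 * t +
  3 * (x ^+ 2 * h) + 8 * (x * h) + 4 * h by ring.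
rewrite E in Q2.
(* After division by 3 the coefficients are 7/9 for 1/n, 6/3 for n^2 tau^n and 15/3 for n^2 h,
   whence the common factor 5. *)
rewrite (_ : 5 * x ^+ 2 * (t + h) = 5 * (x ^+ 2 * t) + 5 * (x ^+ 2 * h)); last by ring.
move: (x ^+ 2 * S) (x * S) (x * t) (x ^+ 2 * t) (x * h) (x ^+ 2 * h) xSx SxS xt tt hh xh Q2 xS => *.
lra.
Qed.

End riemann_sums.

(** * The estimate for a fixed n *)

Lemma C3b_derivatives (R : realType) (f : R -> R) : C3b f -> exists M : R,
  [/\ forall x : R, is_derive x 1 f (f^`(1)%classic x),
      forall x : R, is_derive x 1 f^`(1)%classic (f^`(2)%classic x),
      forall x : R, is_derive x 1 f^`(2)%classic (f^`(3)%classic x)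
    & continuous f^`(3)%classic] /\
  [/\ forall x, `|f^`(1)%classic x| <= M, forall x, `|f^`(2)%classic x| <= M
    & forall x, `|f^`(3)%classic x| <= M].
Proof.
move=> [df cf bf].
have der k : (k < 3)%N -> forall x : R,
    is_derive x 1 f^`(k)%classic (f^`(k.+1)%classic x).
  by move=> k3 x; rewrite derive1nS derive1E; apply/derivableP; exact: df.
have [M1 b1] := bf 1%N isT; have [M2 b2] := bf 2%N isT; have [M3 b3] := bf 3%N isT.
exists (Num.max M1 (Num.max M2 M3)); split; split.
- exact: (der 0%N).
- exact: (der 1%N).
- exact: (der 2%N).
- exact: cf.
- by move=> x; rewrite le_max b1.
- by move=> x; rewrite !le_max b2 orbT.
- by move=> x; rewrite !le_max b3 !orbT.
Qed.

Section dominated.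
Context (R : realType) (d : measure_display) (T : measurableType d).
Variable P : probability T R.

(** Dominated convergence with majorant M |X|. It is applied to f''', for which mere continuity
    yields no rate. *)
Lemma cvg_mean_bounded (X Y : T -> R) (g : R -> R) (M l : R) (c : nat -> R) :
  L1 P X -> measurable_fun [set: T] Y -> continuous g ->
  (forall x, `|g x| <= M) -> c n @[n --> \oo] --> l ->
  mean P (fun w => X w * g (c n * Y w)) @[n --> \oo] -->
  mean P (fun w => X w * g (l * Y w)).
Proof.
move=> iX mY cg gM cl.
have mg : measurable_fun [set: R] g by exact: continuous_measurable_fun.
have mX := L1_measurable iX.
have mm k : measurable_fun [set: T] (fun w => X w * g (k * Y w)).
  apply: measurable_funM => //; apply: (measurableT_comp mg); exact: measurable_funM.
have ii k : L1 P (fun w => X w * g (k * Y w)).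
  apply: (L1_bounded _ (fun w => gM _) iX); apply: (measurableT_comp mg).
  exact: measurable_funM.
have M0 : 0 <= M by exact: le_trans (gM 0).
have [] := @dominated_convergence _ T R P setT measurableT
  (fun n w => (X w * g (c n * Y w))%:E) (fun w => (X w * g (l * Y w))%:E)
  (fun w => (M * `|X w|)%:E).
- by move=> n; exact/measurable_EFinP.
- exact/measurable_EFinP.
- apply: aeW => w _; apply/cvg_EFin; first by near=> n.
  apply: cvgMr; apply: (@cvg_comp _ _ _ (fun n => c n * Y w) g _ (nbhs (l * Y w))).
    exact: cvgMl.
  exact: cg.
- exact/L1Z/L1_abs.
- apply: aeW => w n _; rewrite lee_fin normrM mulrC ler_wpM2r//.
move=> _ _; rewrite EFin_mean// => /fine_cvgP[_ h].
exact: h.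
Unshelve. all: by end_near. Qed.

End dominated.

Section level_n.
Context (R : realType) (d : measure_display) (T : measurableType d).
Variables (P : probability T R) (B : R -> {RV P >-> R}).
Hypothesis hB : standard_brownian_motion B.
Variable zs : T -> R.
Hypotheses (mzs : measurable_fun [set: T] zs) (pzs : standard_pair P (B 1) zs)
  (izs : L2 P zs) (zs2 : mean P (fun w => zs w ^+ 2) = 1).
Variables (f f1 f2 f3 : R -> R) (M : R).
Hypotheses (df : forall x : R, is_derive x 1 f (f1 x))
  (df1 : forall x : R, is_derive x 1 f1 (f2 x))
  (df2 : forall x : R, is_derive x 1 f2 (f3 x)) (cf3 : continuous f3).
Hypotheses (b1 : forall x, `|f1 x| <= M) (b2 : forall x, `|f2 x| <= M)
  (b3 : forall x, `|f3 x| <= M).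

Definition expansion_coef (c : R) :=
  mean P (fun w => B 1 w ^+ 2 * f3 (c * (B 1 w * zs w))).

Variables (n N : nat) (tau h : R).
Hypotheses (n0 : (0 < n)%N) (N0 : (0 < N)%N) (tau0 : 0 < tau) (h0 : 0 < h)
  (tauN : tau + N%:R * h = 1).
Let a k : R := Num.sqrt n%:R * node tau h k ^+ n.
Local Notation v := (grid_var N h a).
Local Notation kappa := (second_coef N h a).

(** The four terms of the bound are, in order, the discretisation of Z, the Taylor remainder, the
    change of scale from sqrt(tau v) to 1 / sqrt 2 in the main term, and the error in the correction
    term. *)
Lemma level_n_estimate (Z : T -> R) : measurable_fun [set: T] Z ->
  is_ito_integral B (fun t w => Num.sqrt n%:R * t ^+ n * B t w) Z ->
  `|mean P (fun w => f (Z w)) -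
    mean P (fun w => f ((Num.sqrt 2)^-1 * (B 1 w * zs w))) -
    (3 * Num.sqrt n%:R)^-1 * expansion_coef (Num.sqrt 2)^-1| <=
  M * Num.sqrt (4 * (n%:R * tau ^+ (2 * n) + 2 * n%:R * (n%:R ^+ 2 * h ^+ 2 + h))) +
  M * ((1 - tau) * v) + M * `|Num.sqrt tau * Num.sqrt v - (Num.sqrt 2)^-1| +
  `|kappa * tau * expansion_coef (Num.sqrt tau * Num.sqrt v) -
    (3 * Num.sqrt n%:R)^-1 * expansion_coef (Num.sqrt 2)^-1|.
Proof.
move=> mZ hZ; have M0 : 0 <= M by exact: le_trans (b1 0).
have tauN' : tau + N%:R * h <= 1 by rewrite tauN.
have a0 k : (k < N)%N -> 0 < a k.
  move=> _; rewrite mulr_gt0 ?sqrtr_gt0 ?ltr0n// exprn_gt0//.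
  by rewrite ltr_pwDl// mulr_ge0// ltW.
have [iZ iS2 dZ] := grid_approx hB n0 tau0 h0 tauN mZ hZ.
set c := Num.sqrt tau * _; set c2 := (Num.sqrt 2)^-1.
set e := _ + 2 * n%:R * _ in dZ *.
set S := (fun w => _ + _) in iS2 dZ.
have iS := L2_L1 iS2.
have iBz : L1 P (fun w => B 1 w * zs w).
  by apply: L1M => //; case: (path_moments hB ltr01 (lexx 1)).
have E1 : `|mean P (fun w => f (Z w)) - mean P (fun w => f (S w))| <=
    M * Num.sqrt (4 * e).
  apply: (le_trans (mean_lipschitz df b1 (L2_L1 iZ) iS)); rewrite ler_wpM2l//.
  apply: (le_trans (mean_norm_le_sqrt (L2B iZ iS2))).
  exact: ler_wsqrtr.
have E2 := grid_expansion hB tau0 h0 tauN' a0 N0 mzs pzs df df1 df2 cf3 b1 b2 b3.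
rewrite -/S -/c -/(expansion_coef c) in E2.
have E3 : `|mean P (fun w => f (c * (B 1 w * zs w))) -
    mean P (fun w => f (c2 * (B 1 w * zs w)))| <= M * `|c - c2|.
  apply: (le_trans (mean_lipschitz df b1 (L1Z c iBz) (L1Z c2 iBz))).
  rewrite ler_wpM2l//.
  have -> : mean P (fun w => `|c * (B 1 w * zs w) - c2 * (B 1 w * zs w)|) =
      `|c - c2| * mean P (fun w => `|B 1 w * zs w|).
    rewrite -meanZ; last exact: L1_abs.
    by apply: eq_mean => w; rewrite -normrM; congr `|_|; ring.
  rewrite ler_piMr//.
  have [[mB iB] mB2] := path_moments hB ltr01 (lexx 1).
  have [_ iz2] := izs.
  (* E|B_1 zs| <= 1 by |x y| <= (x^2 + y^2) / 2, both second moments being 1. *)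
  apply: (@le_trans _ _ (mean P (fun w => 2^-1 * (B 1 w ^+ 2 + zs w ^+ 2)))).
    apply: le_mean; [exact: L1_abs|exact/L1Z/L1D|].
    move=> w; rewrite normrM.
    rewrite -[B 1 w ^+ 2]real_normK ?num_real// -[zs w ^+ 2]real_normK ?num_real//.
    by have := sqr_ge0 (`|B 1 w| - `|zs w|); lra.
  by rewrite meanZ ?meanD ?mB2 ?zs2; [lra|..]; rewrite //; exact: L1D.
move: E1 E2 E3; rewrite /c2 -/c2.
move: (mean P (fun w => f (Z w))) (mean P (fun w => f (S w)))
  (mean P (fun w => f (c * (B 1 w * zs w)))) (mean P (fun w => f (c2 * (B 1 w * zs w))))
  (kappa * tau * expansion_coef c) ((3 * Num.sqrt n%:R)^-1 * expansion_coef c2)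
  (M * Num.sqrt (4 * e)) (M * ((1 - tau) * v)) (M * `|c - c2|).
move=> m1 m2 m3 m4 k1 k2 r1 r2 r3 E1 E2 E3.
rewrite (_ : m1 - m4 - k2 = (m1 - m2) + (m2 - m3 - k1) + (m3 - m4) + (k1 - k2)); last by ring.
apply: (le_trans (ler_normD _ _)); rewrite lerD2r.
apply: (le_trans (ler_normD _ _)); apply: lerD => //.
by apply: (le_trans (ler_normD _ _)); apply: lerD.
Qed.

End level_n.

(** * Refining the grid *)

Section rates.
Context (R : realType).

(* With q = n^(-1/4), the part of [0, 1] that is cut off at tau = 1 - q^3 has
   n tau^(2n) = O(n exp(- 2 / q)), while sqrt n (1 - tau) = q. As n q^4 = 1, the
   interval [tau, 1] consists of n^4 cells of length q^19. *)
Definition rate n : R := (Num.sqrt (Num.sqrt n%:R))^-1.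

Lemma rate_props n : (1 < n)%N ->
  [/\ 0 < rate n, rate n < 1, n%:R * rate n ^+ 4 = 1 & Num.sqrt n%:R * rate n ^+ 2 = 1].
Proof.
move=> n1; have n0 : 0 < n%:R :> R by rewrite ltr0n ltnW.
have s0 : 0 < Num.sqrt n%:R :> R by rewrite sqrtr_gt0.
have s20 : 0 < Num.sqrt (Num.sqrt n%:R) :> R by rewrite sqrtr_gt0.
have h2 : Num.sqrt n%:R * rate n ^+ 2 = 1.
  by rewrite /rate exprVn sqr_sqrtr ?(ltW s0)// divff// gt_eqF.
split=> //; first by rewrite invr_gt0.
- rewrite invf_lt1// -[X in X < _]sqrtr1 ltr_sqrt// -[X in X < _]sqrtr1 ltr_sqrt//.
  by rewrite ltr1n.
- by rewrite -[n%:R]sqr_sqrtr ?(ltW n0)// (_ : 4 = 2 * 2)%N// exprM -exprMn h2 expr1n.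
Qed.

(* (1 - q^3)^n <= exp(- n q^3) = exp(- 1 / (16 q))^16 <= (16 q)^16 *)
Lemma rate_pow n : (1 < n)%N -> (1 - rate n ^+ 3) ^+ n <= 16 ^+ 16 * rate n ^+ 16.
Proof.
move=> n1; have [q0 q1 q4 _] := rate_props n1; set q := rate n in q0 q1 q4 *.
have q3 : 0 <= 1 - q ^+ 3 by rewrite subr_ge0 exprn_ile1// ltW.
apply: (@le_trans _ _ (expR (- q ^+ 3) ^+ n)).
  by rewrite lerXn2r ?nnegrE ?expR_ge0// expR_ge1Dx.
rewrite -expRM_natl mulrN expRN -[leRHS]invrK lef_pV2 ?posrE ?expR_gt0//; last first.
  by rewrite invr_gt0 mulr_gt0// exprn_gt0.
have -> : n%:R * q ^+ 3 = 16%:R * (q^-1 / 16).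
  apply: (mulIf (lt0r_neq0 q0)); rewrite -mulrA -exprSr q4.
  by field; rewrite gt_eqF.
rewrite expRM_natl invfM -!exprVn -exprMn lerXn2r ?nnegrE ?expR_ge0//.
  by rewrite mulr_ge0 ?invr_ge0 ?(ltW q0).
apply: le_trans (expR_ge1Dx _); rewrite mulrC.
by rewrite lerDr.
Qed.

Lemma rate_cvg : rate n @[n --> \oo] --> (0 : R).
Proof.
apply/cvgrPdist_le => e e0; near=> n.
have n1 : (1 < n)%N by near: n; exact: nbhs_infty_gt.
have [q0 q1 q4 _] := rate_props n1.
rewrite sub0r normrN (gtr0_norm q0).
rewrite -(@ler_pXn2r _ 4)// ?nnegrE ?(ltW q0) ?(ltW e0)//.
have n0 : 0 < n%:R :> R by rewrite ltr0n ltnW.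
rewrite -(ler_pM2l n0) q4 -ler_pdivrMr ?exprn_gt0// mul1r.
by near: n; exact: nbhs_infty_ger.
Unshelve. all: by end_near. Qed.

Lemma cvg_rate_bound (x : nat -> R) (l C : R) :
  (forall n, (1 < n)%N -> `|x n - l| <= C * rate n) -> x n @[n --> \oo] --> l.
Proof.
move=> xl; apply/cvgrPdist_le => e e0.
have c0 : C * rate n @[n --> \oo] --> (0 : R).
  by rewrite -[0](mulr0 C); apply: cvgMr; exact: rate_cvg.
near=> n; have n1 : (1 < n)%N by near: n; exact: nbhs_infty_gt.
rewrite distrC (le_trans (xl n n1))//.
apply: le_trans (ler_norm _) _; rewrite -[_ * _]subr0 distrC.
near: n; move/cvgrPdist_le : c0; exact.
Unshelve. all: by end_near. Qed.

Definition rtau n : R := 1 - rate n ^+ 3.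
(** With n = q^(-4) this gives n^2 h = q^11, so even the mesh errors multiplied by n^2 are positive
    powers of q. *)
Definition rstep n : R := rate n ^+ 19.
Definition rcoef n k : R := Num.sqrt n%:R * node (rtau n) (rstep n) k ^+ n.
Definition rvar n : R := grid_var (n ^ 4) (rstep n) (rcoef n).
Definition rkappa n : R := second_coef (n ^ 4) (rstep n) (rcoef n).

Lemma rate_grid n : (1 < n)%N ->
  [/\ 0 < rtau n, 0 < rstep n & rtau n + (n ^ 4)%:R * rstep n = 1].
Proof.
move=> n1; have [q0 q1 q4 _] := rate_props n1; split.
- by rewrite subr_gt0 exprn_ilt1// ltW.
- exact: exprn_gt0.
- rewrite natrX /rtau /rstep.
  rewrite (_ : n%:R ^+ 4 * rate n ^+ 19 = (n%:R * rate n ^+ 4) ^+ 4 * rate n ^+ 3); last by ring.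
  by rewrite q4; ring.
Qed.

Local Notation K := (16 ^+ 16 : R).

(** [K] comes from the bound on tau^n; the 3 counts 1/n = q^4 once and n h = q^15 twice. *)
Lemma rvar_bounds n : (1 < n)%N ->
  0 <= 2^-1 - rvar n <= (K + 3) * rate n ^+ 3.
Proof.
move=> n1; have [q0 q1 q4 _] := rate_props n1; have [t0 h0 tN] := rate_grid n1.
have n0 := ltnW n1; have N0 : (0 < n ^ 4)%N by rewrite expn_gt0 n0.
have /andP[v0 v1] := grid_var_bounds t0 h0 tN n0 N0.
rewrite -/(rcoef n) -/(rvar n) in v0 v1; rewrite v0/=; apply: (le_trans v1).
have tn := rate_pow n1; rewrite -/(rtau n) in tn.
set q := rate n in q0 q1 q4 tn *.
have nV : n%:R^-1 = q ^+ 4.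
  by apply: (mulfI (x := n%:R)); rewrite ?pnatr_eq0 ?gtn_eqF// q4 divff// pnatr_eq0 gtn_eqF.
have qX m : (3 <= m)%N -> q ^+ m <= q ^+ 3.
  by move=> m3; rewrite ler_wiXn2l// ltW.
have nh : n%:R * rstep n = q ^+ 15.
  by rewrite /rstep -/q -[19%N]/(4 + 15)%N exprD mulrA q4 mul1r.
rewrite nV -mulrA nh.
have K0 : 0 <= K by rewrite exprn_ge0.
have h4 := qX 4%N isT; have h15 := qX 15%N isT; have h16 := qX 16%N isT.
have Kq : K * q ^+ 16 <= K * q ^+ 3 by rewrite ler_wpM2l.
rewrite [leRHS]mulrDl.
move: tn Kq; move: (K * _) (K * _) => x y; lra.
Qed.

(** The bound becomes q^4 + 5 (K q^8 + q^11), whence 5 K + 6. *)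
Lemma rkappa_bounds n : (1 < n)%N ->
  0 <= Num.sqrt n%:R * rkappa n <= 3^-1 /\
  3^-1 - Num.sqrt n%:R * rkappa n <= (5 * K + 6) * rate n.
Proof.
move=> n1; have [q0 q1 q4 _] := rate_props n1; have [t0 h0 tN] := rate_grid n1.
have n0 := ltnW n1; have N0 : (0 < n ^ 4)%N by rewrite expn_gt0 n0.
have [k0 k1] := second_coef_bounds t0 h0 tN n0 N0.
split; first exact: k0.
apply: (le_trans k1).
have tn := rate_pow n1; rewrite -/(rtau n) in tn.
set q := rate n in q0 q1 q4 tn *.
have nV : n%:R^-1 = q ^+ 4.
  by apply: (mulfI (x := n%:R)); rewrite ?pnatr_eq0 ?gtn_eqF// q4 divff// pnatr_eq0 gtn_eqF.
have qX m : (1 <= m)%N -> q ^+ m <= q.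
  by move=> m1; rewrite -[leRHS]expr1 ler_wiXn2l// ltW.
have n2 m : n%:R ^+ 2 * q ^+ (8 + m) = q ^+ m.
  by rewrite exprD (_ : 8 = 4 * 2)%N// exprM mulrA -exprMn q4 expr1n mul1r.
have K0 : 0 <= K by rewrite exprn_ge0.
rewrite nV.
apply: (@le_trans _ _ (q ^+ 4 + 5 * (K * q ^+ 8 + q ^+ 11))).
  rewrite lerD2l -mulrA ler_wpM2l// -(n2 8) -(n2 11) mulrCA -mulrDr.
  by rewrite ler_wpM2l ?sqr_ge0// lerD2r.
have h4 := qX 4%N isT; have h8 := qX 8%N isT; have h11 := qX 11%N isT.
have Kq : K * q ^+ 8 <= K * q by rewrite ler_wpM2l.
rewrite [leRHS]mulrDl -[X in _ <= X + _](mulrA 5).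
move: Kq; move: (K * _) (K * _) => x y; lra.
Qed.

(** Moved under the root, the factor n leaves 4 (K + 4) q^2: [K] for the part before tau, 4 for 2
    (q^22 + q^11). As K + 4 >= 1, it bounds its own root. *)
Lemma sqrt_error n : (1 < n)%N ->
  Num.sqrt n%:R * Num.sqrt (4 * (n%:R * rtau n ^+ (2 * n) +
    2 * n%:R * (n%:R ^+ 2 * rstep n ^+ 2 + rstep n))) <= 2 * (K + 4) * rate n.
Proof.
move=> n1; have [q0 q1 q4 _] := rate_props n1; have [t0 h0 tN] := rate_grid n1.
have tn := rate_pow n1; rewrite -/(rtau n) in tn.
have tau1 : rtau n <= 1 by rewrite -tN lerDl mulr_ge0// ltW.
set q := rate n in q0 q1 q4 tn *.
have n2 m : n%:R ^+ 2 * q ^+ (8 + m) = q ^+ m.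
  by rewrite exprD (_ : 8 = 4 * 2)%N// exprM mulrA -exprMn q4 expr1n mul1r.
have K0 : 0 <= K by rewrite exprn_ge0.
have qX m p : (p <= m)%N -> q ^+ m <= q ^+ p.
  by move=> pm; rewrite ler_wiXn2l// ltW.
have q00 := ltW q0.
rewrite -sqrtrM// -[leRHS]ger0_norm; last by rewrite !mulr_ge0// addr_ge0.
rewrite -sqrtr_sqr ler_wsqrtr//.
have t2n : rtau n ^+ (2 * n) <= K * q ^+ 16.
  by apply: le_trans tn; rewrite ler_wiXn2l ?(ltW t0)// mul2n -addnn leq_addr.
apply: (@le_trans _ _ (4 * ((K + 4) * q ^+ 2))); last first.
  have : K + 4 <= (K + 4) ^+ 2 by rewrite expr2 ler_peMl//; lra.
  move: (K + 4) => k h.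
  rewrite [leRHS](_ : _ = 4 * (k ^+ 2 * q ^+ 2)); last by ring.
  by rewrite ler_wpM2l// ler_wpM2r// exprn_ge0.
rewrite (_ : n%:R * (4 * (n%:R * rtau n ^+ (2 * n) +
    2 * n%:R * (n%:R ^+ 2 * rstep n ^+ 2 + rstep n))) =
  4 * (n%:R ^+ 2 * rtau n ^+ (2 * n) + 2 * (n%:R ^+ 2 * (n%:R ^+ 2 * rstep n ^+ 2) +
    n%:R ^+ 2 * rstep n))); last by ring.
rewrite ler_wpM2l//.
have -> : n%:R ^+ 2 * (n%:R ^+ 2 * rstep n ^+ 2) = q ^+ 22.
  by rewrite /rstep -/q -exprM (n2 30) (n2 22).
have -> : n%:R ^+ 2 * rstep n = q ^+ 11 by rewrite /rstep -/q (n2 11).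
have h1 : n%:R ^+ 2 * rtau n ^+ (2 * n) <= K * q ^+ 2.
  apply: (@le_trans _ _ (n%:R ^+ 2 * (K * q ^+ 16))).
    by rewrite ler_wpM2l// sqr_ge0.
  by rewrite mulrCA (n2 8) ler_wpM2l// qX.
have h2 := qX 22%N 2%N isT; have h3 := qX 11%N 2%N isT.
rewrite [leRHS]mulrDl; move: h1 h2 h3; move: (K * _) (n%:R ^+ 2 * rtau n ^+ (2 * n)) => x y.
lra.
Qed.

End rates.

(** x - 1/2 factors as a difference of squares, and the sum of the two roots is at least 1 / sqrt 2
    >= 1/2. *)
Lemma sqrt_half_dist (R : realType) (x : R) : 0 <= x ->
  `|Num.sqrt x - (Num.sqrt 2)^-1| <= 2 * `|x - 2^-1|.
Proof.
move=> x0; rewrite -sqrtrV//; set y := Num.sqrt 2^-1.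
have y2 : y ^+ 2 = 2^-1 by rewrite sqr_sqrtr ?invr_ge0.
have y1 : 2^-1 <= y.
  have y0 : 0 <= y by exact: sqrtr_ge0.
  by rewrite leNgt; apply/negP => yl; move: y2; nra.
rewrite -[X in 2 * `|X - _|]sqr_sqrtr// -y2 subr_sqr normrM.
rewrite mulrCA ler_peMr// ger0_norm; last by rewrite addr_ge0 ?sqrtr_ge0.
by have := sqrtr_ge0 x; lra.
Qed.

(** * Passage to the limit *)

Section expansion.
Context (R : realType) (d : measure_display) (T : measurableType d).
Variables (P : probability T R) (B : R -> {RV P >-> R}).
Hypothesis hB : standard_brownian_motion B.
Variable zs : T -> R.
Hypotheses (mzs : measurable_fun [set: T] zs) (pzs : standard_pair P (B 1) zs)
  (izs : L2 P zs) (zs2 : mean P (fun w => zs w ^+ 2) = 1).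
Variables (f f1 f2 f3 : R -> R) (M : R).
Hypotheses (df : forall x : R, is_derive x 1 f (f1 x))
  (df1 : forall x : R, is_derive x 1 f1 (f2 x))
  (df2 : forall x : R, is_derive x 1 f2 (f3 x)) (cf3 : continuous f3).
Hypotheses (b1 : forall x, `|f1 x| <= M) (b2 : forall x, `|f2 x| <= M)
  (b3 : forall x, `|f3 x| <= M).
Variable Z : nat -> T -> R.
Hypotheses (mZ : forall n, measurable_fun [set: T] (Z n))
  (hZ : forall n, (1 <= n)%N ->
    is_ito_integral B (fun t w => Num.sqrt n%:R * t ^+ n * B t w) (Z n)).

Local Notation K := (16 ^+ 16 : R).
Local Notation coef := (expansion_coef B zs f3).
Let scale n : R := Num.sqrt (rtau R n) * Num.sqrt (rvar R n).
Let kappa n : R := Num.sqrt n%:R * rkappa R n * rtau R n.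
Let J : R := coef (Num.sqrt 2)^-1.
Let err n : R := mean P (fun w => f (Z n w)) -
  mean P (fun w => f ((Num.sqrt 2)^-1 * (B 1 w * zs w))) - (3 * Num.sqrt n%:R)^-1 * J.

Let rvar_half n : (1 < n)%N -> 0 <= rvar R n <= 2^-1.
Proof.
move=> n1; have /andP[v0 _] := rvar_bounds R n1.
rewrite subr_ge0 in v0; rewrite v0 andbT /rvar /grid_var.
have [t0 h0 _] := rate_grid R n1.
by rewrite mulr_ge0 ?(ltW h0)//; apply: sumr_ge0 => i _; exact: sqr_ge0.
Qed.

(** 1/2 - tau v = (1/2 - v) + q^3 v, doubled by [sqrt_half_dist]. *)
Let scale_dist n : (1 < n)%N ->
  `|scale n - (Num.sqrt 2)^-1| <= (2 * K + 8) * rate R n ^+ 3.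
Proof.
move=> n1; have [q0 q1 _ _] := rate_props R n1; have [t0 h0 tN] := rate_grid R n1.
have /andP[v0 v1] := rvar_half n1; have /andP[_ v2] := rvar_bounds R n1.
rewrite /scale -sqrtrM ?(ltW t0)//.
apply: (le_trans (sqrt_half_dist (mulr_ge0 (ltW t0) v0))).
have x0 : 0 <= rate R n ^+ 3 by rewrite exprn_ge0// ltW.
have tE : rtau R n = 1 - rate R n ^+ 3 by [].
move: v0 v1 v2 t0 x0; rewrite tE; move: (rvar R n) (rate R n ^+ 3) K => v x k.
move=> v0 v1 v2 t0 x0; rewrite distrC ger0_norm; nra.
Qed.

Let kappa_dist n : (1 < n)%N -> `|kappa n - 3^-1| <= (5 * K + 7) * rate R n.
Proof.
move=> n1; have [q0 q1 _ _] := rate_props R n1; have [t0 h0 tN] := rate_grid R n1.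
have [/andP[k0 k1] k2] := rkappa_bounds R n1; rewrite /kappa /rtau.
have q3 : rate R n ^+ 3 <= rate R n by rewrite -[leRHS]expr1 ler_wiXn2l// ltW.
have q30 : 0 <= rate R n ^+ 3 by rewrite exprn_ge0// ltW.
move: k0 k1 k2 q0 q3 q30; move: (_ * rkappa R n) (rate R n ^+ 3) (rate R n) K => k x q c.
move=> k0 k1 k2 q0 q3 q30; rewrite distrC ger0_norm; nra.
Qed.

(** As sqrt n q^3 = q, the constants add up to 2 (K + 4) + 1 + (2 K + 8) = 4 K + 17, for
    discretisation, Taylor remainder and change of scale. *)
Let scaled_error n : (1 < n)%N ->
  `|Num.sqrt n%:R * err n| <= M * (4 * K + 17) * rate R n +
    `|kappa n * coef (scale n) - 3^-1 * J|.
Proof.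
move=> n1; have [q0 q1 q4 q2] := rate_props R n1; have [t0 h0 tN] := rate_grid R n1.
have n0 := ltnW n1; have N0 : (0 < n ^ 4)%N by rewrite expn_gt0 n0.
have s0 : 0 < Num.sqrt n%:R :> R by rewrite sqrtr_gt0 ltr0n.
have M0 : 0 <= M by exact: le_trans (b1 0).
have := level_n_estimate hB mzs pzs izs zs2 df df1 df2 cf3 b1 b2 b3 n0 N0 t0 h0 tN
  (mZ n) (hZ n0).
rewrite -/(rcoef R n) -/(rvar R n) -/(rkappa R n) -/(scale n) -/J -/(err n).
rewrite -(ler_pM2l s0) normrM gtr0_norm// => /le_trans; apply.
have e1 := sqrt_error R n1.
have e2 := scale_dist n1.
have /andP[v0 v1] := rvar_half n1.
have q3 : Num.sqrt n%:R * rate R n ^+ 3 = rate R n by rewrite exprSr mulrA q2 mul1r.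
have -> : kappa n * coef (scale n) - 3^-1 * J = Num.sqrt n%:R *
    (rkappa R n * rtau R n * coef (scale n) - (3 * Num.sqrt n%:R)^-1 * J).
  by rewrite /kappa invfM; field; rewrite gt_eqF.
rewrite mulrDr [X in _ <= _ + X]normrM (gtr0_norm s0) lerD2r.
have e3 : Num.sqrt n%:R * ((1 - rtau R n) * rvar R n) <= rate R n.
  rewrite /rtau (_ : 1 - (1 - _) = rate R n ^+ 3); last by ring.
  by rewrite mulrA q3 ler_piMr ?(ltW q0)//; lra.
have e4 : Num.sqrt n%:R * `|scale n - (Num.sqrt 2)^-1| <= (2 * K + 8) * rate R n.
  by rewrite -[X in _ <= _ * X]q3 mulrCA ler_wpM2l// ltW.
move: e1 e3 e4; move: (Num.sqrt n%:R) (Num.sqrt (4 * _)) ((1 - _) * _) `|_ - _| K.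
move=> s x y z k e1 e3 e4.
rewrite (_ : s * _ = M * (s * x + s * y + s * z)); last by ring.
by rewrite -mulrA ler_wpM2l//; lra.
Qed.

(** All terms are O(q) except the coefficient at the varying scale, which converges by continuity of
    [f3] alone. *)
Lemma expansion_error_cvg : Num.sqrt n%:R * err n @[n --> \oo] --> (0 : R).
Proof.
have cs : scale n @[n --> \oo] --> (Num.sqrt 2)^-1.
  apply: (@cvg_rate_bound _ _ _ (2 * K + 8)) => n n1.
  apply: (le_trans (scale_dist n1)); rewrite ler_wpM2l ?addr_ge0 ?mulr_ge0 ?exprn_ge0//.
  have [q0 q1 _ _] := rate_props R n1.
  by rewrite -[leRHS]expr1 ler_wiXn2l// ltW.
have ck : kappa n @[n --> \oo] --> (3^-1 : R) by exact: cvg_rate_bound kappa_dist.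
have [iB2 _] := path_moments hB ltr01 (lexx 1).
have cJ : coef (scale n) @[n --> \oo] --> J.
  apply: (cvg_mean_bounded _ _ cf3 b3 cs); first by case: iB2.
  exact: measurable_funM.
have c0 : kappa n * coef (scale n) - 3^-1 * J @[n --> \oo] --> (0 : R).
  by rewrite -(subrr (3^-1 * J)); apply: cvgB; [exact: cvgM|exact: cvg_cst].
have cb : M * (4 * K + 17) * rate R n +
    `|kappa n * coef (scale n) - 3^-1 * J| @[n --> \oo] --> (0 : R).
  rewrite -[0]addr0; apply: cvgD.
    by rewrite -[0](mulr0 (M * (4 * K + 17))); apply: cvgMr; exact: rate_cvg.
  by rewrite -[0](@normr0 _ R); exact: cvg_norm.
apply/cvgrPdist_le => e e0; near=> n; rewrite sub0r normrN.
have n1 : (1 < n)%N by near: n; exact: nbhs_infty_gt.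
apply: (le_trans (scaled_error n1)); apply: (le_trans (ler_norm _)).
rewrite -[X in `|X|]subr0 distrC.
near: n; move/cvgrPdist_le : cb; exact.
Unshelve. all: by end_near. Qed.

End expansion.

(** Positivity is asked for n > 0 only because [s] will be sqrt n, which vanishes at 0. *)
Lemma eqaddo_inv (R : realType) (x y s : nat -> R) :
  (forall n, (0 < n)%N -> 0 < s n) ->
  s n * (x n - y n) @[n --> \oo] --> (0 : R) ->
  (x : nat -> R^o) = y +o_\oo (fun n => (s n)^-1 : R^o).
Proof.
move=> s0 /cvgrPdist_le lim0; apply/eqaddoP => e e0; near=> n.
have n0 : (0 < n)%N by near: n; exact: nbhs_infty_gt.
rewrite normfV (gtr0_norm (s0 n n0)) ler_pdivlMr ?s0// mulrC.
rewrite -[X in X * _](gtr0_norm (s0 n n0)) -normrM -[X in `|X|]subr0 distrC.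
near: n; exact: lim0.
Unshelve. all: by end_near. Qed.

Theorem mainTheorem6 (R : realType) (d : measure_display)
    (T : measurableType d) (P : probability T R)
    (B : R -> {RV P >-> R}) (zeta : {RV P >-> R}) (Z : nat -> {RV P >-> R})
    (hB : standard_brownian_motion B)
    (hzeta : has_normal_law P zeta 0 1)
    (hindep : indep_RV_sigma P zeta (natural_filtration (fun t => B t : T -> R) 1))
    (hZ : forall n, (1 <= n)%N ->
      is_ito_integral B (fun t w => Num.sqrt n%:R * t ^+ n * B t w) (Z n))
    (f : R -> R) (hf : C3b f) :
  (fun n : nat => fine 'E_P[fun w => f (Z n w)]%E : R^o) =
    (fun n : nat =>
       fine 'E_P[fun w => f ((Num.sqrt 2)^-1 * `|B 1 w| * zeta w)%R]%E +
       (3 * Num.sqrt n%:R)^-1 *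
         fine 'E_P[fun w => (B 1 w ^+ 2 *
                     f^`(3)%classic ((Num.sqrt 2)^-1 * `|B 1 w| * zeta w))%R]%E)
    +o_\oo (fun n : nat => (Num.sqrt n%:R)^-1 : R^o).
Proof.
have [M [[df df1 df2 cf3] [b1 b2 b3]]] := C3b_derivatives hf.
have mB : measurable_fun [set: T] (B 1) by exact: measurable_funP.
have mz : measurable_fun [set: T] zeta by exact: measurable_funP.
have nB : has_normal_law P (B 1) 0 1.
  by have := path_law hB ltr01 (lexx 1); rewrite sqrtr1.
have iz : indep_RV P zeta (B 1).
  move=> A C mA mC; apply: hindep => //.
  by have /knownP := @known_path _ _ _ _ B _ _ ler01 (lexx 1); exact.
(* The sign at 0 is taken to be +, so that zs^2 = zeta^2 at every point and the moments carry
   over. *)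
pose zs w := if 0 <= B 1 w then zeta w else - zeta w.
have zsE c w : c * `|B 1 w| * zeta w = c * (B 1 w * zs w).
  by rewrite /zs; case: ger0P => _; rewrite ?mulrNN ?mulrA// -!mulrA ?mulNr ?mulrN.
have mzs : measurable_fun [set: T] zs.
  apply: measurable_fun_ifT => //; first exact: measurable_fun_ler.
  exact: measurableT_comp.
have pzs : standard_pair P (B 1) zs by exact: sign_standard_pair.
have [[_ iz2] _ mz2] := standard_normal_moments mz hzeta.
have zs2 w : zs w ^+ 2 = zeta w ^+ 2 by rewrite /zs; case: ifP; rewrite ?sqrrN.
have izs : L2 P zs by split=> //; rewrite (_ : (fun w => _) = fun w => zeta w ^+ 2)//;
  apply/funext => w; exact: zs2.
have mzs2 : mean P (fun w => zs w ^+ 2) = 1 by rewrite -mz2; exact: eq_mean.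
apply: eqaddo_inv => [n n0|]; first by rewrite sqrtr_gt0 ltr0n.
rewrite [X in X @ _ --> _](_ : _ = fun n => Num.sqrt n%:R *
    (mean P (fun w => f (Z n w)) -
     mean P (fun w => f ((Num.sqrt 2)^-1 * (B 1 w * zs w))) -
     (3 * Num.sqrt n%:R)^-1 * expansion_coef B zs f^`(3)%classic (Num.sqrt 2)^-1)).
  exact: (expansion_error_cvg hB mzs pzs izs mzs2 df df1 df2 cf3 b1 b2 b3
    (fun n => measurable_funP (Z n)) hZ).
have congr_expansion (s a c m x m' x' : R) : m = m' -> x = x' ->
  s * (a - (m + c * x)) = s * (a - m' - c * x') by move=> -> ->; ring.
apply/funext => n; rewrite !fine_expectation.
by apply: congr_expansion; apply: eq_mean => w; rewrite zsE.
Qed.
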